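(* Let $S\subset\mathbb{R}^p$ ($p\ge1$) be a non-empty Borel set, let $\alpha>0$, and let $\mathrm{Cov}^*$ be a correlation function on $S$ such that the matrix $(\mathrm{Cov}^*(s_{j_1},s_{j_2}))_{1\le j_1,j_2\le d}$ is non-singular for all distinct $s_1,\dots,s_d\in S$. Let $\mathbf{W}_1,\mathbf{W}_2,\dots$ be iid replications of a standard Gaussian random field $\mathbf{W}=\{W(s),s\in S\}$ (centered, with unit variances) with covariance function $\mathrm{Cov}^*$, and let $\{V_i\}_{i\ge1}$ be the points of a Poisson process on $(0,\infty)$ with intensity measure $\alpha v^{-(\alpha+1)}\,dv$, independent of $(\mathbf{W}_i)_{i\ge1}$. Then the process defined by $$\mathbf{Z}=\{Z(s)\}=\left\{m_\alpha^{-1/\alpha}\max_{i=1,2,\dots}V_iW_i(s)\right\}\quad(s\in S),\qquad m_\alpha=\pi^{-1/2}\,2^{(\alpha-2)/2}\,\Gamma\!\left(\tfrac{\alpha+1}{2}\right),$$ where $\Gamma$ is the Gamma function, is an extremal $t$ process with $\alpha$-Fréchet marginal distributions whose dependence structure is characterized by $\alpha$ general degrees of freedom and the correlation function $\mathrm{Cov}^*$. That is, $\mathbf{Z}$ is max-stable, $\mathbb{P}(Z(s)\le z)=\exp(-z^{-\alpha})$ for $z>0$ and $s\in S$, and for all $d\ge1$, all distinct $s_1,\dots,s_d\in S$ and all $\mathbf{z}\in(0,\infty)^d$, with $\Sigma^*=(\mathrm{Cov}^*(s_{j_1},s_{j_2}))_{1\le j_1,j_2\le d}$, $$-\log\mathbb{P}\left(Z(s_j)^\alpha\le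 z_j,\ j=1,\dots,d\right)=\sum_{j=1}^d z_j^{-1}\,t_{\alpha+1}\!\left((\mathbf{z}_{-j}/z_j)^{1/\alpha}\;\middle|\;\Sigma^*_{-j,j},\,(\alpha+1)^{-1}\left(\Sigma^*_{-j,-j}-\Sigma^*_{-j,j}(\Sigma^*_{-j,j})^{T}\right)\right).$$
   Context: Conventions: operations on vectors (maxima, arithmetic, powers, inequalities) are componentwise. Multivariate $t$ distribution: for $\nu>0$, $\boldsymbol\mu\in\mathbb{R}^d$ and a positive definite matrix $\Sigma=AA^T$ ($A$ an invertible $d\times d$ matrix), $t_\nu(\boldsymbol{\mu},\Sigma)$ is the law of $\boldsymbol{\mu}+R_dA\mathbf{U}$, where $\mathbf{U}$ is uniform on the Euclidean unit sphere of $\mathbb{R}^d$ and $R_d\ge0$ is independent of $\mathbf{U}$ with $d^{-1}R_d^2\sim F_{d,\nu}$ (the $F$-distribution with $d$ and $\nu$ degrees of freedom). $t_\nu(\mathbf{x}\mid\boldsymbol{\mu},\Sigma)=\mathbb{P}(\mathbf{X}\le\mathbf{x})$ denotes its distribution function, where $\mathbf{X}\sim t_\nu(\boldsymbol\mu,\Sigma)$. Submatrix notation: for a $d\times d$ matrix $\Sigma^*=(\sigma^*_{j_1j_2})$, $\Sigma^*_{-j,-j}$ is obtained by deleting row $j$ and column $j$, and $\Sigma^*_{-j,j}$ is the $j$-th column with its $j$-th entry removed; $\mathbf{z}_{-j}$ is $\mathbf{z}$ with its $j$-th entry removed. For $d=1$ the formula is read as $z^{-1}$. Max-stability: a random vector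 $\mathbf{Z}$ with nondegenerate univariate margins is max-stable if, for iid copies $\mathbf{Z}_1,\mathbf{Z}_2,\dots$, there are vectors $\mathbf{a}_n>\mathbf{0}$, $\mathbf{b}_n$ with $\max_{i\le n}\mathbf{a}_n^{-1}(\mathbf{Z}_i-\mathbf{b}_n)\overset{d}{=}\mathbf{Z}$ for every $n\ge1$. A process is max-stable if its finite-dimensional distributions are. Extremal $t$ process with $\nu>0$ general degrees of freedom and correlation function $\mathrm{Cov}^*$: a max-stable process on $S$ whose dependence function at any distinct sites $s_1,\dots,s_d$ is the right-hand side of the last displayed formula of the claim with $\alpha$ replaced by $\nu$; for a max-stable vector with $\alpha$-Fréchet margins, the dependence function is $M(\mathbf{z})=-\log\mathbb{P}(\mathbf{Z}^\alpha\le\mathbf{z})$. The points $V_i$ may be taken in descending order, $V_1\ge V_2\ge\cdots$. *)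

(* Defs.v *)
From HB Require Import structures.
From mathcomp Require Import all_boot all_order all_algebra.
From mathcomp Require Import finmap.
From mathcomp Require Import all_classical all_reals all_analysis.
From mathcomp Require Import measurable_realfun.

Set Implicit Arguments.
Unset Strict Implicit.
Unset Printing Implicit Defensive.

Import Order.TTheory GRing.Theory Num.Theory.
Import numFieldNormedType.Exports.

Local Open Scope classical_set_scope.
Local Open Scope ring_scope.

(** * Borel sets, laws and independence *)

Definition borel (U : topologicalType) : set (set U) := <<s @open U >>.

Definition random_vector (T : Type) (R : realType) (n : nat)
    (X : 'I_n -> T -> R) (w : T) : 'cV[R]_n :=
  \col_j X j w.

Definition same_law (R : realType) (d d' : measure_display)
    (T : measurableType d) (P : probability T R)
    (T' : measurableType d') (P' : probability T' R) (n : nat)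
    (X : 'I_n -> T -> R) (Y : 'I_n -> T' -> R) : Prop :=
  forall B : set 'cV[R]_n, borel B ->
    P (random_vector X @^-1` B) = P' (random_vector Y @^-1` B).

(* The sigma-algebra sigma(X_i, i in I). *)
Definition sigma_generated (I T : Type) (R : realType) (X : I -> T -> R) :
    set (set T) :=
  <<s \bigcup_i preimage_set_system [set: T] (X i) measurable >>.

Definition independent2 (R : realType) (d : measure_display)
    (T : measurableType d) (P : probability T R) (F G : set (set T)) : Prop :=
  forall A B, F A -> G B -> P (A `&` B) = (P A * P B)%E.

Definition mutually_independent (R : realType) (d : measure_display)
    (T : measurableType d) (P : probability T R) (I : choiceType)
    (F : I -> set (set T)) : Prop :=
  forall (J : {fset I}) (E : I -> set T), (forall i, i \in J -> F i (E i)) ->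
    P (\bigcap_(i in [set` J]) E i) = (\prod_(i <- J) P (E i))%E.

(* The n-fold product of a measure m on the line, by Fubini's recursion
   m^(n+1)(B) = \int m^n(B_x) m(dx); it is meaningful on Borel sets B. *)
Fixpoint power_measure (R : realType) (m : {measure set (measurableTypeR R) -> \bar R})
    (n : nat) : set 'cV[R]_n -> \bar R :=
  match n with
  | 0 => fun B => (\1_B (0 : 'cV[R]_0))%:E
  | n'.+1 => fun B =>
      (\int[m]_x power_measure m
         [set y : 'cV[R]_n' | B (col_mx (x%:M : 'cV[R]_1) y)])%E
  end.

Definition lebesgue_measure_n (R : realType) (n : nat) :
    set 'cV[R]_n -> \bar R :=
  @power_measure R (@lebesgue_measure R) n.

Definition std_normal_prob_n (R : realType) (n : nat) :
    set 'cV[R]_n -> \bar R :=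
  @power_measure R (@normal_prob R 0 1) n.

(** * Gaussian random fields *)

(* X has the law of mu + A N, where N has iid N(0, 1) components; singular
   covariance matrices A A^T are allowed. *)
Definition gaussian_vector (R : realType) (d : measure_display)
    (T : measurableType d) (P : probability T R) (n : nat)
    (X : 'I_n -> T -> R) : Prop :=
  exists (mu : 'cV[R]_n) (k : nat) (A : 'M[R]_(n, k)),
    forall B : set 'cV[R]_n, borel B ->
      P (random_vector X @^-1` B)
      = std_normal_prob_n [set y | B (mu + A *m y)].

Definition gaussian_field (R : realType) (d : measure_display)
    (T : measurableType d) (P : probability T R) (S : Type)
    (W : S -> T -> R) : Prop :=
  forall (n : nat) (s : 'I_n -> S), gaussian_vector P (fun j => W (s j)).

Definition cov_matrix (R : realType) (S : Type) (Cov : S -> S -> R) (n : nat)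
    (s : 'I_n -> S) : 'M[R]_n :=
  \matrix_(i, j) Cov (s i) (s j).

Definition correlation_function (R : realType) (S : Type)
    (Cov : S -> S -> R) : Prop :=
  [/\ forall s, Cov s s = 1,
      forall s t, Cov s t = Cov t s
    & forall (n : nat) (s : 'I_n -> S) (c : 'I_n -> R),
        0 <= \sum_i \sum_j c i * c j * Cov (s i) (s j)].

(* Unit variances are covered by Cov s s = 1 when Cov is a correlation
   function. *)
Definition centered_gaussian_field (R : realType) (d : measure_display)
    (T : measurableType d) (P : probability T R) (S : Type)
    (Cov : S -> S -> R) (W : S -> {RV P >-> R}) : Prop :=
  [/\ gaussian_field P (fun s => W s : T -> R),
      forall s, ('E_P[W s] = 0)%E
    & forall s t, covariance P (W s) (W t) = (Cov s t)%:E].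

(** * Poisson processes on the half-line *)

Definition point_count (R : realType) (T : Type) (V : nat -> T -> R)
    (A : set R) (w : T) : \bar R :=
  counting [set i | A (V i w)].

Definition intensity_measure (R : realType) (f : R -> R) (A : set R) : \bar R :=
  (\int[lebesgue_measure]_(v in A) (f v)%:E)%E.

(* In poisson_prob rate k U, the argument k is not used. *)
Definition poisson_process (R : realType) (d : measure_display)
    (T : measurableType d) (P : probability T R)
    (V : nat -> {RV P >-> R}) (Lambda : set R -> \bar R) : Prop :=
  let N := point_count (fun i => V i : T -> R) in
  [/\ forall i w, 0 < V i w,
      forall A : set R, measurable A -> A `<=` `]0, +oo[ ->
        ((Lambda A < +oo)%E -> forall n : nat,
           P [set w | N A w = n%:R%:E]
           = poisson_prob (fine (Lambda A)) 0 [set n]) /\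
        (Lambda A = +oo%E -> P [set w | N A w = +oo%E] = 1%E)
    & forall (k : nat) (A : 'I_k -> set R),
        (forall i, measurable (A i) /\ A i `<=` `]0, +oo[) ->
        trivIset [set: 'I_k] A ->
        mutually_independent P
          (fun i => preimage_set_system [set: T] (N (A i)) measurable)].

(** * The multivariate t distribution *)

Definition Gamma (R : realType) (a : R) : R :=
  \int[lebesgue_measure]_(x in `]0, +oo[) (x `^ (a - 1) * expR (- x)).

(* Density on (0, +oo) of the F-distribution with a and b degrees of
   freedom. *)
Definition F_pdf (R : realType) (a b x : R) : R :=
  Gamma ((a + b) / 2) / (Gamma (a / 2) * Gamma (b / 2))
  * (a / b) `^ (a / 2) * x `^ (a / 2 - 1)
  * (1 + a / b * x) `^ (- ((a + b) / 2)).

(* The library norm of a matrix is the sup norm. *)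
Definition euclidean_norm (R : realType) (n : nat) (x : 'cV[R]_n) : R :=
  Num.sqrt (\sum_i x i 0 ^+ 2).

(* Normalised surface measure on the unit sphere: B has the share of the unit
   ball's volume that lies in the cone over B. *)
Definition sphere_prob (R : realType) (n : nat) (B : set 'cV[R]_n) : \bar R :=
  (fine (lebesgue_measure_n
     [set x : 'cV[R]_n | 0 < euclidean_norm x <= 1
                         /\ B ((euclidean_norm x)^-1 *: x)])
   / fine (lebesgue_measure_n
     [set x : 'cV[R]_n | euclidean_norm x <= 1]))%:E.

(* Law of mu + R A U, with U uniform on the sphere and independent of
   R = sqrt (n Q), where Q has the F-distribution with n and nu degrees of
   freedom. *)
Definition t_prob (R : realType) (n : nat) (nu : R) (mu : 'cV[R]_n)
    (A : 'M[R]_n) (B : set 'cV[R]_n) : \bar R :=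
  (\int[lebesgue_measure]_(q in `]0%R, +oo[)
     ((F_pdf n%:R nu q)%:E *
      sphere_prob
        [set u : 'cV[R]_n | B (mu + Num.sqrt (n%:R * q) *: (A *m u))%R]))%E.

(* Some invertible A with A A^T = Sigma; t_prob does not depend on which. *)
Definition matrix_root (R : realType) (n : nat) (Sigma : 'M[R]_n) : 'M[R]_n :=
  xget 1%:M [set A : 'M[R]_n | A \in unitmx /\ A *m A^T = Sigma].

(* The convention t_cdf = 1 for n = 0 makes the one-site dependence function
   equal to z^-1. *)
Definition t_cdf (R : realType) (n : nat) (nu : R) (x mu : 'cV[R]_n)
    (Sigma : 'M[R]_n) : R :=
  if n == 0 then 1
  else fine (t_prob nu mu (matrix_root Sigma)
               [set y : 'cV[R]_n | forall i, y i 0 <= x i 0]).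

(** * Max-stability *)

Definition nondegenerate (R : realType) (d : measure_display)
    (T : measurableType d) (P : probability T R) (X : T -> R) : Prop :=
  ~ exists c : R, P [set w | X w = c] = 1%E.

Definition iid_copies (R : realType) (d d' : measure_display)
    (T : measurableType d) (P : probability T R)
    (T' : measurableType d') (P' : probability T' R) (n : nat)
    (X : 'I_n -> T -> R) (Y : nat -> 'I_n -> {RV P' >-> R}) : Prop :=
  (forall i, same_law P' P (fun j => Y i j : T' -> R) X) /\
  mutually_independent P'
    (fun i => sigma_generated (fun j => Y i j : T' -> R)).

(* The norming constants depend only on the law of X, so they are chosen
   before the iid copies. *)
Definition max_stable (R : realType) (d : measure_display)
    (T : measurableType d) (P : probability T R) (n : nat)
    (X : 'I_n -> T -> R) : Prop :=
  [/\ forall j, measurable_fun [set: T] (X j),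
      forall j, nondegenerate P (X j)
    & exists a b : nat -> 'I_n -> R,
        (forall m j, 0 < a m j) /\
        forall (d' : measure_display) (T' : measurableType d')
               (P' : probability T' R) (Y : nat -> 'I_n -> {RV P' >-> R}),
          iid_copies P X Y ->
          forall m : nat, (0 < m)%N ->
            let U i j w := (a m j)^-1 * (Y i j w - b m j) in
            same_law P' P
              (fun j w => \big[Num.max/U 0%N j w]_(i < m) U i j w) X].

Definition max_stable_process (R : realType) (d : measure_display)
    (T : measurableType d) (P : probability T R) (S : Type)
    (Z : S -> T -> R) : Prop :=
  forall (n : nat) (s : 'I_n.+1 -> S), max_stable P (fun j => Z (s j)).

Definition frechet_margins (R : realType) (d : measure_display)
    (T : measurableType d) (P : probability T R) (S : Type) (alpha : R)
    (Z : S -> T -> R) : Prop :=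
  forall (s : S) (z : R), 0 < z ->
    P [set w | Z s w <= z] = (expR (- z `^ (- alpha)))%:E.

Definition dependence_function (R : realType) (d : measure_display)
    (T : measurableType d) (P : probability T R) (n : nat) (alpha : R)
    (X : 'I_n -> T -> R) (z : 'cV[R]_n) : R :=
  - ln (fine (P [set w | forall j, X j w `^ alpha <= z j 0])).

(** * Extremal t processes *)

Definition extremal_t_dependence (R : realType) (n : nat) (nu : R)
    (Sigma : 'M[R]_n.+1) (z : 'cV[R]_n.+1) : R :=
  \sum_(j < n.+1)
    let Sjj := row' j (col' j Sigma) in
    let Sj := row' j (col j Sigma) in
    (z j 0)^-1 *
    t_cdf (nu + 1)
      (map_mx (fun x => (x / z j 0) `^ (nu^-1)) (row' j z))
      Sj
      ((nu + 1)^-1 *: (Sjj - Sj *m Sj^T)).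

(* alpha is the index of the Frechet margins, nu the degrees of freedom. *)
Definition extremal_t_process (R : realType) (d : measure_display)
    (T : measurableType d) (P : probability T R) (S : Type) (alpha nu : R)
    (Cov : S -> S -> R) (Z : S -> T -> R) : Prop :=
  [/\ max_stable_process P Z,
      frechet_margins P alpha Z
    & forall (n : nat) (s : 'I_n.+1 -> S), injective s ->
        forall z : 'cV[R]_n.+1, (forall j, 0 < z j 0) ->
          dependence_function P alpha (fun j => Z (s j)) z
          = extremal_t_dependence nu (cov_matrix Cov s) z].

Definition m_const (R : realType) (alpha : R) : R :=
  pi `^ (- 2^-1) * 2 `^ ((alpha - 2) / 2) * Gamma ((alpha + 1) / 2).

(* sup is the maximum wherever the latter exists, which is almost surely. *)
Definition max_process (R : realType) (T S : Type) (alpha : R)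
    (V : nat -> T -> R) (W : nat -> S -> T -> R) (s : S) (w : T) : R :=
  m_const alpha `^ (- alpha^-1) * sup (range (fun i => V i w * W i s w)).

(* Main.v *)
(** Dividing the points by the thresholds, the event [Z(s_j) <= c z_j for all j]
    says that [V_i M_i <= 1] for all [i], where [M_i] is the maximum of 0 and of
    the [W_i(s_j) / z_j], and [c] is the norming constant. Marking the Poisson
    process with the iid marks [M_i], this has probability
    [exp (- \int P(v M > 1) Lambda(dv)) = exp (- E[M ^ alpha])]; for step functions
    of [V_i] instead of [V_i] it follows from the generating functions of the
    Poisson counts, and in general by monotone limits. The exponent is homogeneous
    of degree [- alpha] in [z], whence max-stability with [a_m = m ^ (1 / alpha)].

    To compute [E[M ^ alpha]], split according to the site [j] at which the maximum
    is attained (ties are null since the covariance matrix is non-singular). Up to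
    an orthogonal change of variables, [W(s_j) = x] is standard normal and the other
    coordinates are [x S_j + B N] with [N] an independent standard normal vector, so
    that the [j]-th term is an integral over [x > 0] of [x ^ alpha] times a Gaussian
    probability depending on [N / x] only. Polar coordinates for [N] turn it into
    [m_alpha] times a multivariate t probability with [alpha + 1] degrees of freedom.

    The supremum is almost surely attained: only finitely many [V_i] exceed a given
    level, and applied to the small points only, the same Poisson formula shows that
    their contribution tends to 0. *)
Require Import Defs.
From HB Require Import structures.
From mathcomp Require Import all_boot all_order all_algebra.
From mathcomp Require Import finmap.
From mathcomp Require Import all_classical all_reals all_analysis.
From mathcomp Require Import measurable_realfun.
From mathcomp Require Import zify ring lra.

Set Implicit Arguments.
Unset Strict Implicit.
Unset Printing Implicit Defensive.

Import Order.TTheory GRing.Theory Num.Theory.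
Import numFieldNormedType.Exports.

Local Open Scope classical_set_scope.
Local Open Scope ring_scope.

(** * Borel sets and distribution functions on column vectors *)

(** The constants come from one integral. [m_alpha] is the moment E[max(X, 0) ^ alpha] of a standard
    normal X, so the factor m_alpha ^ (- 1 / alpha) makes the margins standard Frechet. In the j-th
    term, the substitution y = N / x in n dimensions costs x ^ n, and integrating x ^ (alpha + n)
    exp (- x ^ 2 (1 + |y| ^ 2) / 2) over x > 0 leaves a multiple of (1 + |y| ^ 2) ^ (- (alpha + n +
    1) / 2). This is, up to a constant, the density of the t law with alpha + 1 degrees of freedom
    and scale matrix (alpha + 1) ^ (-1) times the identity.

    Two obstacles shape the proof. The laws are set functions defined by iterated integrals:
    orthogonal invariance is drawn from the uniqueness of translation invariant measures, and
    substitutions on the line from comparing measures on half-lines. The Poisson process is known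
    through its counts, while the marks are attached to the indices of an arbitrary enumeration of
    the points; the two meet when the number of indices tends to infinity and the partial counts
    become stationary. *)

Notation cVb R n := (g_sigma_algebraType (@open 'cV[R]_n)).

Section borel_cV.
Variable R : realType.

Lemma measurable_cV_coord n (i : 'I_n) :
  measurable_fun [set: cVb R n] (fun y : cVb R n => (y : 'cV[R]_n) i 0).
Proof.
apply: (measurability _ (RGenOInfty.measurableE R)).
move=> _ [_ [x ->] <-]; rewrite setTI; apply: sub_sigma_algebra.
have /continuousP : continuous (fun y : 'cV[R]_n => y i 0).
  exact: coord_continuous.
by apply; exact: interval_open.
Qed.

(** Second countability: an open set is a countable union of boxes with rational centre and radius,
    and boxes are balls of the sup norm. The source is any measurable space, so that the lemma also
    applies to the sigma-algebra generated by orthants. *)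
Lemma open_cV_measurable_preimage d (T : measurableType d) n (f : T -> 'cV[R]_n) :
  (forall i, measurable_fun [set: T] (fun t => f t i 0)) ->
  forall U, open U -> measurable (f @^-1` U).
Proof.
move=> mf U oU.
pose I := ('cV[rat]_n * rat)%type.
pose box (q : I) : set 'cV[R]_n := [set y | forall i, ball (ratr (q.1 i 0) : R) (ratr q.2 : R) (y i 0)].
have -> : f @^-1` U = \bigcup_(q in [set q : I | box q `<=` U]) (f @^-1` box q).
  apply/seteqP; split => t /=; last by move=> [q qU] /qU.
  move=> Uf; have [e /= e0 eU] : exists2 e : R, 0 < e & ball (f t) e `<=` U.
    by move: oU; rewrite openE => /(_ _ Uf) /nbhs_ballP[e /= e0 eU]; exists e.
  (* With r below e / 2, going from [f t] to a point of the box through its rational centre costs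
     less than e. *)
  have [r] := @rat_in_itvoo R 0 (e / 2) (divr_gt0 e0 (ltr0n _ 2)).
  rewrite in_itv/= => /andP[r0 re].
  have qx (i : 'I_n) : exists q : rat, ball (f t i 0) (ratr r : R) (ratr q : R).
    have lt : f t i 0 - ratr r < f t i 0 + ratr r.
      by rewrite ltrBlDr -addrA ltrDl addr_gt0.
    have [q qi] := rat_in_itvoo lt.
    by exists q; rewrite ball_itv.
  have [q qP] := choice qx.
  exists (\col_i q i, r); last by move=> i /=; rewrite mxE; apply: ball_sym.
  move=> y /= yq; apply: eU; split => // i j.
  rewrite (ord1 j).
  apply: (@le_ball _ _ _ (ratr r + ratr r)).
    by rewrite (splitr e) lerD // ltW.
  apply: (ball_triangle (qP i)).
  by have := yq i; rewrite mxE.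
rewrite bigcup_mkcond; apply: countable_bigcupT_measurable => [|q].
  exact: countableP.
case: ifPn => // _.
have -> : f @^-1` box q = \bigcap_(i in [set: 'I_n]) ((fun t => f t i 0) @^-1` ball (ratr (q.1 i 0) : R) (ratr q.2 : R)).
  by apply/seteqP; split => [t ft i _|t ft i]; [exact: ft|exact: (ft i)].
apply: fin_bigcap_measurable => // i _.
rewrite -[X in measurable X]setTI; apply: mf => //.
exact: measurable_ball.
Qed.

Lemma measurable_fun_cV d (T : measurableType d) n (f : T -> cVb R n) :
  (forall i, measurable_fun [set: T] (fun t => (f t : 'cV[R]_n) i 0)) ->
  measurable_fun [set: T] f.
Proof.
move=> mf; apply: (@measurability _ _ T (cVb R n) setT f (@open 'cV[R]_n)) => //.
move=> _ [U oU <-]; rewrite setTI.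
exact: open_cV_measurable_preimage.
Qed.

Lemma measurable_mulmx n k (A : 'M[R]_(n, k)) :
  measurable_fun [set: cVb R k] (fun y : cVb R k => A *m (y : 'cV[R]_k) : cVb R n).
Proof.
apply: measurable_fun_cV => i.
under eq_fun do rewrite mxE.
apply: measurable_sum => j; apply: measurable_funM => //.
exact: measurable_cV_coord.
Qed.

Lemma measurable_addcV d (T : measurableType d) n (f g : T -> cVb R n) :
  measurable_fun setT f -> measurable_fun setT g ->
  measurable_fun setT (fun t => (f t : 'cV[R]_n) + (g t : 'cV[R]_n) : cVb R n).
Proof.
move=> mf mg; apply: measurable_fun_cV => i; under eq_fun do rewrite mxE.
by apply: measurable_funD; apply: (measurableT_comp (measurable_cV_coord i)).
Qed.

Lemma measurable_scalecV d (T : measurableType d) n (f : T -> R) (g : T -> cVb R n) :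
  measurable_fun setT f -> measurable_fun setT g ->
  measurable_fun setT (fun t => f t *: (g t : 'cV[R]_n) : cVb R n).
Proof.
move=> mf mg; apply: measurable_fun_cV => i; under eq_fun do rewrite mxE.
by apply: measurable_funM => //; apply: (measurableT_comp (measurable_cV_coord i)).
Qed.

Lemma measurable_col_mx d (T : measurableType d) m n (f : T -> cVb R m) (g : T -> cVb R n) :
  measurable_fun setT f -> measurable_fun setT g ->
  measurable_fun setT (fun t => col_mx (f t : 'cV[R]_m) (g t : 'cV[R]_n) : cVb R (m + n)).
Proof.
move=> mf mg; apply: measurable_fun_cV => i; under eq_fun do rewrite mxE.
by case: (fintype.split i) => j; apply: (measurableT_comp (measurable_cV_coord j)).
Qed.

Lemma measurable_scalar_cV : measurable_fun [set: R] (fun x => x%:M : cVb R 1).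
Proof.
apply: measurable_fun_cV => i; rewrite (ord1 i).
under eq_fun do rewrite mxE eqxx mulr1n.
exact: measurable_id.
Qed.

Lemma measurable_euclidean_norm n :
  measurable_fun [set: cVb R n] (fun y : cVb R n => euclidean_norm (y : 'cV[R]_n)).
Proof.
apply: (measurableT_comp (continuous_measurable_fun (@sqrt_continuous R))).
apply: measurable_sum => j; apply: measurable_funX.
exact: measurable_cV_coord.
Qed.

Lemma measurable_orthant n (c : 'cV[R]_n) :
  measurable [set y : cVb R n | forall i, (y : 'cV[R]_n) i 0 <= c i 0].
Proof.
suff -> : [set y : cVb R n | forall i, (y : 'cV[R]_n) i 0 <= c i 0] = \bigcap_(i in [set: 'I_n])
    ((fun y : cVb R n => (y : 'cV[R]_n) i 0) @^-1` `]-oo, c i 0]).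
  apply: fin_bigcap_measurable => // i _.
  rewrite -[X in measurable X]setTI; exact: measurable_cV_coord.
apply/seteqP; split => [y yc i _|y yc i].
  by rewrite /= in_itv/=; exact: yc.
by have := yc i I; rewrite /= in_itv.
Qed.

Lemma borel_cV_orthantE n :
  (@measurable _ (cVb R n)) = <<s range (fun c : 'cV[R]_n => [set y : 'cV[R]_n | forall i, y i 0 <= c i 0]) >>.
Proof.
set G := range _.
have sG := @smallest_sigma_algebra _ setT G.
apply/seteqP; split; last first.
  apply: smallest_sub; first exact: sigma_algebra_measurable.
  by move=> _ [c _ <-]; exact: measurable_orthant.
apply: smallest_sub => // U oU.
suff : @measurable _ (g_sigma_algebraType G) ((fun y : g_sigma_algebraType G => y : 'cV[R]_n) @^-1` U) by [].
apply: open_cV_measurable_preimage => // i.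
apply: (measurability _ (RGenCInfty.measurableE R)).
move=> _ [_ [x ->] <-]; rewrite setTI.
rewrite -[X in measurable X]setCK; apply: measurableC.
(* The half-space {y_i < x} is the increasing union of orthants whose i-th bound is x - 1 / (k + 1)
   and whose other bounds are k. *)
pose V k : set 'cV[R]_n := [set y | forall j, y j 0 <= (if j == i then x - k.+1%:R^-1 else k%:R)].
have -> : ~` ((fun t : g_sigma_algebraType G => (t : 'cV[R]_n) i 0) @^-1` `[x, +oo[)
   = \bigcup_k V k.
  apply/seteqP; split => y /=.
    rewrite in_itv/= andbT => /negP; rewrite -ltNge => yx.
    pose M := \sum_j `|y j 0|.
    have [k1 hk1] : exists k : nat, k.+1%:R^-1 < x - y i 0.
      have := ltr_add_invr yx => -[k hk]; exists k.
      by rewrite ltrBrDl.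
    pose k2 := Num.truncn M.
    exists (maxn k1 k2.+1) => // j.
    case: eqP => [->|_].
      rewrite lerBrDr -lerBrDl ltW //.
      apply: le_lt_trans hk1.
      by rewrite lef_pV2 ?posrE// ler_nat ltnS leq_maxl.
    apply: (@le_trans _ _ M).
      rewrite /M (bigD1 j) //= (le_trans (ler_norm _)) // lerDl.
      by apply: sumr_ge0.
    apply: (@le_trans _ _ k2.+1%:R).
      by apply/ltW/truncnS_gt.
    by rewrite ler_nat leq_maxr.
  move=> [k _] /(_ i); rewrite eqxx => yx.
  rewrite in_itv/= andbT; apply/negP; rewrite -ltNge.
  by apply: (le_lt_trans yx); rewrite ltrBlDr ltrDl.
apply: bigcupT_measurable => k; apply: sub_sigma_algebra.
exists (\col_j (if j == i then x - k.+1%:R^-1 else k%:R)) => //.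
by apply/seteqP; split => y /= h j; have := h j; rewrite mxE.
Qed.

Lemma measurable_random_vector d (T : measurableType d) n (X : 'I_n -> T -> R) :
  (forall j, measurable_fun setT (X j)) ->
  measurable_fun setT (random_vector X : T -> cVb R n).
Proof.
move=> mX; apply: measurable_fun_cV => i; under eq_fun do rewrite mxE.
exact: mX.
Qed.

(** Max-stability asks for equality of laws on all Borel sets, but the max process is accessible
    through its distribution function. Orthants are stable under intersection, generate the Borel
    sets and exhaust the space, so the distribution function suffices. *)
Lemma same_law_cdf d d' (T : measurableType d) (P : probability T R)
    (T' : measurableType d') (P' : probability T' R) n
    (X : 'I_n -> T -> R) (Y : 'I_n -> T' -> R) :
  (forall j, measurable_fun setT (X j)) ->
  (forall j, measurable_fun setT (Y j)) ->
  (forall y : 'I_n -> R, P [set w | forall j, X j w <= y j]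
                      = P' [set w | forall j, Y j w <= y j]) ->
  same_law P P' X Y.
Proof.
move=> mX mY XY B mB.
pose G := range (fun c : 'cV[R]_n => [set y : 'cV[R]_n | forall i, y i 0 <= c i 0]).
pose g k : set (cVb R n) := [set y : 'cV[R]_n | forall i, y i 0 <= (const_mx k%:R : 'cV[R]_n) i 0].
pose mXf : {mfun T >-> cVb R n} := HB.pack (random_vector X : T -> cVb R n)
   (isMeasurableFun.Build _ _ _ _ _ (measurable_random_vector mX)).
pose mYf : {mfun T' >-> cVb R n} := HB.pack (random_vector Y : T' -> cVb R n)
   (isMeasurableFun.Build _ _ _ _ _ (measurable_random_vector mY)).
apply: (@measure_unique _ R (cVb R n) G g _ _ _ _
   (pushforward P mXf) (pushforward P' mYf)) => //.
- exact: borel_cV_orthantE.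
- move=> _ _ [c _ <-] [e _ <-]; exists (\col_i Num.min (c i 0) (e i 0)) => //.
  apply/seteqP; split => y /=.
    move=> h; split => i; have := h i; rewrite mxE le_min => /andP[]//.
  by move=> [h1 h2] i; rewrite mxE le_min h1 h2.
- by move=> k; exists (const_mx k%:R).
- apply/seteqP; split => // y _.
  pose M := \sum_j `|y j 0|.
  exists (Num.truncn M).+1 => // i; rewrite mxE.
  apply: (@le_trans _ _ M); last by apply/ltW/truncnS_gt.
  rewrite /M (bigD1 i) //= (le_trans (ler_norm _)) // lerDl.
  by apply: sumr_ge0.
- move=> _ [c _ <-].
  have := XY (fun j => c j 0).
  by congr (_ = _); rewrite /= /pushforward; congr (_ _); apply/seteqP; split=> w /= h j; have := h j; rewrite mxE.
- move=> k; apply: (@le_lt_trans _ _ 1%E); last by rewrite ltry.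
  apply: probability_le1.
  rewrite -[X in measurable X]setTI; apply: (measurable_funP mXf) => //.
  exact: measurable_orthant.
Qed.

End borel_cV.

Lemma measurable_sublevel d (T : measurableType d) (R : realType) (f : T -> measurableTypeR R) (c : R) :
  measurable_fun setT f -> measurable [set w | f w <= c].
Proof.
move=> mf; rewrite -[X in measurable X]setTI; have := mf measurableT _ (measurable_itv `]-oo, c]).
by congr (measurable (_ `&` _)); apply/seteqP; split => w; rewrite /= in_itv.
Qed.

(** * Power measures *)

Section image_measure.
Context d d' (T : measurableType d) (T' : measurableType d') (R : realType).

(** The measure structure of [pushforward] depends on the proof of measurability; destructing this
    existence statement yields a plain measure variable instead. *)
Lemma image_measure_exists (mu : {measure set T -> \bar R}) (f : T -> T') :
  measurable_fun setT f ->
  exists nu : {measure set T' -> \bar R}, forall A, nu A = mu (f @^-1` A).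
Proof.
move=> mf; unshelve eexists (pushforward mu f : {measure set T' -> \bar R}); first exact: mf.
by [].
Qed.

Lemma ge0_integral_image (mu : {measure set T -> \bar R})
    (nu : {measure set T' -> \bar R}) (f : T -> T') :
  measurable_fun setT f -> (forall A, measurable A -> nu A = mu (f @^-1` A)) ->
  forall g : T' -> \bar R, measurable_fun setT g -> (forall y, 0 <= g y)%E ->
  (\int[nu]_y g y = \int[mu]_x g (f x))%E.
Proof.
move=> mf nuE g mg g0.
have <- := @ge0_integral_pushforward _ _ _ _ R f mf mu setT g measurableT mg (fun y _ => g0 y).
by apply: eq_measure_integral => A mA _; exact: nuE.
Qed.

End image_measure.

Section sigma_finite_upgrade.
Context d (T : measurableType d) (R : realType) (mu : {measure set T -> \bar R}).
Hypothesis sf : sigma_finite setT mu.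

(** The proof is an argument of this alias so that the two structures below can be attached to
    it. *)
Definition sigma_finite_copy (_ : sigma_finite setT mu) : set T -> \bar R := mu.
HB.instance Definition _ := Measure.on (sigma_finite_copy sf).
HB.instance Definition _ := Measure_isSigmaFinite.Build _ _ _ (sigma_finite_copy sf) sf.

Lemma sigma_finite_measure_exists :
  exists nu : {sigma_finite_measure set T -> \bar R}, forall A, nu A = mu A.
Proof. by exists (sigma_finite_copy sf). Qed.

End sigma_finite_upgrade.

Section power_measure_theory.
Variables (R : realType) (m : {sigma_finite_measure set (measurableTypeR R) -> \bar R}).

Definition cons_cV n (xy : measurableTypeR R * cVb R n) : cVb R n.+1 :=
  col_mx (xy.1%:M : 'cV[R]_1) (xy.2 : 'cV[R]_n).

Definition uncons_cV n (y : cVb R n.+1) : measurableTypeR R * cVb R n :=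
  ((y : 'cV[R]_n.+1) 0 0, dsubmx (y : 'cV[R]_(1 + n))).

Lemma uncons_cVK n : cancel (@uncons_cV n) (@cons_cV n).
Proof.
move=> y; rewrite /cons_cV /uncons_cV /=.
rewrite -[RHS](@vsubmxK _ 1 n 1 y); congr (@col_mx _ 1 n 1 _ _).
apply/matrixP => i j; rewrite (ord1 i) (ord1 j) !mxE eqxx mulr1n.
by congr (y _ _); apply/val_inj.
Qed.

Lemma cons_cVK n : cancel (@cons_cV n) (@uncons_cV n).
Proof.
move=> [x y]; rewrite /cons_cV /uncons_cV /=; congr pair; last first.
  exact: (@col_mxKd _ 1 n 1).
have := @col_mxEu R 1 n 1 (x%:M) y 0 0; rewrite [X in _ = X]mxE eqxx mulr1n.
by move=> {2}<-; rewrite (_ : lshift n 0 = 0) //; exact/val_inj.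
Qed.

Lemma measurable_cons_cV n : measurable_fun setT (@cons_cV n).
Proof.
apply: (@measurable_col_mx _ _ _ 1 n (fun xy : measurableTypeR R * cVb R n => xy.1%:M) snd) => //.
by apply: (measurableT_comp (@measurable_scalar_cV R)).
Qed.

Lemma measurable_uncons_cV n : measurable_fun setT (@uncons_cV n).
Proof.
apply/measurable_fun_pairP; split => /=.
  exact: measurable_cV_coord.
apply: measurable_fun_cV => i; under eq_fun do rewrite mxE.
exact: measurable_cV_coord.
Qed.

Let measurable_cons_preimage n (B : set (cVb R n.+1)) : measurable B ->
  measurable (@cons_cV n @^-1` B).
Proof. by move=> mB; rewrite -[X in measurable X]setTI; exact: measurable_cons_cV. Qed.

(** On Borel sets, Fubini's recursion is the image under [cons_cV] of the product of [m] with the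
    measure of the previous dimension. Sigma-finiteness belongs to the induction hypothesis because
    the next product is built from it. *)
Lemma power_measure_exists n :
  exists mu : {sigma_finite_measure set (cVb R n) -> \bar R},
    forall B : set 'cV[R]_n, borel B -> power_measure m B = mu B.
Proof.
elim: n => [|n [mu IH]].
  by exists (\d_(0 : cVb R 0)) => B mB /=; rewrite diracE indicE.
have [nu nuE] := image_measure_exists (m \x mu)%E (@measurable_cons_cV n).
have sf : sigma_finite setT nu.
  have /sigma_finiteP[F [FT ndF Ff]] := sigma_finiteT m.
  have /sigma_finiteP[G [GT ndG Gf]] := sigma_finiteT mu.
  (* The exhausting sequences are taken nondecreasing, so that a single index captures both
     coordinates. *)
  exists (fun k => @uncons_cV n @^-1` (F k `*` G k)).
    apply/esym; rewrite -subTset => y _.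
    have : (\bigcup_k F k) (uncons_cV y).1 by rewrite -FT.
    have : (\bigcup_k G k) (uncons_cV y).2 by rewrite -GT.
    move=> [k _ Gk] [l _ Fl]; exists (maxn k l) => //; split.
      by move: Fl; exact/subsetPset/ndF/leq_maxr.
    by move: Gk; exact/subsetPset/ndG/leq_maxl.
  move=> k; have [mF Foo] := Ff k; have [mG Goo] := Gf k; split.
    rewrite -[X in measurable X]setTI; apply: measurable_uncons_cV => //.
    exact: measurableX.
  rewrite nuE (_ : _ @^-1` _ = F k `*` G k); last first.
    by apply/seteqP; split => xy; rewrite /preimage /mkset cons_cVK.
  by rewrite [ltLHS](product_measure1E m mu mF mG) lte_mul_pinfty// ge0_fin_numE.
have [nu' nu'E] := sigma_finite_measure_exists sf.
exists nu' => B mB; rewrite nu'E nuE /= /product_measure1 /=.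
apply: eq_integral => x _ /=.
rewrite IH.
  by congr (mu _); apply/seteqP; split => y; rewrite /xsection /= ?inE.
have := measurable_xsection x (measurable_cons_preimage mB).
congr (measurable _).
by apply/seteqP; split => y; rewrite /xsection /= ?inE.
Qed.

Definition pmeas n : {sigma_finite_measure set (cVb R n) -> \bar R} :=
  projT1 (cid (power_measure_exists n)).

Lemma pmeasE n (B : set 'cV[R]_n) : borel B -> pmeas n B = power_measure m B.
Proof. by move=> mB; rewrite /pmeas; case: cid => mu /= ->. Qed.

Lemma measurable_cons_section n (B : set (cVb R n.+1)) x : measurable B ->
  measurable [set y : cVb R n | B (cons_cV (x, y))].
Proof.
move=> mB; have := measurable_xsection x (measurable_cons_preimage mB).
congr (measurable _).
by apply/seteqP; split => y; rewrite /xsection /= ?inE.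
Qed.

Lemma pmeas0E (B : set (cVb R 0)) : measurable B -> pmeas 0 B = (\1_B (0 : 'cV[R]_0))%:E.
Proof. by move=> mB; rewrite pmeasE. Qed.

Lemma pmeasSE n (B : set (cVb R n.+1)) : measurable B ->
  pmeas n.+1 B = (\int[m]_x pmeas n [set y | B (cons_cV (x, y))])%E.
Proof.
move=> mB; rewrite pmeasE //=; apply: eq_integral => x _.
by rewrite pmeasE //; exact: measurable_cons_section.
Qed.

Lemma pmeasS_pushforward n (B : set (cVb R n.+1)) : measurable B ->
  pmeas n.+1 B = (m \x pmeas n)%E (@cons_cV n @^-1` B).
Proof.
move=> mB; rewrite pmeasSE //; apply: eq_integral => x _ /=.
by congr (pmeas n _); apply/seteqP; split => y; rewrite /xsection /= ?inE.
Qed.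

Lemma ge0_integral_pmeasS n (f : cVb R n.+1 -> \bar R) :
  measurable_fun setT f -> (forall y, 0 <= f y)%E ->
  (\int[pmeas n.+1]_y f y = \int[m]_x \int[pmeas n]_y f (cons_cV (x, y)))%E.
Proof.
move=> mf f0.
rewrite (ge0_integral_image (@measurable_cons_cV n) (@pmeasS_pushforward n)) //.
rewrite fubini_tonelli1 //.
apply: measurableT_comp => //; exact: measurable_cons_cV.
Qed.

Lemma ge0_integral_pmeas0 (f : cVb R 0 -> \bar R) :
  measurable_fun setT f -> (forall y, 0 <= f y)%E ->
  (\int[pmeas 0]_y f y = f (0 : 'cV[R]_0)%R)%E.
Proof.
move=> mf f0.
rewrite (eq_measure_integral (\d_(0 : cVb R 0))); last first.
  by move=> A mA _; rewrite [LHS](pmeas0E mA) /= /dirac.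
by rewrite integral_dirac //= diracT mul1e.
Qed.

Lemma measurable_pmeas_section n (B : set (cVb R n.+1)) : measurable B ->
  measurable_fun setT (fun x : measurableTypeR R => pmeas n [set y | B (cons_cV (x, y))]).
Proof.
move=> mB; have := measurable_fun_xsection (pmeas n) (measurable_cons_preimage mB).
congr (measurable_fun _); apply/funext => x /=.
by congr (pmeas n _); apply/seteqP; split => y; rewrite /xsection /= ?inE.
Qed.

End power_measure_theory.

(** * Lebesgue measure on column vectors *)

Section lebesgue_line.
Variable R : realType.
Notation mu := (@lebesgue_measure R).

Lemma lebesgue_measure_translation (a : R) (A : set (measurableTypeR R)) :
  measurable A -> mu A = mu ((fun x => a + x) @^-1` A).
Proof.
move=> mA.
have mf : measurable_fun setT (fun x : measurableTypeR R => a + x : measurableTypeR R).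
  by apply: measurable_funD => //; exact: measurable_id.
have [nu nuE] := image_measure_exists mu mf.
rewrite -nuE; apply: lebesgue_measure_unique => // _ [[b c] _ <-] /=.
rewrite nuE (_ : _ @^-1` _ = `]b - a, c - a]%classic).
  rewrite [LHS]lebesgue_measure_itv [RHS]lebesgue_measure_itv /= !lte_fin ltrD2r.
  by case: ifP => // _; rewrite -!EFinB; congr EFin; ring.
by apply/seteqP; split => x /=; rewrite !in_itv /= ltrBlDl lerBrDl.
Qed.

Lemma lebesgue_measure_scale (c : R) (A : set (measurableTypeR R)) : 0 < c ->
  measurable A -> mu ((fun x => c * x) @^-1` A) = ((c^-1)%:E * mu A)%E.
Proof.
move=> c0 mA.
have mf : measurable_fun setT (fun x : measurableTypeR R => c * x : measurableTypeR R).
  by apply: measurable_funM => //; exact: measurable_id.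
have [nu nuE] := image_measure_exists mu mf.
have cnn : 0 <= c by exact: ltW.
pose k : {nonneg R} := NngNum cnn.
have : mu A = mscale k nu A.
  apply: lebesgue_measure_unique => // _ [[a b] _ <-] /=.
  rewrite /mscale /= nuE (_ : _ @^-1` _ = `]a / c, b / c]%classic); last first.
    by apply/seteqP; split => x /=; rewrite !in_itv /= ltr_pdivrMr // ler_pdivlMr // mulrC.
  rewrite [LHS]lebesgue_measure_itv [X in (_ * X)%E]lebesgue_measure_itv /= !lte_fin ltr_pM2r ?invr_gt0 //.
  case: ifP => _; last by rewrite mule0.
  by rewrite -!EFinB -EFinM; congr EFin; field; rewrite gt_eqF.
rewrite /mscale /= nuE => ->; rewrite muleA -EFinM mulVf ?gt_eqF // mul1e.
by [].
Qed.

End lebesgue_line.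

Section lebesgue_cV.
Variable R : realType.

Definition leb n : {sigma_finite_measure set (cVb R n) -> \bar R} :=
  pmeas (@lebesgue_measure R) n.

Lemma lebE n (B : set 'cV[R]_n) : borel B -> lebesgue_measure_n B = leb n B.
Proof. by move=> mB; rewrite /leb [RHS]pmeasE. Qed.

Lemma measurable_preimage_cV d (T : measurableType d) n (f : T -> cVb R n) (B : set (cVb R n)) :
  measurable_fun setT f -> measurable B -> measurable (f @^-1` B).
Proof. by move=> mf mB; rewrite -[X in measurable X]setTI; exact: mf. Qed.

Lemma measurable_translate n (a : 'cV[R]_n) :
  measurable_fun setT (fun y : cVb R n => a + (y : 'cV[R]_n) : cVb R n).
Proof. by apply: measurable_addcV. Qed.

Lemma measurable_scale n (c : R) :
  measurable_fun setT (fun y : cVb R n => c *: (y : 'cV[R]_n) : cVb R n).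
Proof. by apply: measurable_scalecV. Qed.

Lemma cons_cVD n (x x' : R) (y y' : 'cV[R]_n) :
  (cons_cV (x, y) : 'cV[R]_n.+1) + (cons_cV (x', y') : 'cV[R]_n.+1) = cons_cV (x + x', y + y').
Proof.
rewrite /cons_cV /= (@add_col_mx _ 1 n 1); congr (@col_mx _ 1 n 1 _ _).
by rewrite raddfD.
Qed.

Lemma cons_cVZ n (c x : R) (y : 'cV[R]_n) :
  c *: (cons_cV (x, y) : 'cV[R]_n.+1) = cons_cV (c * x, c *: y).
Proof.
rewrite /cons_cV /= (@scale_col_mx _ 1 n 1); congr (@col_mx _ 1 n 1 _ _).
by rewrite scale_scalar_mx.
Qed.

Lemma leb_translation n (a : 'cV[R]_n) (B : set (cVb R n)) : measurable B ->
  leb n ((fun y : cVb R n => a + (y : 'cV[R]_n)) @^-1` B) = leb n B.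
Proof.
elim: n => [|n IH] in a B *.
  by move=> mB; congr (leb 0 _); apply/seteqP; split => y; rewrite /preimage /= (flatmx0 a) add0r.
move=> mB.
rewrite [LHS]pmeasSE; last exact: (measurable_preimage_cV (measurable_translate a)).
rewrite [RHS]pmeasSE //.
have [a0 [a' ->]] : exists a0 a', a = cons_cV (a0, a').
  by exists (uncons_cV a).1, (uncons_cV a).2; rewrite -surjective_pairing uncons_cVK.
rewrite [RHS](ge0_integral_image _ (lebesgue_measure_translation a0)) //=; last 2 first.
  by apply: measurable_funD => //; exact: measurable_id.
  exact: measurable_pmeas_section.
apply: eq_integral => x _.
rewrite -[RHS](IH a'); last exact: measurable_cons_section.
by congr (leb n _); apply/seteqP; split => y; rewrite /preimage /= cons_cVD.
Qed.

Lemma leb_scale n (r : R) (B : set (cVb R n)) : 0 < r -> measurable B ->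
  leb n ((fun y : cVb R n => r *: (y : 'cV[R]_n)) @^-1` B) = ((r ^- n)%:E * leb n B)%E.
Proof.
move=> r0; elim: n => [|n IH] in B *.
  move=> mB; rewrite expr0 invr1 mul1e; congr (leb 0 _).
  by apply/seteqP; split => y; rewrite /preimage /= [r *: _]flatmx0 [y]flatmx0.
move=> mB.
rewrite [LHS]pmeasSE; last exact: (measurable_preimage_cV (measurable_scale r)).
rewrite [X in (_ * X)%E]pmeasSE //.
pose F (x : measurableTypeR R) := leb n [set y | B (cons_cV (x, y))].
have mF : measurable_fun setT F by exact: measurable_pmeas_section.
transitivity (\int[@lebesgue_measure R]_x ((r ^- n)%:E * F (r * x)%R))%E.
  apply: eq_integral => x _; rewrite -(IH _ (measurable_cons_section (r * x) mB)) //.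
  by congr (leb n _); apply/seteqP; split => y; rewrite /preimage /= cons_cVZ.
have mr : measurable_fun setT (fun x : measurableTypeR R => r * x : measurableTypeR R).
  by apply: measurable_funM => //; exact: measurable_id.
rewrite ge0_integralZl //; last 2 first.
  by apply: (measurableT_comp mF).
  by rewrite lee_fin invr_ge0 exprn_ge0 // ltW.
rewrite exprS invfM EFinM -muleA muleCA; congr (_ * _)%E.
have k0 : 0 <= r^-1 by rewrite invr_ge0 ltW.
pose k : {nonneg R} := NngNum k0.
rewrite -(@ge0_integral_image _ _ _ _ _ (@lebesgue_measure R) (mscale k (@lebesgue_measure R)) (fun x => r * x) mr _ F mF) //; last first.
  by move=> A mA; rewrite /mscale /= lebesgue_measure_scale.
by rewrite ge0_integral_mscale.
Qed.

Lemma measurable_cube n (r : R) :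
  measurable [set y : cVb R n | forall i, `|(y : 'cV[R]_n) i 0| <= r].
Proof.
suff -> : [set y : cVb R n | forall i, `|(y : 'cV[R]_n) i 0| <= r] = \bigcap_(i in [set: 'I_n])
    ((fun y : cVb R n => (y : 'cV[R]_n) i 0) @^-1` `[-r, r]).
  apply: fin_bigcap_measurable => // i _.
  rewrite -[X in measurable X]setTI; exact: measurable_cV_coord.
apply/seteqP; split => [y yc i _|y yc i].
  by rewrite /= in_itv/= -ler_norml; exact: yc.
by have := yc i I; rewrite /= in_itv /= -ler_norml.
Qed.

Lemma leb_cube n (r : R) : 0 <= r ->
  leb n [set y : cVb R n | forall i, `|(y : 'cV[R]_n) i 0| <= r] = ((2 * r) ^+ n)%:E.
Proof.
move=> r0; elim: n => [|n IH].
  rewrite [LHS]pmeas0E; last exact: measurable_cube.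
  by rewrite expr0 indicE mem_set // => -[].
rewrite [LHS]pmeasSE; last exact: measurable_cube.
transitivity (\int[@lebesgue_measure R]_x (((2 * r) ^+ n)%:E * (\1_(`[-r, r]%classic) x)%:E))%E.
  apply: eq_integral => x _.
  rewrite indicE; case: (boolP (x \in _)) => /=; [move=> /set_mem|move=> /negP; rewrite inE]; rewrite /= in_itv /= -ler_norml => xr.
    rewrite mule1 -IH; congr (leb n _); apply/seteqP; split => y /=.
      move=> h i; have := h (rshift 1 i); rewrite /cons_cV /=.
      by rewrite (@col_mxEd _ 1 n 1).
    move=> h i; rewrite /cons_cV /=; rewrite -(@splitK 1 n i).
    case: (fintype.split _) => j /=; last by rewrite (@col_mxEd _ 1 n 1).
    by rewrite (@col_mxEu _ 1 n 1) (ord1 j) mxE eqxx mulr1n.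
  rewrite mule0 (_ : [set y | _] = set0) ?measure0 //.
  apply/seteqP; split => y //= h; case: xr.
  have := h (@lshift 1 n 0); rewrite /cons_cV /=.
  by rewrite (@col_mxEu _ 1 n 1) mxE eqxx mulr1n.
rewrite ge0_integralZl //; [|exact/measurable_EFinP/measurable_indic|by rewrite lee_fin exprn_ge0 // mulr_ge0].
rewrite [X in (_ * X)%E](_ : _ = lebesgue_measure `[-r, r]%classic); last first.
  by rewrite integral_indic // setIT.
rewrite [X in (_ * X)%E]lebesgue_measure_itv /= lte_fin.
case: ifPn => [_|]; first by rewrite -EFinB -EFinM exprSr; congr (_ * _)%:E; ring.
rewrite -leNgt => h; have -> : r = 0 by lra.
by rewrite mule0 mulr0 expr0n.
Qed.

(** The uniqueness argument for Haar measure. The double integral of 1_B(y) 1_A(x + y) gives the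
    left side when x is integrated first. For fixed x, replacing y by y - x, which [nu] allows,
    turns the integrand into 1_A(y) 1_B(y - x); integrating this over x gives the volume of the
    reflection of B, whatever y is. *)
Lemma invariant_measure_swap n (nu : {sigma_finite_measure set (cVb R n) -> \bar R}) :
  (forall (a : 'cV[R]_n) (B : set (cVb R n)), measurable B ->
     nu ((fun y : cVb R n => a + (y : 'cV[R]_n)) @^-1` B) = nu B) ->
  forall A B : set (cVb R n), measurable A -> measurable B ->
  (nu B * leb n A = nu A * leb n ((fun y : cVb R n => (- (y : 'cV[R]_n))%R) @^-1` B))%E.
Proof.
move=> nuT A B mA mB.
have mN : measurable_fun setT (fun y : cVb R n => - (y : 'cV[R]_n) : cVb R n).
  apply: measurable_fun_cV => i; under eq_fun do rewrite mxE.
  by apply: measurableT_comp => //; exact: measurable_cV_coord.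
pose f (xy : cVb R n * cVb R n) : \bar R :=
  ((\1_B xy.2) * (\1_A ((xy.1 : 'cV[R]_n) + (xy.2 : 'cV[R]_n) : cVb R n)))%:E.
pose g (xy : cVb R n * cVb R n) : \bar R :=
  ((\1_A xy.2) * (\1_B (- (xy.1 : 'cV[R]_n) + (xy.2 : 'cV[R]_n) : cVb R n)))%:E.
have mi d (T : measurableType d) (C : set (cVb R n)) (h : T -> cVb R n) :
    measurable C -> measurable_fun setT h -> measurable_fun setT (fun xy => \1_C (h xy) : R).
  by move=> mC mh; apply: (measurableT_comp _ mh); exact: measurable_indic.
have mf : measurable_fun setT f.
  apply/measurable_EFinP; apply: measurable_funM; apply: mi => //.
  exact: measurable_addcV.
have mg : measurable_fun setT g.
  apply/measurable_EFinP; apply: measurable_funM; apply: mi => //.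
  by apply: measurable_addcV => //; exact: (measurableT_comp mN).
have f0 xy : (0 <= f xy)%E by rewrite lee_fin mulr_ge0.
have g0 xy : (0 <= g xy)%E by rewrite lee_fin mulr_ge0.
transitivity (\int[nu]_y \int[leb n]_x f (x, y))%E.
  transitivity (\int[nu]_y ((\1_B y)%:E * leb n A))%E.
    rewrite ge0_integralZr //; last exact/measurable_EFinP/measurable_indic.
    by rewrite integral_indic // setIT.
  apply: eq_integral => y _.
  rewrite /f /=; under eq_integral do rewrite EFinM.
  rewrite ge0_integralZl //; last first.
    by apply/measurable_EFinP; apply: mi => //; exact: measurable_addcV.
  congr (_ * _)%E.
  rewrite -[LHS](leb_translation (y : 'cV[R]_n) mA).
  rewrite -(setIT (_ @^-1` A)) -integral_indic //; last first.
    exact: (measurable_preimage_cV (measurable_translate _)).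
  by apply: eq_integral => x _; rewrite !indicE addrC /in_mem /= .
rewrite -fubini_tonelli //.
transitivity (\int[leb n]_x \int[nu]_y g (x, y))%E.
  apply: eq_integral => x _.
  rewrite [LHS](ge0_integral_image (measurable_translate (- (x : 'cV[R]_n))) (f := (fun y : cVb R n => - (x : 'cV[R]_n) + (y : 'cV[R]_n) : cVb R n)) (mu := nu)) //; last 2 first.
    by move=> C mC; exact/esym/nuT.
    by apply: (measurableT_comp mf); exact: measurable_pair1.
  by apply: eq_integral => y _; rewrite /f /g /= addrA subrr add0r mulrC.
rewrite fubini_tonelli //.
transitivity (\int[nu]_y ((\1_A y)%:E * leb n ((fun y : cVb R n => (- (y : 'cV[R]_n))%R) @^-1` B)))%E; last first.
  rewrite ge0_integralZr //; last exact/measurable_EFinP/measurable_indic.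
  by rewrite integral_indic // setIT.
apply: eq_integral => y _.
rewrite /g /=; under eq_integral do rewrite EFinM.
have mB' := measurable_preimage_cV mN mB.
rewrite ge0_integralZl //; last first.
  by apply/measurable_EFinP; apply: mi => //; exact: measurable_addcV.
congr (_ * _)%E.
rewrite -[RHS](leb_translation (- (y : 'cV[R]_n)) mB').
rewrite -(setIT (_ @^-1` _)) -integral_indic //; last first.
  exact: (measurable_preimage_cV (measurable_translate _)).
apply: eq_integral => x _; rewrite !indicE /preimage /=; congr (nat_of_bool _)%:R%:E.
by apply/idP/idP; rewrite !inE /= opprD opprK addrC.
Qed.

Lemma euclidean_norm_ge_coord n (y : 'cV[R]_n) i : `|y i 0| <= euclidean_norm y.
Proof.
rewrite -sqrtr_sqr /euclidean_norm ler_sqrt ?sqr_ge0 //.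
  by rewrite (bigD1 i) //= lerDl; apply: sumr_ge0 => j _; exact: sqr_ge0.
by apply: sumr_ge0 => j _; exact: sqr_ge0.
Qed.

Definition ball_cV (n : nat) : set (cVb R n) := [set y | euclidean_norm (y : 'cV[R]_n) <= 1].
Arguments ball_cV : clear implicits.

Lemma measurable_ball_cV n : measurable (ball_cV n).
Proof.
rewrite -[X in measurable X]setTI (_ : ball_cV n = (fun y : cVb R n => euclidean_norm (y : 'cV[R]_n)) @^-1` `]-oo, 1]).
  exact: measurable_euclidean_norm.
by apply/seteqP; split => y; rewrite /ball_cV /= in_itv.
Qed.

Lemma leb_ball_fin n : (leb n (ball_cV n) < +oo)%E.
Proof.
apply: (@le_lt_trans _ _ (leb n [set y : cVb R n | forall i, `|(y : 'cV[R]_n) i 0| <= 1])).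
  apply: le_measure; rewrite ?inE.
  - exact: measurable_ball_cV.
  - exact: measurable_cube.
  - by move=> y /= y1 i; exact: (le_trans (euclidean_norm_ge_coord _ _)).
by rewrite leb_cube // ltry.
Qed.

(** The ball contains the cube of half-side 1 / (n + 1), since n squares of numbers at most 1 / (n +
    1) add up to less than 1. *)
Lemma leb_ball_gt0 n : (0 < leb n (ball_cV n))%E.
Proof.
have k0 : 0 < n.+1%:R^-1 :> R by rewrite invr_gt0.
apply: (@lt_le_trans _ _ (leb n [set y : cVb R n | forall i, `|(y : 'cV[R]_n) i 0| <= n.+1%:R^-1])).
  by rewrite leb_cube ?lte_fin ?exprn_gt0 ?mulr_gt0 // ltW.
apply: le_measure; rewrite ?inE.
- exact: measurable_cube.
- exact: measurable_ball_cV.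
- move=> y /= yk; rewrite /ball_cV /= /euclidean_norm -sqrtr1 ler_sqrt //.
  apply: (@le_trans _ _ (\sum_(i < n) n.+1%:R^-1)).
    apply: ler_sum => i _; rewrite -real_normK ?num_real //.
    have h1 : n.+1%:R^-1 <= 1 :> R by rewrite invf_le1 // ler1n.
    rewrite expr2 -[leRHS]mul1r; apply: ler_pM => //.
    exact: le_trans (yk i) h1.
  by rewrite sumr_const card_ord -[leLHS]mulr_natr mulrC ler_pdivrMr // mul1r ler_nat.
Qed.

Lemma euclidean_norm_orthogonal n (H : 'M[R]_n) (y : 'cV[R]_n) :
  H^T *m H = 1%:M -> euclidean_norm (H *m y) = euclidean_norm y.
Proof.
move=> HH; rewrite /euclidean_norm; congr (Num.sqrt _).
have E (z : 'cV[R]_n) : \sum_i z i 0 ^+ 2 = (z^T *m z) 0 0.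
  by rewrite mxE; apply: eq_bigr => i _; rewrite mxE expr2.
by rewrite !E trmx_mul mulmxA -(mulmxA _ _ H) HH mulmx1.
Qed.

(** The image of Lebesgue measure under [H] is again translation invariant, and it gives the unit
    ball the same mass because [H] preserves the Euclidean norm. Comparing [invariant_measure_swap]
    for the image and for Lebesgue measure itself, both against the ball, eliminates the reflected
    set; the volume of the ball is then cancelled, being positive and finite. *)
Lemma leb_orthogonal n (H : 'M[R]_n) (B : set (cVb R n)) :
  H^T *m H = 1%:M -> measurable B ->
  leb n ((fun y : cVb R n => H *m (y : 'cV[R]_n)) @^-1` B) = leb n B.
Proof.
move=> HH mB.
have HH' : H *m H^T = 1%:M by apply: mulmx1C.
have [nu0 nu0E] := image_measure_exists (leb n) (measurable_mulmx H).
have sf : sigma_finite setT nu0.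
  have [G GT Gf] := sigma_finiteT (leb n).
  exists (fun k => (fun y : cVb R n => H^T *m (y : 'cV[R]_n) : cVb R n) @^-1` G k).
    by rewrite -preimage_bigcup -GT preimage_setT.
  move=> k; have [mG Goo] := Gf k; split.
    exact: (measurable_preimage_cV (measurable_mulmx H^T)).
  rewrite nu0E (_ : _ @^-1` _ = G k) //.
  by apply/seteqP; split => y; rewrite /preimage /= mulmxA HH mul1mx.
have [nu nuE] := sigma_finite_measure_exists sf.
have nuT (a : 'cV[R]_n) (C : set (cVb R n)) : measurable C ->
     nu ((fun y : cVb R n => a + (y : 'cV[R]_n)) @^-1` C) = nu C.
  move=> mC; rewrite !nuE !nu0E.
  rewrite -[RHS](leb_translation (H^T *m a)); last exact: (measurable_preimage_cV (measurable_mulmx H)).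
  congr (leb n _); apply/seteqP; split => y; rewrite /preimage /= mulmxDr mulmxA HH' mul1mx //.
have lebT (a : 'cV[R]_n) (C : set (cVb R n)) : measurable C ->
     leb n ((fun y : cVb R n => a + (y : 'cV[R]_n)) @^-1` C) = leb n C.
  exact: leb_translation.
have E1 := invariant_measure_swap nuT (@measurable_ball_cV n) mB.
have E2 := invariant_measure_swap lebT (@measurable_ball_cV n) mB.
have Eb : nu (ball_cV n) = leb n (ball_cV n).
  rewrite nuE nu0E; congr (leb n _).
  by apply/seteqP; split => y; rewrite /preimage /ball_cV /= euclidean_norm_orthogonal.
rewrite Eb -E2 in E1.
have bfin : leb n (ball_cV n) \is a fin_num by rewrite ge0_fin_numE ?leb_ball_fin.
have bn0 : leb n (ball_cV n) != 0%E by rewrite gt_eqF // leb_ball_gt0.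
rewrite nuE nu0E in E1.
move: E1; rewrite muleC [in RHS]muleC.
move: bn0 bfin; case: (leb n (ball_cV n)) => // b bn0 _ E1.
rewrite eqe in bn0.
rewrite -[LHS]mul1e -[RHS]mul1e.
have -> : 1%E = ((b^-1)%:E * b%:E)%E :> \bar R by rewrite -EFinM mulVf.
by rewrite -!muleA E1.
Qed.

End lebesgue_cV.
Arguments ball_cV : clear implicits.

(** * The standard Gaussian law *)

Section density.
Context d (T : measurableType d) (R : realType).
Import HBNNSimple.

Lemma ge0_integral_mul_indic (mu : {measure set T -> \bar R}) (A : set T) (f : T -> \bar R) :
  (\int[mu]_(x in A) f x = \int[mu]_x (f x * (\1_A x)%:E))%E.
Proof. by rewrite integral_mkcond epatch_indic. Qed.

Lemma ge0_integral_nnsfun_mul (mu : {measure set T -> \bar R}) (h : {nnsfun T >-> R})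
    (f : T -> R) : measurable_fun setT f -> (forall x, 0 <= f x) ->
  (\int[mu]_x ((f x)%:E * (h x)%:E) =
   \sum_(r \in range h) (r%:E * \int[mu]_(x in h @^-1` [set r]) (f x)%:E))%E.
Proof.
move=> mf f0.
transitivity (\int[mu]_x \sum_(r \in range h) ((f x)%:E * (r * \1_(h @^-1` [set r]) x)%:E))%E.
  apply: eq_integral => x _; rewrite -ge0_mule_fsumr; last first.
    by move=> r; exact: nnfun_muleindic_ge0.
  by rewrite fsumEFin // -(fimfunE h x).
have mh r : measurable_fun setT (fun x => (f x)%:E * (r * \1_(h @^-1` [set r]) x)%:E)%E.
  apply: emeasurable_funM; first exact/measurable_EFinP.
  by apply/measurable_EFinP; exact: measurable_funM.
rewrite ge0_integral_fsum //; last first.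
  by move=> r x _; rewrite mule_ge0 ?lee_fin // -lee_fin; exact: nnfun_muleindic_ge0.
apply: eq_fsbigr => r rh.
rewrite [in RHS]ge0_integral_mul_indic -ge0_integralZl //.
- by apply: eq_integral => x _; rewrite EFinM muleCA.
- apply: emeasurable_funM; first exact/measurable_EFinP.
  by apply/measurable_EFinP; exact: measurable_indic.
- by move=> x _; rewrite mule_ge0 // lee_fin.
- by move: rh; rewrite inE => -[t _ <-]; rewrite lee_fin.
Qed.

Lemma ge0_integral_density (mu nu : {measure set T -> \bar R}) (f : T -> R) :
  measurable_fun setT f -> (forall x, 0 <= f x) ->
  (forall A, measurable A -> nu A = \int[mu]_(x in A) (f x)%:E)%E ->
  forall g : T -> \bar R, measurable_fun setT g -> (forall x, 0 <= g x)%E ->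
  (\int[nu]_x g x = \int[mu]_x ((f x)%:E * g x))%E.
Proof.
move=> mf f0 nuE g mg g0.
pose h := nnsfun_approx measurableT mg.
have gE x : g x = lim ((EFin \o h n) x @[n --> \oo]).
  by apply/esym/cvg_lim => //; apply: cvg_nnsfun_approx.
have -> : (\int[nu]_x g x = lim (\int[nu]_x (EFin \o h n) x @[n --> \oo]))%E.
  under eq_integral do rewrite gE.
  apply: monotone_convergence => //.
  - by move=> n; exact/measurable_EFinP.
  - by move=> n x _; rewrite lee_fin.
  - by move=> x _ a b ab; rewrite lee_fin; exact/lefP/nd_nnsfun_approx.
have -> : (\int[mu]_x ((f x)%:E * g x) =
    lim (\int[mu]_x ((f x)%:E * (h n x)%:E) @[n --> \oo]))%E.
  have fgE x : ((f x)%:E * g x = lim (((f x)%:E * (h n x)%:E) @[n --> \oo]))%E.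
    apply/esym/cvg_lim => //; apply: cvgeZl => //.
    by apply: cvg_nnsfun_approx.
  under eq_integral do rewrite fgE.
  apply: monotone_convergence => //.
  - move=> n; apply: emeasurable_funM; exact/measurable_EFinP.
  - by move=> n x _; rewrite mule_ge0 ?lee_fin.
  - by move=> x _ a b ab; rewrite lee_wpmul2l ?lee_fin //; exact/lefP/nd_nnsfun_approx.
apply/congr_lim/funext => n.
have mhr r : measurable (h n @^-1` [set r]) by [].
rewrite ge0_integral_nnsfun_mul //.
(* Writing the integral against [nu] with density 1 lets the same formula for simple functions
   expand both sides. *)
transitivity (\int[nu]_x ((cst 1%R x)%:E * (h n x)%:E))%E.
  by apply: eq_integral => x _ /=; rewrite mul1e.
rewrite ge0_integral_nnsfun_mul //.
apply: eq_fsbigr => r _; congr (_ * _)%E.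
rewrite -nuE //; apply: etrans (integral_cst nu (mhr r) 1%E) _; exact: mul1e.
Qed.

End density.

Section gaussian_cV.
Variable R : realType.

Definition gauss n : {sigma_finite_measure set (cVb R n) -> \bar R} :=
  pmeas (@normal_prob R 0 1) n.

Lemma gaussE n (B : set 'cV[R]_n) : borel B -> std_normal_prob_n B = gauss n B.
Proof. by move=> mB; rewrite [RHS]pmeasE. Qed.

Lemma gauss_setT n : gauss n setT = 1%E.
Proof.
elim: n => [|n IH]; first by rewrite [LHS]pmeas0E // indicT.
rewrite [LHS]pmeasSE //; transitivity (\int[@normal_prob R 0 1]_x 1)%E.
  by apply: eq_integral => x _; rewrite -IH.
by rewrite integral_cst // mul1e; exact: probability_setT.
Qed.

Definition gauss_pdf n (y : 'cV[R]_n) : R :=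
  normal_peak 1 ^+ n * expR (- (\sum_i y i 0 ^+ 2) / 2).

Lemma gauss_pdf_ge0 n (y : 'cV[R]_n) : 0 <= gauss_pdf y.
Proof. by rewrite mulr_ge0 ?exprn_ge0 ?normal_peak_ge0 // expR_ge0. Qed.

Lemma measurable_gauss_pdf n : measurable_fun setT (fun y : cVb R n => gauss_pdf (y : 'cV[R]_n)).
Proof.
apply: measurable_funM => //; apply: measurableT_comp => //.
apply: measurable_funM => //; apply: measurableT_comp => //.
apply: measurable_sum => i; apply: measurable_funX; exact: measurable_cV_coord.
Qed.

Lemma cons_cV0 n (x : R) (y : 'cV[R]_n) : (cons_cV (x, y) : 'cV[R]_n.+1) 0 0 = x.
Proof. by have := congr1 fst (cons_cVK (x, y : cVb R n)). Qed.

Lemma cons_cVS n (x : R) (y : 'cV[R]_n) (i : 'I_n) : (cons_cV (x, y) : 'cV[R]_n.+1) (lift ord0 i) 0 = y i 0.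
Proof.
have -> : lift ord0 i = rshift 1 i :> 'I_n.+1 by apply/ord_inj.
exact: (@col_mxEd R 1 n 1 x%:M y i 0).
Qed.

Lemma normal_pdf01E (x : R) : normal_pdf 0 1 x = normal_peak 1 * expR (- x ^+ 2 / 2).
Proof.
by rewrite normal_pdfE ?oner_eq0 //= /normal_fun subr0 expr1n.
Qed.

Lemma gauss_pdf_cons n (x : R) (y : 'cV[R]_n) :
  gauss_pdf (cons_cV (x, y) : 'cV[R]_n.+1) = normal_pdf 0 1 x * gauss_pdf y.
Proof.
rewrite normal_pdf01E /gauss_pdf big_ord_recl cons_cV0.
under eq_bigr do rewrite cons_cVS.
by rewrite exprS opprD mulrDl expRD; ring.
Qed.

Lemma ge0_integral_normal_prob (g : measurableTypeR R -> \bar R) : measurable_fun setT g ->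
  (forall x, 0 <= g x)%E ->
  (\int[@normal_prob R 0 1]_x g x =
   \int[@lebesgue_measure R]_x ((normal_pdf 0 1 x)%:E * g x))%E.
Proof.
move=> mg g0; apply: ge0_integral_density => //.
- exact: measurable_normal_pdf.
- by move=> x; exact: normal_pdf_ge0.
Qed.

Lemma gauss_density n (B : set (cVb R n)) : measurable B ->
  (gauss n B = \int[leb R n]_(y in B) (gauss_pdf (y : 'cV[R]_n))%:E)%E.
Proof.
elim: n => [|n IH] in B *; move=> mB; rewrite ge0_integral_mul_indic.
  rewrite [RHS]ge0_integral_pmeas0; last 2 first.
  - apply: emeasurable_funM; last exact/measurable_EFinP/measurable_indic.
    by apply/measurable_EFinP; exact: measurable_gauss_pdf.
  - by move=> y; rewrite mule_ge0 ?lee_fin ?gauss_pdf_ge0.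
  rewrite [LHS]pmeas0E // /gauss_pdf big_ord0 expr0 mul1r oppr0 mul0r expR0 mul1e.
  by [].
have mf : measurable_fun setT (fun y : cVb R n.+1 => (gauss_pdf (y : 'cV[R]_n.+1))%:E * (\1_B y)%:E)%E.
  apply: emeasurable_funM; last exact/measurable_EFinP/measurable_indic.
  by apply/measurable_EFinP; exact: measurable_gauss_pdf.
rewrite [RHS]ge0_integral_pmeasS //; last first.
  by move=> y; rewrite mule_ge0 ?lee_fin ?gauss_pdf_ge0.
rewrite [LHS]pmeasSE // [LHS]ge0_integral_normal_prob //; last exact: measurable_pmeas_section.
apply: eq_integral => x _.
have mBx := measurable_cons_section x mB.
rewrite [X in (_ * X)%E](IH _ mBx) ge0_integral_mul_indic -ge0_integralZl //.
- by apply: eq_integral => y _; rewrite gauss_pdf_cons muleA EFinM.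
- apply: emeasurable_funM; last exact/measurable_EFinP/measurable_indic.
  by apply/measurable_EFinP; exact: measurable_gauss_pdf.
- by move=> y; rewrite mule_ge0 ?lee_fin ?gauss_pdf_ge0.
- by rewrite lee_fin normal_pdf_ge0.
Qed.

Lemma ge0_integral_gauss n (g : cVb R n -> \bar R) : measurable_fun setT g ->
  (forall x, 0 <= g x)%E ->
  (\int[gauss n]_x g x =
   \int[leb R n]_x ((gauss_pdf (x : 'cV[R]_n))%:E * g x))%E.
Proof.
move=> mg g0; apply: (@ge0_integral_density _ _ _ (leb R n) (gauss n)) => //.
- exact: measurable_gauss_pdf.
- by move=> x; exact: gauss_pdf_ge0.
- exact: gauss_density.
Qed.

(** The density depends on the Euclidean norm alone, and Lebesgue measure is invariant. *)
Lemma gauss_orthogonal n (H : 'M[R]_n) (B : set (cVb R n)) :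
  H^T *m H = 1%:M -> measurable B ->
  gauss n ((fun y : cVb R n => H *m (y : 'cV[R]_n)) @^-1` B) = gauss n B.
Proof.
move=> HH mB.
have mHB := measurable_preimage_cV (measurable_mulmx H) mB.
rewrite [LHS]gauss_density // [RHS]gauss_density //.
rewrite [LHS]ge0_integral_mul_indic [RHS]ge0_integral_mul_indic.
have lebH A : measurable A -> leb R n A = leb R n ((fun y : cVb R n => H *m (y : 'cV[R]_n)) @^-1` A).
  by move=> mA; rewrite leb_orthogonal.
pose g (y : cVb R n) : \bar R := ((gauss_pdf (y : 'cV[R]_n))%:E * (\1_B y)%:E)%E.
have mg : measurable_fun setT g.
  apply: emeasurable_funM; last exact/measurable_EFinP/measurable_indic.
  by apply/measurable_EFinP; exact: measurable_gauss_pdf.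
have g0 y : (0 <= g y)%E by rewrite mule_ge0 ?lee_fin ?gauss_pdf_ge0.
apply/esym; apply: etrans (ge0_integral_image (measurable_mulmx H) lebH mg g0) _.
rewrite /g.
apply: eq_integral => y _; congr (_%:E * _)%E.
have E (z : 'cV[R]_n) : \sum_i z i 0 ^+ 2 = euclidean_norm z ^+ 2.
  by rewrite sqr_sqrtr //; apply: sumr_ge0 => i _; exact: sqr_ge0.
by rewrite /gauss_pdf !E euclidean_norm_orthogonal.
Qed.

(** The reflection along v = q - e, where e is the first basis row. Since q and e are unit vectors,
    |v| ^ 2 = 2 - 2 q.e = 2 q.v, so q is sent to q - v = e. When q = e there is no direction to
    reflect along and the identity serves. *)
Lemma householder k (q : 'rV[R]_k.+1) : q *m q^T = 1%:M ->
  exists H : 'M[R]_k.+1, H^T *m H = 1%:M /\ q *m H = delta_mx 0 0.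
Proof.
move=> qq; pose e : 'rV[R]_k.+1 := delta_mx 0 0.
have ee : e *m e^T = 1%:M.
  by rewrite trmx_delta mul_delta_mx; apply/matrixP => i j; rewrite !mxE (ord1 i) (ord1 j).
have [qe|qe] := eqVneq q e.
  by exists 1%:M; rewrite trmx1 mulmx1 mulmx1 qe.
have [v vE] : exists v, v = q - e by exists (q - e).
pose c := (v *m v^T) 0 0.
have c0 : c != 0.
  have -> : c = \sum_i v 0 i ^+ 2.
    by rewrite /c mxE; apply: eq_bigr => i _; rewrite [X in _ * X]mxE expr2.
  rewrite psumr_eq0; last by move=> i _; exact: sqr_ge0.
  apply: contra qe => /allP h; rewrite -subr_eq0; apply/eqP/matrixP => i j.
  have := h j (mem_index_enum _); rewrite /= sqrf_eq0 -vE (ord1 i) => /eqP ->.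
  by rewrite mxE.
have vvc : v *m v^T = c%:M by rewrite [LHS]mx11_scalar.
pose s := (q *m e^T) 0 0.
have qes : q *m e^T = s%:M by rewrite [LHS]mx11_scalar.
have eqs : e *m q^T = s%:M by rewrite -[LHS]trmxK trmx_mul trmxK qes tr_scalar_mx.
have cs : c = 2 - 2 * s.
  rewrite /c vE linearB /= mulmxBl !mulmxBr qq ee qes eqs !mxE eqxx !mulr1n; ring.
have qv : q *m v^T = (c / 2)%:M.
  rewrite vE linearB /= mulmxBr qq qes -raddfB /= cs; congr (_%:M); by field.
pose H := 1%:M - (2 / c) *: (v^T *m v).
have HT : H^T = H by rewrite /H linearB /= trmx1 linearZ /= trmx_mul trmxK.
exists H; split.
  rewrite HT /H mulmxBl mul1mx mulmxBr mulmx1 -scalemxAl -scalemxAr.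
  rewrite mulmxA -(mulmxA v^T) vvc mul_mx_scalar -scalemxAl !scalerA.
  rewrite (_ : 2 / c * (2 / c * c) = 2 / c + 2 / c); last by field.
  rewrite scalerDl; set X := _ *: _.
  by rewrite (opprD X X) (addrA X) subrr sub0r opprK subrK.
rewrite /H mulmxBr mulmx1 -scalemxAr mulmxA qv mul_scalar_mx scalerA.
rewrite (_ : 2 / c * (c / 2) = 1) ?scale1r; last by field.
by rewrite vE opprB addrC subrK.
Qed.

Lemma block_delta_cons n k (Q : 'M[R]_(n, k)) (x : R) (y : 'cV[R]_k) :
  (block_mx 1%:M 0 0 Q : 'M[R]_(1 + n, 1 + k)) *m (cons_cV (x, y) : 'cV[R]_(1 + k))
  = cons_cV (x, Q *m y).
Proof.
by rewrite /cons_cV /= mul_block_col !mul0mx mul1mx addr0 add0r.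
Qed.

(** Induction on the rows. A rotation, harmless by [gauss_orthogonal], takes the first row to the
    first basis row; orthogonality then makes the first column of the other rows vanish. The matrix
    has become diag(1, Q'), with Q' again of orthonormal rows, and one coordinate can be peeled
    off. *)
Lemma gauss_row_orthonormal n k (Q : 'M[R]_(n, k)) (B : set (cVb R n)) :
  Q *m Q^T = 1%:M -> measurable B ->
  gauss k ((fun y : cVb R k => Q *m (y : 'cV[R]_k)) @^-1` B) = gauss n B.
Proof.
elim: n => [|n IH] in k Q B *; move=> QQ mB.
  have [B0|B0] := pselect (B (0 : 'cV[R]_0)).
    have -> : B = setT by apply/seteqP; split => // y _; rewrite [y]flatmx0.
    by rewrite preimage_setT !gauss_setT.
  have -> : B = set0 by apply/seteqP; split => // y; rewrite [y]flatmx0.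
  by rewrite preimage_set0 !measure0.
case: k => [|k] in Q QQ *.
  have := congr1 (fun M : 'M[R]_n.+1 => M 0 0) QQ.
  by rewrite !mxE big_ord0 eqxx => /esym/eqP; rewrite oner_eq0.
pose q : 'rV[R]_k.+1 := usubmx (Q : 'M[R]_(1 + n, k.+1)).
pose Q2 : 'M[R]_(n, k.+1) := dsubmx (Q : 'M[R]_(1 + n, k.+1)).
have QE : Q = col_mx q Q2 :> 'M[R]_(1 + n, k.+1) by rewrite vsubmxK.
have : (col_mx q Q2 : 'M[R]_(1 + n, k.+1)) *m (col_mx q Q2 : 'M[R]_(1 + n, k.+1))^T = 1%:M by rewrite -QE.
rewrite tr_col_mx mul_col_row (scalar_mx_block 1 n) => /eq_block_mx[qq qQ2 Q2q Q2Q2].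
have [H [HH qH]] := householder qq.
have HH' : H *m H^T = 1%:M by apply: mulmx1C.
have mQB := measurable_preimage_cV (measurable_mulmx Q) mB.
rewrite -[LHS](gauss_orthogonal HH mQB).
have [Q2H Q2HE] : exists M : 'M[R]_(n, 1 + k), M = Q2 *m H by exists (Q2 *m H).
have Q2He : Q2H *m (delta_mx 0 0 : 'rV[R]_k.+1)^T = 0.
  by rewrite Q2HE -qH trmx_mul mulmxA -(mulmxA Q2) HH' mulmx1 Q2q.
have Q2H0 : lsubmx Q2H = 0.
  apply/matrixP => i j; have := congr1 (fun M : 'cV[R]_n => M i 0) Q2He.
  rewrite trmx_delta mxE (bigD1 0) //= big1 => [|l l0]; last first.
    by rewrite [X in _ * X]mxE (negbTE l0) mulr0.
  rewrite !mxE eqxx mulr1 addr0 => <-; rewrite (ord1 j); congr (Q2H _ _).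
  exact/val_inj.
have QH : Q *m H = block_mx 1%:M 0 0 (rsubmx Q2H) :> 'M[R]_(1 + n, 1 + k).
  rewrite QE (@mul_col_mx _ 1 n) qH -Q2HE block_mxEh -[RHS]vsubmxK.
  rewrite -block_mxEh block_mxEv col_mxKu col_mxKd -Q2H0 hsubmxK; congr col_mx.
  apply/matrixP => i j; rewrite (ord1 i) !mxE.
  have := splitK j; case: (fintype.split j) => l <-; rewrite !mxE //.
  by rewrite (ord1 l) eqxx.
have Q'Q' : rsubmx Q2H *m (rsubmx Q2H)^T = 1%:M.
  have : Q2H *m Q2H^T = 1%:M by rewrite Q2HE trmx_mul mulmxA -(mulmxA Q2) HH' mulmx1.
  by rewrite -{1 2}(hsubmxK Q2H) Q2H0 tr_row_mx mul_row_col mul0mx add0r.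
rewrite [LHS]pmeasSE; last first.
  exact: (measurable_preimage_cV (measurable_mulmx H)).
rewrite [RHS]pmeasSE //; apply: eq_integral => x _.
rewrite -[RHS](IH _ (rsubmx Q2H) _ Q'Q' (measurable_cons_section x mB)).
congr (gauss k _); apply/seteqP.
by split => y; rewrite /preimage /= mulmxA QH block_delta_cons.
Qed.

End gaussian_cV.

(** * Densities and power functions *)

Section density_measure.
Context d (T : measurableType d) (R : realType) (mu : {measure set T -> \bar R}).
Variable w : T -> R.
Hypotheses (mw : measurable_fun setT w) (w0 : forall x, 0 <= w x).

Definition density_measure (A : set T) : \bar R := (\int[mu]_x ((w x)%:E * (\1_A x)%:E))%E.

Let densE A : density_measure A = (\int[mu]_(x in A) (w x)%:E)%E.
Proof. by rewrite ge0_integral_mul_indic. Qed.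

Let dens0 : density_measure set0 = 0%E.
Proof. by rewrite densE integral_set0. Qed.

Let dens_ge0 A : (0 <= density_measure A)%E.
Proof. by apply: integral_ge0 => x _; rewrite mule_ge0 ?lee_fin. Qed.

Let dens_sigma_additive : semi_sigma_additive density_measure.
Proof.
move=> F mF tF mUF; rewrite densE ge0_integral_bigcup //; last 2 first.
- by apply/measurable_EFinP; apply: measurable_funTS.
- by move=> x _; rewrite lee_fin.
rewrite (_ : (fun n => _) = (fun n => \sum_(0 <= i < n) \int[mu]_(x in F i) (w x)%:E))%E.
  by apply: is_cvg_nneseries => n _ _; apply: integral_ge0 => x _; rewrite lee_fin.
by apply/funext => n; apply: eq_bigr => i _; rewrite densE.
Qed.

HB.instance Definition _ := isMeasure.Build _ _ _ density_measure dens0 dens_ge0 dens_sigma_additive.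

Lemma density_measure_exists : exists nu : {measure set T -> \bar R},
  forall A, nu A = (\int[mu]_(x in A) (w x)%:E)%E.
Proof. by exists density_measure. Qed.

End density_measure.

(** * Integrals and measures with power densities *)

Section powR_integrals.
Variable R : realType.
Notation mu := (@lebesgue_measure R).

Lemma powR_inv (x a : R) : 0 <= x -> x^-1 `^ a = x `^ (- a).
Proof. by move=> x0; rewrite -powR_inv1 // -powRrM mulN1r. Qed.

Lemma continuous_powR (c x : R) : 0 < x -> {for x, continuous (fun y : R => y `^ c)}.
Proof.
move=> x0; apply/differentiable_continuous/derivable1_diffP.
by apply: derivable_powR; rewrite in_itv/= x0.
Qed.

(** The factor [k] covers both uses with a nonnegative integrand: k = 1 with a positive exponent
    near 0, and k = -1 with a negative exponent in the tail. *)
Lemma integral_powR_itv (k c a b : R) : 0 < a -> a < b ->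
  (\int[mu]_(x in `[a, b]) (k * (c * x `^ (c - 1)))%:E = (k * b `^ c - k * a `^ c)%:E)%E.
Proof.
move=> a0 ab.
have b0 := lt_trans a0 ab.
have D (x : R) : 0 < x -> is_derive x 1 (fun y : R => k * y `^ c) (k * (c * x `^ (c - 1))).
  by move=> x0; exact: (is_deriveZ _ (is_derive1_powR c x0)).
have C (x : R) : 0 < x -> {for x, continuous (fun y : R => k * y `^ c)}.
  move=> x0; apply/differentiable_continuous/derivable1_diffP.
  by have [] := D x x0.
rewrite EFinB; apply: (@continuous_FTC2 _ (fun x => k * (c * x `^ (c - 1))) (fun x => k * x `^ c)) => //.
- apply: continuous_in_subspaceT => x; rewrite inE /= in_itv /= => /andP[ax _].
  apply: cvgM; first exact: cvg_cst.
  apply: cvgM; first exact: cvg_cst.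
  by apply: continuous_powR; exact: lt_le_trans ax.
- split.
  + move=> x; rewrite in_itv /= => /andP[ax _].
    by have [] := D x (lt_trans a0 ax).
  + by apply: cvg_at_right_filter; exact: C.
  + by apply: cvg_at_left_filter; exact: C.
- move=> x; rewrite in_itv /= => /andP[ax _].
  by rewrite derive1E; have [_ ->] := D x (lt_trans a0 ax).
Qed.

Lemma powR_cvg0_seq (p : R) (u : nat -> R) : 0 < p -> (forall n, 0 < u n) ->
  u @ \oo --> 0 -> (fun n => u n `^ p) @ \oo --> 0.
Proof.
move=> p0 u0 u_cvg.
have /cvg_at_rightP := powR_cvg0 p0; apply; split => //.
Qed.

Lemma measurable_powR_weight (c : R) :
  measurable_fun setT (fun x : measurableTypeR R => (c * x `^ (c - 1))).
Proof. by apply: measurable_funM => //; exact: measurable_powR. Qed.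

Lemma integral_powR_head (p t : R) : 0 < p -> 0 < t ->
  (\int[mu]_(x in `]0%R, t]) (p * x `^ (p - 1))%:E = (t `^ p)%:E)%E.
Proof.
move=> p0 t0.
(* The index k + 2 keeps the left end strictly between 0 and t from k = 0 on. *)
pose u k : R := t / k.+2%:R.
have u0 k : 0 < u k by rewrite divr_gt0.
have ut k : u k < t by rewrite ltr_pdivrMr // ltr_pMr // ltr1n.
pose F k : set (measurableTypeR R) := `[u k, t]%classic.
have FE : \bigcup_k F k = `]0, t]%classic.
  apply/seteqP; split => x /=.
    move=> [k _] /=; rewrite /F /= !in_itv /= => /andP[ux ->].
    by rewrite (lt_le_trans _ ux).
  rewrite in_itv /= => /andP[x0 xt].
  exists (Num.truncn (t / x)) => //; rewrite /F /= in_itv /= xt andbT /u.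
  rewrite ler_pdivrMr // mulrC -ler_pdivrMr // ltW //.
  by apply: (lt_trans (truncnS_gt _)); rewrite ltr_nat.
have ndF : nondecreasing_seq F.
  move=> m k mk; apply/subsetPset => x; rewrite /F /= !in_itv /= => /andP[ux ->].
  rewrite andbT (le_trans _ ux) // /u ler_pM2l // lef_pV2 ?posrE // ler_nat.
  by rewrite !ltnS.
have := @ge0_nondecreasing_set_cvg_integral _ _ _ F (fun x => (p * x `^ (p - 1))%:E) mu ndF.
rewrite FE => /(_ _ _ _)/cvg_lim <- //; last 3 first.
- by move=> k; exact: measurable_itv.
- move=> k; apply: measurable_funTS; apply/measurable_EFinP.
  exact: measurable_powR_weight.
- by move=> k x _; rewrite lee_fin mulr_ge0 ?powR_ge0 // ltW.
apply/cvg_lim => //.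
have E k : (\int[mu]_(x in F k) (p * x `^ (p - 1))%:E = (t `^ p - u k `^ p)%:E)%E.
  have := integral_powR_itv 1 p (u0 k) (ut k); rewrite !mul1r => <-.
  by apply: eq_integral => x _; rewrite mul1r.
under eq_fun do rewrite E.
apply: cvg_EFin; first by near=> k.
rewrite -[X in _ --> X]subr0; apply: cvgB; first exact: cvg_cst.
apply: powR_cvg0_seq => //.
rewrite -(mulr0 t); apply: cvgMr.
by have := @cvg_harmonic R; rewrite -(cvg_shiftS _).
Unshelve. all: by end_near. Qed.

Lemma integral_powR_tail (a t : R) : 0 < a -> 0 < t ->
  (\int[mu]_(x in `[t, +oo[) (a * x `^ (- (a + 1)))%:E = (t `^ (- a))%:E)%E.
Proof.
move=> a0 t0.
pose u k : R := t + k.+1%:R.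
have u0 k : 0 < u k by rewrite addr_gt0.
have ut k : t < u k by rewrite ltrDl.
pose F k : set (measurableTypeR R) := `[t, u k]%classic.
have FE : \bigcup_k F k = `[t, +oo[%classic.
  apply/seteqP; split => x /=.
    by move=> [k _] /=; rewrite /F /= !in_itv /= => /andP[->].
  rewrite in_itv /= andbT => tx.
  exists (Num.truncn x) => //; rewrite /F /= in_itv /= tx /u ltW //.
  by apply: (lt_trans (truncnS_gt _)); rewrite ltrDr.
have ndF : nondecreasing_seq F.
  move=> m k mk; apply/subsetPset => x; rewrite /F /= !in_itv /= => /andP[-> ux] /=.
  by rewrite (le_trans ux) // lerD2l ler_nat ltnS.
have := @ge0_nondecreasing_set_cvg_integral _ _ _ F (fun x => (a * x `^ (- (a + 1)))%:E) mu ndF.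
rewrite FE => /(_ _ _ _)/cvg_lim <- //; last 3 first.
- by move=> k; exact: measurable_itv.
- move=> k; apply: measurable_funTS; apply/measurable_EFinP.
  by apply: measurable_funM => //; exact: measurable_powR.
- by move=> k x _; rewrite lee_fin mulr_ge0 ?powR_ge0 // ltW.
apply/cvg_lim => //.
have E k : (\int[mu]_(x in F k) (a * x `^ (- (a + 1)))%:E = (t `^ (- a) - (u k)^-1 `^ a)%:E)%E.
  have := integral_powR_itv (-1) (- a) t0 (ut k); rewrite powR_inv ?(ltW (u0 _)) //.
  rewrite [_ * t `^ _]mulN1r [_ * u k `^ _]mulN1r opprK [t `^ _ - _]addrC => <-.
  by apply: eq_integral => x _; rewrite mulN1r mulNr opprK opprD.
under eq_fun do rewrite E.
apply: cvg_EFin; first by near=> k.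
rewrite -[X in _ --> X]subr0; apply: cvgB; first exact: cvg_cst.
apply: powR_cvg0_seq => // [n|]; first by rewrite invr_gt0.
have le_h k : (u k)^-1 <= harmonic k.
  by rewrite /= lef_pV2 ?posrE // lerDr ltW.
apply: (@squeeze_cvgr _ _ _ _ (cst 0) (@harmonic R)).
- by near=> k; rewrite le_h andbT invr_ge0 ltW.
- exact: cvg_cst.
- exact: cvg_harmonic.
Unshelve. all: by end_near. Qed.

Lemma measure_line_unique (m1 m2 : {measure set (measurableTypeR R) -> \bar R}) :
  (forall t : R, m1 `]-oo, t]%classic = m2 `]-oo, t]%classic) ->
  (forall t : R, m1 `]-oo, t]%classic < +oo)%E ->
  forall A, measurable A -> m1 A = m2 A.
Proof.
move=> m12 m1oo.
apply: (@measure_unique _ R (measurableTypeR R) (range (fun t : R => `]-oo, t]%classic))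
   (fun k => `]-oo, k%:R]%classic)).
- apply/seteqP; split; last first.
    apply: smallest_sub; first exact: sigma_algebra_measurable.
    by move=> _ [t _ <-]; exact: measurable_itv.
  rewrite RGenOInfty.measurableE; apply: smallest_sub; first exact: smallest_sigma_algebra.
  move=> _ [t ->]; rewrite -setCitvl; apply: sigma_algebraC.
  by apply: sub_sigma_algebra; exists t.
- move=> _ _ [s _ <-] [t _ <-]; exists (Num.min s t) => //.
  by apply/seteqP; split => x /=; rewrite !in_itv /= le_min => /andP.
- by move=> k; exists k%:R.
- apply/seteqP; split => // x _; exists (Num.truncn x).+1 => //=.
  by rewrite in_itv /= ltW // truncnS_gt.
- by move=> _ [t _ <-].
- by move=> k; exact: m1oo.
Qed.

Definition powR_weight (p x : R) : R := \1_(`]0, +oo[%classic) x * (p * x `^ (p - 1)).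

Lemma measurable_powR_weight0 p : measurable_fun setT (powR_weight p).
Proof.
by apply: measurable_funM; [exact: measurable_indic|exact: measurable_powR_weight].
Qed.

Lemma powR_weight_ge0 p x : 0 <= p -> 0 <= powR_weight p x.
Proof. by move=> p0; rewrite mulr_ge0 // mulr_ge0 // powR_ge0. Qed.

(** The measure d(x ^ p) on the positive half-line. Because its values on half-lines are explicit, a
    substitution can be carried out by identifying an image measure with it through
    [measure_line_unique]. *)
Lemma powR_measure_exists (p : R) : 0 < p ->
  exists m : {sigma_finite_measure set (measurableTypeR R) -> \bar R},
    (forall A, m A = \int[mu]_(x in A) (powR_weight p x)%:E)%E /\
    forall t : R, m `]-oo, t]%classic = (if 0 < t then t `^ p else 0)%:E.
Proof.
move=> p0.
have [m mE] := density_measure_exists mu (measurable_powR_weight0 p) (fun x => powR_weight_ge0 x (ltW p0)).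
have mt (t : R) : m `]-oo, t]%classic = (if 0 < t then t `^ p else 0)%:E.
  rewrite mE; case: ifPn => [t0|].
    rewrite -(integral_powR_head p0 t0) [LHS]integral_mkcond [RHS]integral_mkcond.
    apply: eq_integral => x _; rewrite !patchE /powR_weight indicE.
    have -> : (x \in `]0, t]%classic) = (x \in `]0, +oo[%classic) && (x \in `]-oo, t]%classic).
      by apply/idP/idP; rewrite !mem_setE !in_itv /= andbT.
    by case: (x \in `]-oo, t]%classic); case: (x \in `]0, +oo[%classic); rewrite /= ?mul1r ?mul0r.
  rewrite -leNgt => t0; apply: integral0_eq => x /=; rewrite in_itv /= => xt.
  rewrite /powR_weight indicE memNset ?mul0r //= in_itv /= andbT; apply/negP.
  by rewrite -leNgt (le_trans xt).
have sf : sigma_finite setT m.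
  exists (fun k => `]-oo, k%:R]%classic).
    apply/esym/seteqP; split => // x _; exists (Num.truncn x).+1 => //=.
    by rewrite in_itv /= ltW // truncnS_gt.
  by move=> k; split => //; rewrite mt ltry.
have [m' m'E] := sigma_finite_measure_exists sf.
by exists m'; split => [A|t]; rewrite m'E.
Qed.

End powR_integrals.

(** * Gamma integrals *)

Section gamma.
Variable R : realType.
Notation mu := (@lebesgue_measure R).

Let gamma_fun (a x : R) : R := x `^ (a - 1) * expR (- x).

Let gamma_fun_ge0 a x : 0 <= gamma_fun a x.
Proof. by rewrite mulr_ge0 ?powR_ge0 ?expR_ge0. Qed.

Lemma measurable_gamma_fun a : measurable_fun setT (fun x : measurableTypeR R => x `^ (a - 1) * expR (- x)).
Proof.
apply: measurable_funM; first exact: measurable_powR.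
by apply: measurableT_comp.
Qed.

Let mg a (D : set (measurableTypeR R)) : measurable_fun D (fun x => (gamma_fun a x)%:E).
Proof. by apply: measurable_funTS; apply/measurable_EFinP; exact: measurable_gamma_fun. Qed.

Let expR_bound (x : R) k : 0 < x -> expR (- x) <= k.+1`!%:R * x ^- k.+1.
Proof.
move=> x0; rewrite expRN -[leRHS]invrK lef_pV2 ?posrE ?expR_gt0 //; last first.
  by rewrite invr_gt0 mulr_gt0 ?ltr0n ?fact_gt0 // invr_gt0 exprn_gt0.
apply: le_trans (expR_ge1Dxn k (ltW x0)).
by rewrite invfM invrK mulrC lerDr.
Qed.

Lemma ge0_integral_powR_measure (p : R) (m : {measure set (measurableTypeR R) -> \bar R}) :
  0 < p -> (forall A, m A = \int[mu]_(x in A) (powR_weight p x)%:E)%E ->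
  forall g : measurableTypeR R -> \bar R, measurable_fun setT g -> (forall x, 0 <= g x)%E ->
  (\int[m]_x g x = \int[mu]_(x in `]0%R, +oo[) ((p * x `^ (p - 1))%:E * g x))%E.
Proof.
move=> p0 mE g mgg g0.
rewrite (@ge0_integral_density _ _ _ mu m (powR_weight p)) //; last 2 first.
- exact: measurable_powR_weight0.
- by move=> x; apply: powR_weight_ge0; exact: ltW.
rewrite [RHS]ge0_integral_mul_indic; apply: eq_integral => x _.
by rewrite /powR_weight EFinM -muleA muleC.
Qed.

Lemma Gamma_fin (a : R) : 0 < a ->
  (\int[mu]_(x in `]0%R, +oo[) (x `^ (a - 1) * expR (- x))%:E < +oo)%E.
Proof.
(* This k exceeds a, so that on [1, +oo[ the bound (k + 1)! x ^ (- (k + 1)) of the exponential makes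
   the integrand at most (k + 1)! x ^ (-2). *)
move=> a0; pose k := (Num.truncn a).+1.
rewrite (_ : `]0, +oo[%classic = `]0, 1]%classic `|` `]1, +oo[%classic); last first.
  apply/seteqP; split => x /=; rewrite !in_itv /= ?andbT.
    by move=> x0; rewrite x0; case: (leP x 1) => h; [left|right].
  by case=> [/andP[]//|]; exact: lt_trans.
rewrite (@ge0_integral_setU _ _ _ mu `]0, 1]%classic `]1, +oo[%classic) //; last 3 first.
- exact: (mg a).
- by move=> x _; rewrite lee_fin; exact: gamma_fun_ge0.
- apply/disj_setPS => x /=; rewrite !in_itv /= andbT => -[/andP[_ x1]].
  by rewrite ltNge x1.
apply: lte_add_pinfty.
  apply: (@le_lt_trans _ _ (\int[mu]_(x in `]0%R, 1%R]) ((a^-1)%:E * (a * x `^ (a - 1))%:E))%E).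
    apply: ge0_le_integral => //.
    - by move=> x _; rewrite lee_fin; exact: gamma_fun_ge0.
    - exact: (mg a).
    - apply: emeasurable_funM => //; apply: measurable_funTS; apply/measurable_EFinP.
      exact: measurable_powR_weight.
    - move=> x /=; rewrite in_itv /= => /andP[x0 _].
      rewrite -EFinM lee_fin mulrA mulVf ?gt_eqF // mul1r ler_piMr ?powR_ge0 //.
      by rewrite expR_le1 oppr_le0 ltW.
  rewrite ge0_integralZl //; last 3 first.
  - apply: measurable_funTS; apply/measurable_EFinP; exact: measurable_powR_weight.
  - by move=> x _; rewrite lee_fin mulr_ge0 ?powR_ge0 // ltW.
  - by rewrite lee_fin invr_ge0 ltW.
  by rewrite integral_powR_head // -EFinM ltry.
apply: (@le_lt_trans _ _ (\int[mu]_(x in `[1%R, +oo[) ((k.+1`!%:R)%:E * (1 * x `^ (- (1 + 1)))%:E))%E).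
  apply: (@le_trans _ _ (\int[mu]_(x in `[1%R, +oo[) (gamma_fun a x)%:E)%E).
    apply: ge0_subset_integral => //; try exact: (mg a); try (by move=> x _; rewrite lee_fin; exact: gamma_fun_ge0).
    by move=> x /=; rewrite !in_itv /= !andbT; exact: ltW.
  apply: ge0_le_integral => //.
  - by move=> x _; rewrite lee_fin; exact: gamma_fun_ge0.
  - apply: emeasurable_funM => //; apply: measurable_funTS; apply/measurable_EFinP.
    by apply: measurable_funM => //; exact: measurable_powR.
  - move=> x /=; rewrite in_itv /= andbT => x1.
    have x0 : 0 < x by exact: lt_le_trans x1.
    rewrite -EFinM lee_fin mul1r.
    apply: (@le_trans _ _ (x `^ (a - 1) * (k.+1`!%:R * x ^- k.+1))).
      by rewrite ler_wpM2l ?powR_ge0 // expR_bound.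
    rewrite mulrCA ler_wpM2l ?ler0n //.
    rewrite -powR_invn ?(ltW x0) // -powRD; last by rewrite (gt_eqF x0) implybT.
    apply: ler_powR => //.
    have : a < k%:R by exact: truncnS_gt.
    rewrite -(natr1 k); lra.
rewrite ge0_integralZl //.
- by rewrite (@integral_powR_tail R 1 1) // -EFinM ltry.
- apply: measurable_funTS; apply/measurable_EFinP.
  by apply: measurable_funM => //; exact: measurable_powR.
- by move=> x _; rewrite lee_fin mulr_ge0 ?powR_ge0.
Qed.

Lemma GammaE (a : R) : 0 < a ->
  (\int[mu]_(x in `]0%R, +oo[) (x `^ (a - 1) * expR (- x))%:E)%E = (Gamma a)%:E.
Proof.
move=> a0; rewrite /Gamma /Rintegral fineK // ge0_fin_numE ?Gamma_fin //.
by apply: integral_ge0 => x _; rewrite lee_fin gamma_fun_ge0.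
Qed.

Lemma Gamma_gt0 (a : R) : 0 < a -> 0 < Gamma a.
Proof.
move=> a0; rewrite -lte_fin -GammaE //.
apply: (@lt_le_trans _ _ (\int[mu]_(x in `]0%R, 1%R]) ((expR (- 1) / a)%:E * (a * x `^ (a - 1))%:E))%E).
  rewrite ge0_integralZl //; last 3 first.
  - apply: measurable_funTS; apply/measurable_EFinP; exact: measurable_powR_weight.
  - by move=> x _; rewrite lee_fin mulr_ge0 ?powR_ge0 // ltW.
  - by rewrite lee_fin mulr_ge0 ?invr_ge0 ?expR_ge0 // ltW.
  by rewrite integral_powR_head // -EFinM lte_fin powR1 mulr1 divr_gt0 ?expR_gt0.
apply: (@le_trans _ _ (\int[mu]_(x in `]0%R, 1%R]) (gamma_fun a x)%:E)%E).
  apply: ge0_le_integral => //.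
  - move=> x _; rewrite mule_ge0 // lee_fin; first by rewrite divr_ge0 ?expR_ge0 // ltW.
    by rewrite mulr_ge0 ?powR_ge0 // ltW.
  - apply: emeasurable_funM => //; apply: measurable_funTS; apply/measurable_EFinP.
    exact: measurable_powR_weight.
  - move=> x /=; rewrite in_itv /= => /andP[x0 x1].
    rewrite -EFinM lee_fin mulrA divfK ?gt_eqF // mulrC ler_wpM2l ?powR_ge0 //.
    by rewrite ler_expR lerN2.
apply: ge0_subset_integral => //; try exact: (mg a); try (by move=> x _; rewrite lee_fin; exact: gamma_fun_ge0).
by move=> x /=; rewrite !in_itv /= andbT => /andP[].
Qed.

Lemma integral_expR_tail (s : R) :
  (\int[mu]_(x in `[s, +oo[) (expR (- x))%:E = (expR (- s))%:E)%E.
Proof.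
have D (x : R) : is_derive x 1 (fun y : R => - expR (- y)) (expR (- x)).
  apply: is_derive_eq; rewrite ?scaleN1r ?mulN1r ?mulrN1 ?opprK ?mulr1.
  by [].
have C (x : R) : {for x, continuous (fun y : R => - expR (- y))}.
  by apply/differentiable_continuous/derivable1_diffP; have [] := D x.
rewrite (@ge0_continuous_FTC2y _ (fun x => expR (- x)) (fun x => - expR (- x)) s 0).
- by rewrite -EFinB sub0r opprK.
- by move=> x _; exact: expR_ge0.
- apply: continuous_subspaceT => x.
  apply: continuous_comp; first exact: opp_continuous.
  exact: continuous_expR.
- rewrite -oppr0; apply: cvgN; exact: cvgr_expR.
- by move=> x _; have [] := D x.
- by apply: cvg_at_right_filter; exact: C.
- by move=> x _; rewrite derive1E; have [_ ->] := D x.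
Qed.

(** Fubini in place of an integration by parts: exp (- x) is integrated over the region s <= x
    against d(s ^ a) and dx. Integrating over s first gives x ^ a exp (- x); integrating over x
    first gives exp (- s) against a s ^ (a - 1). *)
Lemma GammaS (a : R) : 0 < a -> Gamma (a + 1) = a * Gamma a.
Proof.
move=> a0.
have [m [mE mt]] := powR_measure_exists a0.
pose C : set (measurableTypeR R * measurableTypeR R) := [set sx | sx.1 <= sx.2 /\ 0 < sx.2].
have mC : measurable C.
  rewrite (_ : C = ((fun sx : measurableTypeR R * measurableTypeR R => sx.2 - sx.1) @^-1` `[0, +oo[)
    `&` ((fun sx : measurableTypeR R * measurableTypeR R => sx.2) @^-1` `]0, +oo[)).
    apply: measurableI; rewrite -[X in measurable X]setTI.
      by apply: measurable_funB => //.
    exact: measurable_snd.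
  by apply/seteqP; split => sx; rewrite /C /= !in_itv /= !andbT subr_ge0.
pose f (sx : measurableTypeR R * measurableTypeR R) : \bar R := (\1_C sx * expR (- sx.2))%:E.
have f0 sx : (0 <= f sx)%E by rewrite lee_fin mulr_ge0 ?expR_ge0.
have mf : measurable_fun setT f.
  apply/measurable_EFinP; apply: measurable_funM; first exact: measurable_indic.
  by apply: measurableT_comp => //; exact: measurableT_comp.
have mexp : measurable_fun setT (fun x : measurableTypeR R => (expR (- x))%:E).
  by apply/measurable_EFinP; exact: measurableT_comp.
have := @fubini_tonelli _ _ _ _ _ m mu f mf f0.
have -> : (\int[m]_s \int[mu]_x f (s, x) = (a * Gamma a)%:E)%E.
  have mF : measurable_fun setT (fubini_F mu f) by apply: measurable_fun_fubini_tonelli_F.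
  rewrite (ge0_integral_powR_measure a0 mE mF); last by move=> s; exact: integral_ge0.
  rewrite EFinM -GammaE // -ge0_integralZl //; last 3 first.
  - exact: (mg a).
  - by move=> x _; rewrite lee_fin; exact: gamma_fun_ge0.
  - by rewrite lee_fin ltW.
  apply: eq_integral => s; rewrite mem_setE in_itv /= andbT => s0.
  rewrite EFinM (EFinM (s `^ _)) muleA -EFinM; congr (_ * _)%E.
  rewrite -integral_expR_tail /fubini_F [RHS]integral_mkcond; apply: eq_integral => x _.
  rewrite /f patchE indicE; have -> : ((s, x) \in C) = (x \in `[s, +oo[%classic).
    apply/idP/idP; rewrite !inE /C /= in_itv /= andbT; first by case.
    by move=> sx; split => //; exact: lt_le_trans sx.
  by case: ifPn; rewrite ?mul1r ?mul0r.
have -> : (\int[mu]_x \int[m]_s f (s, x) = (Gamma (a + 1))%:E)%E.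
  rewrite -GammaE ?addr_gt0 // [RHS]ge0_integral_mul_indic; apply: eq_integral => x _.
  rewrite addrK indicE; case: (boolP (x \in _)); rewrite mem_setE in_itv /= andbT => x0; last first.
    rewrite mule0; apply: integral0_eq => s _; rewrite /f indicE memNset ?mul0r //.
    by move=> -[_] /=; apply/negP.
  rewrite mule1 EFinM (_ : (x `^ a)%:E = m `]-oo, x]%classic); last by rewrite mt x0.
  rewrite -(setIT `]-oo, x]%classic) -integral_indic // -ge0_integralZr //; last exact/measurable_EFinP/measurable_indic.
  apply: eq_integral => s _; rewrite /f EFinM /=; congr (_%:E * _)%E.
  rewrite !indicE; congr (nat_of_bool _)%:R.
  apply/idP/idP; rewrite !inE /C /= in_itv /=; first by case.
  by move=> sx; split.
by move=> [->].
Qed.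

End gamma.

(** * Polar coordinates *)

Section restriction.
Context d (T : measurableType d) (R : realType) (mu : {measure set T -> \bar R}).

Lemma restricted_measure_exists (D : set T) : measurable D ->
  exists nu : {measure set T -> \bar R},
    (forall A, measurable A -> nu A = mu (D `&` A)) /\
    forall g : T -> \bar R, measurable_fun setT g -> (forall x, 0 <= g x)%E ->
      (\int[nu]_x g x = \int[mu]_(x in D) g x)%E.
Proof.
move=> mD.
have m1 : measurable_fun setT (\1_D : T -> R) by exact: measurable_indic.
have i0 x : 0 <= \1_D x :> R by rewrite indicE.
have [nu nuE] := density_measure_exists mu m1 i0.
exists nu; split => [A mA|g mg g0].
  by rewrite nuE integral_indic.
rewrite (@ge0_integral_density _ _ _ mu nu (\1_D)) //.
rewrite [RHS]ge0_integral_mul_indic; apply: eq_integral => x _.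
by rewrite muleC.
Qed.

End restriction.

Section half_square.
Variable R : realType.
Notation mu := (@lebesgue_measure R).

Lemma le_sqrt (x y : R) : 0 <= x -> 0 <= y -> (x <= Num.sqrt y) = (x ^+ 2 <= y).
Proof. by move=> x0 y0; rewrite -{1}(ger0_norm x0) -sqrtr_sqr ler_sqrt. Qed.

(** The substitution q = x ^ 2 / 2. The image of Lebesgue measure on the half-line gives ]-oo, t]
    the mass sqrt (2 t), hence it is sqrt 2 times d(q ^ (1 / 2)). *)
Lemma ge0_integral_half_square (g : measurableTypeR R -> \bar R) :
  measurable_fun setT g -> (forall x, 0 <= g x)%E ->
  (\int[mu]_(x in `]0%R, +oo[) g (x ^+ 2 / 2)%R =
   \int[mu]_(q in `]0%R, +oo[) (((2 * q) `^ (- 2^-1))%:E * g q))%E.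
Proof.
move=> mg g0.
have p0 : 0 < 2^-1 :> R by rewrite invr_gt0.
have [m [mE mt]] := powR_measure_exists p0.
have [l [lE lint]] := restricted_measure_exists mu (measurable_itv `]0, +oo[).
have msq : measurable_fun setT (fun x : measurableTypeR R => x ^+ 2 / 2 : measurableTypeR R).
  by apply: measurable_funM => //; exact: measurable_funX.
have [k kE] := image_measure_exists l msq.
have s0 : 0 <= Num.sqrt 2 :> R by exact: sqrtr_ge0.
pose r : {nonneg R} := NngNum s0.
have mtk (t : R) : k `]-oo, t]%classic = mscale r m `]-oo, t]%classic.
  rewrite kE lE; last by rewrite -[X in measurable X]setTI; exact: msq.
  rewrite /mscale /= mt; case: ifPn => [t0|].
    rewrite powR12_sqrt ?(ltW t0) // -EFinM -sqrtrM //.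
    rewrite (_ : _ `&` _ = `]0, Num.sqrt (2 * t)]%classic).
      rewrite lebesgue_measure_itv /= lte_fin sqrtr_gt0 mulr_gt0 //.
      by rewrite -EFinB subr0.
    have t20 : 0 <= 2 * t by rewrite mulr_ge0 // ltW.
    apply/seteqP; split => x /=; rewrite !in_itv /= andbT.
      by move=> [x0 xt]; rewrite x0 /= le_sqrt ?(ltW x0) //; lra.
    by move=> /andP[x0]; rewrite x0 /= le_sqrt ?(ltW x0) // => xt; split => //; lra.
  rewrite -leNgt => t0; rewrite mule0 (_ : _ `&` _ = set0) ?measure0 //.
  apply/seteqP; split => x //=; rewrite !in_itv /= andbT => -[x0 xt].
  by have : 0 < x ^+ 2 / 2 by [rewrite divr_gt0 // exprn_gt0]; lra.
have kmE : forall A, measurable A -> k A = mscale r m A.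
  apply: measure_line_unique => t; rewrite mtk // /mscale /= mt.
  by rewrite -EFinM ltry.
transitivity (\int[l]_x g (x ^+ 2 / 2)%R)%E.
  by rewrite lint //; exact: (measurableT_comp mg).
rewrite -(ge0_integral_image msq (fun A _ => kE A) mg g0).
rewrite (eq_measure_integral (mscale r m)); last by move=> A mA _; exact: kmE.
rewrite ge0_integral_mscale // (ge0_integral_powR_measure p0 mE mg g0).
rewrite -ge0_integralZl //; last 2 first.
- apply: emeasurable_funM; last exact: measurable_funTS.
  by apply: measurable_funTS; apply/measurable_EFinP; exact: measurable_powR_weight.
- by move=> x _; rewrite mule_ge0 // lee_fin mulr_ge0 ?powR_ge0 // ltW.
apply: eq_integral => q; rewrite mem_setE in_itv /= andbT => q0.
rewrite muleA -EFinM; congr (_%:E * _)%E.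
rewrite powRM ?(ltW q0) // [2 `^ _]powRN powR12_sqrt // mulrA.
congr (_ * _ `^ _); last by field.
have s20 : Num.sqrt 2 != 0 :> R by rewrite gt_eqF // sqrtr_gt0.
apply: (mulfI s20); rewrite divff // mulrA -expr2 sqr_sqrtr // divff //.
Qed.

(* Up to the factor [(2 pi) ^ (- 1 / 2)] of the normal density, this is the
   constant [m_alpha] for [b = alpha]. *)
Lemma integral_powR_gauss (b : R) : 0 < b ->
  (\int[mu]_(x in `]0%R, +oo[) (x `^ b * expR (- x ^+ 2 / 2))%:E
   = (2 `^ ((b - 1) / 2) * Gamma ((b + 1) / 2))%:E)%E.
Proof.
move=> b0.
pose g (q : measurableTypeR R) : \bar R := ((2 * q) `^ (b / 2) * expR (- q))%:E.
have mg : measurable_fun setT g.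
  apply/measurable_EFinP; apply: measurable_funM; last exact: measurableT_comp.
  have m2 : measurable_fun setT (fun q : measurableTypeR R => 2 * q : measurableTypeR R).
    by apply: measurable_funM.
  exact: (measurableT_comp (@measurable_powR R (b / 2)) m2).
have g0 q : (0 <= g q)%E by rewrite lee_fin mulr_ge0 ?powR_ge0 ?expR_ge0.
transitivity (\int[mu]_(x in `]0%R, +oo[) g (x ^+ 2 / 2)%R)%E.
  apply: eq_integral => x; rewrite mem_setE in_itv /= andbT => x0.
  rewrite /g mulNr; congr (_ * _)%:E.
  rewrite mulrC divfK // -powR_mulrn ?(ltW x0) // -powRrM; congr (_ `^ _).
  by field.
rewrite ge0_integral_half_square // EFinM -GammaE; last by rewrite divr_gt0 // addr_gt0.
apply: etrans; last first.
  apply: ge0_integralZl.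
  - exact: measurable_itv.
  - by apply: measurable_funTS; apply/measurable_EFinP; exact: measurable_gamma_fun.
  - by move=> x _; rewrite lee_fin mulr_ge0 ?powR_ge0 ?expR_ge0.
  - by rewrite lee_fin powR_ge0.
apply: eq_integral => q; rewrite mem_setE in_itv /= andbT => q0.
rewrite /g -!EFinM !mulrA; congr (_ * _)%:E.
have q20 : 2 * q != 0 by rewrite mulf_neq0 // gt_eqF.
rewrite -powRD; last by rewrite q20 implybT.
rewrite (_ : - 2^-1 + b / 2 = (b - 1) / 2); last by field.
rewrite powRM ?(ltW q0) //; congr (_ * _ `^ _).
by field.
Qed.

End half_square.

Section polar.
Variable R : realType.
Notation mu := (@lebesgue_measure R).

Definition ball_volume n : R := fine (leb R n (ball_cV R n)).

Lemma ball_volumeE n : (ball_volume n)%:E = leb R n (ball_cV R n).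
Proof. by rewrite fineK // ge0_fin_numE // leb_ball_fin. Qed.

Lemma ball_volume_gt0 n : 0 < ball_volume n.
Proof. by rewrite -lte_fin ball_volumeE leb_ball_gt0. Qed.

Definition direction n (y : cVb R n) : cVb R n :=
  (euclidean_norm (y : 'cV[R]_n))^-1 *: (y : 'cV[R]_n).

Lemma measurable_direction n : measurable_fun setT (@direction n).
Proof.
apply: measurable_scalecV => //.
rewrite (_ : (fun t => _) = (fun y : cVb R n => euclidean_norm (y : 'cV[R]_n) `^ (-1))).
  exact: (measurableT_comp (@measurable_powR R (-1)) (@measurable_euclidean_norm R n)).
by apply/funext => y; rewrite powR_inv1 // sqrtr_ge0.
Qed.

Definition punctured_ball n : set (cVb R n) :=
  [set y | 0 < euclidean_norm (y : 'cV[R]_n) <= 1].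

Lemma measurable_punctured_ball n : measurable (@punctured_ball n).
Proof.
rewrite (_ : @punctured_ball n = (fun y : cVb R n => euclidean_norm (y : 'cV[R]_n)) @^-1` `]0, 1]).
  by rewrite -[X in measurable X]setTI; exact: measurable_euclidean_norm.
by apply/seteqP; split => y; rewrite /punctured_ball /= in_itv.
Qed.

(** Multiplied by the volume of the ball, [sphere_prob] is the image of Lebesgue measure on the
    punctured ball under [direction]. It is bounded by that volume, so the [fine] in the definition
    of [sphere_prob] loses nothing. *)
Lemma sphere_measure_exists n :
  exists sg : {sigma_finite_measure set (cVb R n) -> \bar R},
    forall B : set (cVb R n), measurable B ->
      sg B = leb R n (@punctured_ball n `&` @direction n @^-1` B) /\
      sg B = ((ball_volume n)%:E * sphere_prob (B : set 'cV[R]_n))%E /\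
      (sg B < +oo)%E.
Proof.
have [l [lE _]] := restricted_measure_exists (leb R n) (@measurable_punctured_ball n).
have [s sE] := image_measure_exists l (@measurable_direction n).
have mdir B : measurable B -> measurable (@direction n @^-1` B).
  by move=> mB; exact: measurable_preimage_cV (@measurable_direction n) mB.
have sE' B : measurable B -> s B = leb R n (@punctured_ball n `&` @direction n @^-1` B).
  by move=> mB; rewrite sE lE //; exact: mdir.
have sle B : measurable B -> (s B <= leb R n (ball_cV R n))%E.
  move=> mB; rewrite sE' //; apply: le_measure; rewrite ?inE.
  - by apply: measurableI; [exact: measurable_punctured_ball|exact: mdir].
  - exact: measurable_ball_cV.
  - by move=> y [/= /andP[]].
have sf : sigma_finite setT s.
  exists (fun _ => setT); first by rewrite bigcup_const.
  by move=> i; split => //; exact: le_lt_trans (sle _ measurableT) (leb_ball_fin _ _).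
have [s' s'E] := sigma_finite_measure_exists sf.
exists s' => B mB; rewrite s'E; split; first exact: sE'.
split; last exact: le_lt_trans (sle _ mB) (leb_ball_fin _ _).
rewrite /sphere_prob lebE; last first.
  by have := measurableI _ _ (@measurable_punctured_ball n) (mdir _ mB).
rewrite [X in (_ / fine X)%:E]lebE; last exact: measurable_ball_cV.
rewrite -/(ball_volume n) -EFinM mulrCA divff ?gt_eqF ?ball_volume_gt0 // mulr1.
have := sE' _ mB; rewrite /setI /preimage /direction => <-.
by rewrite fineK // ge0_fin_numE // (le_lt_trans (sle _ mB)) // leb_ball_fin.
Qed.

Lemma euclidean_norm0 n : euclidean_norm (0 : 'cV[R]_n) = 0.
Proof. by rewrite /euclidean_norm big1 ?sqrtr0 // => i _; rewrite mxE expr0n. Qed.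

Lemma euclidean_norm_ge0 n (y : 'cV[R]_n) : 0 <= euclidean_norm y.
Proof. exact: sqrtr_ge0. Qed.

Lemma euclidean_norm_eq0 n (y : 'cV[R]_n) : euclidean_norm y = 0 -> y = 0.
Proof.
move=> y0; apply/matrixP => i j; rewrite (ord1 j) mxE; apply/eqP.
by rewrite -normr_le0 -y0 euclidean_norm_ge_coord.
Qed.

Lemma euclidean_normZ n (r : R) (y : 'cV[R]_n) : 0 <= r ->
  euclidean_norm (r *: y) = r * euclidean_norm y.
Proof.
move=> r0; rewrite /euclidean_norm.
under eq_bigr do rewrite mxE exprMn.
by rewrite -mulr_sumr sqrtrM ?sqr_ge0 // sqrtr_sqr ger0_norm.
Qed.

(** Such a set is unchanged by doubling, which divides its finite volume by 2 ^ (n + 1). The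
    dimension has to be positive: in dimension 0 the origin has mass 1. *)
Lemma leb_null0 n (A : set (cVb R n.+1)) : measurable A ->
  (forall y, A y -> y = (0 : 'cV[R]_n.+1)) -> leb R n.+1 A = 0%E.
Proof.
move=> mA A0.
have Afin : (leb R n.+1 A < +oo)%E.
  apply: le_lt_trans (leb_ball_fin R n.+1); apply: le_measure; rewrite ?inE //.
    exact: measurable_ball_cV.
  by move=> y /A0 ->; rewrite /ball_cV /= euclidean_norm0.
have := leb_scale (ltr0n R 2) mA.
rewrite (_ : _ @^-1` A = A); last first.
  apply/seteqP; split => y /=; rewrite /preimage /=.
    move=> Ay; have /= y0 := A0 _ Ay; rewrite y0 in Ay.
    suff -> : y = (0 : 'cV[R]_n.+1) by [].
    by apply: (scalerI (_ : 2 != 0 :> R)) => //; rewrite y0 scaler0.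
  by move=> Ay; have /= y0 := A0 _ Ay; rewrite y0 in Ay *; rewrite scaler0.
have : leb R n.+1 A \is a fin_num by rewrite ge0_fin_numE.
move: (leb R n.+1 A) => [r| |] // _; rewrite -EFinM => -[E]; congr EFin.
have : (1 - 2 ^- n.+1) * r = 0 by rewrite mulrBl mul1r -E subrr.
move/eqP; rewrite mulf_eq0 => /orP[|/eqP//].
rewrite subr_eq0 => /eqP/esym/eqP; rewrite invr_eq1.
by rewrite gt_eqF // exprn_egt1 // ltr1n.
Qed.

(** For t > 0 and up to the origin, the set is the dilation by sqrt (c t) of the part of the
    punctured ball lying in the cone over B. *)
Lemma leb_polar_cell n (c t : R) (B : set (cVb R n.+1)) : 0 < c -> measurable B ->
  leb R n.+1 [set y | euclidean_norm (y : 'cV[R]_n.+1) ^+ 2 / c <= t /\ B (direction y)] =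
  ((if 0 < t then (c * t) `^ (n.+1%:R / 2) else 0)%:E *
   leb R n.+1 (@punctured_ball n.+1 `&` @direction n.+1 @^-1` B))%E.
Proof.
move=> c0 mB.
have mN : measurable_fun setT (fun y : cVb R n.+1 => euclidean_norm (y : 'cV[R]_n.+1) ^+ 2 / c : measurableTypeR R).
  by apply: measurable_funM => //; apply: measurable_funX; exact: measurable_euclidean_norm.
have mdir := measurable_preimage_cV (@measurable_direction n.+1) mB.
set S := (X in leb R n.+1 X = _).
have SE : S = (fun y : cVb R n.+1 => euclidean_norm (y : 'cV[R]_n.+1) ^+ 2 / c) @^-1` `]-oo, t]
   `&` @direction n.+1 @^-1` B.
  by apply/seteqP; split => y; rewrite /S /= in_itv.
have mS : measurable (S : set (cVb R n.+1)).
  rewrite SE; apply: measurableI => //.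
  by rewrite -[X in measurable X]setTI; exact: mN.
case: ifPn => [t0|]; last first.
  rewrite -leNgt => t0; rewrite mul0e; apply: leb_null0 => // y [yt _].
  apply: euclidean_norm_eq0; apply/eqP; rewrite -sqrf_eq0 eq_le sqr_ge0 andbT.
  by move: yt; rewrite ler_pdivrMr // => /le_trans; apply; rewrite mulr_le0_ge0 // ltW.
pose r := Num.sqrt (c * t).
have r0 : 0 < r by rewrite sqrtr_gt0 mulr_gt0.
have mC := measurableI _ _ (@measurable_punctured_ball n.+1) mdir.
have mr := measurable_preimage_cV (measurable_scale r^-1) mC.
have -> : leb R n.+1 S = leb R n.+1 ((fun y : cVb R n.+1 => r^-1 *: (y : 'cV[R]_n.+1)) @^-1`
    (@punctured_ball n.+1 `&` @direction n.+1 @^-1` B)).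
  have m0 : measurable [set y : cVb R n.+1 | euclidean_norm (y : 'cV[R]_n.+1) = 0].
    rewrite (_ : [set y | _] = (fun y : cVb R n.+1 => euclidean_norm (y : 'cV[R]_n.+1)) @^-1` [set 0]) //.
    rewrite -[X in measurable X]setTI; exact: measurable_euclidean_norm.
  (* The origin, whose direction is 0 by the convention 0^-1 = 0, may lie in [S] but not in the
     dilated punctured ball; it is split off as a null set. *)
  rewrite -(setUIDK S [set y : cVb R n.+1 | euclidean_norm (y : 'cV[R]_n.+1) = 0]).
  rewrite measureU; last 3 first.
  - exact: measurableI.
  - exact: measurableD.
  - by apply/seteqP; split => y //= [[_ ?] [_ ?]].
  rewrite [X in (X + _)%E]leb_null0; last 2 first.
  - exact: measurableI.
  - by move=> y [_ /=]; exact: euclidean_norm_eq0.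
  rewrite add0e; congr (leb R n.+1 _); apply/seteqP.
  have ri0 : 0 <= r^-1 by rewrite invr_ge0 ltW.
  have ct0 : 0 <= c * t by rewrite mulr_ge0 // ltW.
  have dirE (y : 'cV[R]_n.+1) : direction (r^-1 *: y) = direction y.
    rewrite /direction euclidean_normZ // invfM invrK scalerA mulrAC divff ?mul1r //.
    by rewrite gt_eqF.
  have cond (y : 'cV[R]_n.+1) : (euclidean_norm (r^-1 *: y) <= 1) = (euclidean_norm y ^+ 2 / c <= t).
    rewrite euclidean_normZ // mulrC ler_pdivrMr // mul1r le_sqrt ?euclidean_norm_ge0 //.
    by rewrite ler_pdivrMr // mulrC.
  have cond0 (y : 'cV[R]_n.+1) : (0 < euclidean_norm (r^-1 *: y)) = (0 < euclidean_norm y).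
    by rewrite euclidean_normZ // pmulr_rgt0 // invr_gt0.
  split => y; rewrite /S /punctured_ball /preimage /= dirE cond cond0.
    move=> [[yt By] /eqP y0]; split => //; rewrite yt andbT.
    by rewrite lt_neqAle eq_sym y0 euclidean_norm_ge0.
  by move=> [/andP[y0 yt] By]; split => //; apply/eqP; rewrite gt_eqF.
rewrite leb_scale ?invr_gt0 //; congr (_%:E * _)%E.
have ct0 : 0 <= c * t by rewrite mulr_ge0 // ltW.
by rewrite -exprVn invrK [n.+1%:R / 2]mulrC powRrM powR12_sqrt // powR_mulrn ?sqrtr_ge0.
Qed.

Lemma measurable_scaled_preimage n (c : R) (D : set (cVb R n)) : measurable D ->
  measurable [set qu : measurableTypeR R * cVb R n | D (Num.sqrt (c * qu.1) *: (qu.2 : 'cV[R]_n))].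
Proof.
move=> mD; rewrite -[X in measurable X]setTI.
apply: (@measurable_scalecV R _ (measurableTypeR R * cVb R n)%type n
  (fun qu => Num.sqrt (c * qu.1)) snd) => //.
apply: (measurableT_comp (continuous_measurable_fun (@sqrt_continuous R))).
by apply: measurable_funM.
Qed.

(* Polar coordinates, with the squared radius [c q] as radial variable. *)
Lemma polar_integral n (c : R) (h : measurableTypeR R -> R) (D : set (cVb R n.+1)) : 0 < c ->
  measurable_fun setT h -> (forall q, 0 <= h q) -> measurable D ->
  (\int[leb R n.+1]_y (h (euclidean_norm (y : 'cV[R]_n.+1) ^+ 2 / c) * \1_D y)%:E =
   \int[mu]_(q in `]0%R, +oo[)
     ((ball_volume n.+1 * (c `^ (n.+1%:R / 2) * (n.+1%:R / 2 * q `^ (n.+1%:R / 2 - 1))) * h q)%:E *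
      sphere_prob [set u : 'cV[R]_n.+1 | D (Num.sqrt (c * q) *: u)%R]))%E.
Proof.
move=> c0 mh h0 mD.
pose p : R := n.+1%:R / 2.
have p0 : 0 < p by rewrite divr_gt0.
have [m [mE mt]] := powR_measure_exists p0.
have [sg sgE] := sphere_measure_exists n.+1.
have cp0 : 0 <= c `^ p by exact: powR_ge0.
pose k : {nonneg R} := NngNum cp0.
pose Phi (y : cVb R n.+1) : measurableTypeR R * cVb R n.+1 :=
  (euclidean_norm (y : 'cV[R]_n.+1) ^+ 2 / c, direction y).
have mN : measurable_fun setT (fun y : cVb R n.+1 => euclidean_norm (y : 'cV[R]_n.+1) ^+ 2 / c : measurableTypeR R).
  by apply: measurable_funM => //; apply: measurable_funX; exact: measurable_euclidean_norm.
have mPhi : measurable_fun setT Phi.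
  apply/measurable_fun_pairP; split => //=; exact: measurable_direction.
have [m' m'E] := image_measure_exists (leb R n.+1) mPhi.
have sf2 : sigma_finite setT (mscale k m).
  exists (fun j => `]-oo, j%:R]%classic).
    apply/esym/seteqP; split => // x _; exists (Num.truncn x).+1 => //=.
    by rewrite in_itv /= ltW // truncnS_gt.
  by move=> j; split => //; rewrite /mscale /= mt -EFinM ltry.
have [m2 m2E] := sigma_finite_measure_exists sf2.
(* Under [Phi], Lebesgue measure becomes the product of a radial and a spherical measure. Only
   rectangles need checking, and for a fixed [B] only those over half-lines, which are the polar
   cells. *)
have cellE A B : measurable A -> measurable B -> m' (A `*` B) = (m2 A * sg B)%E.
  move=> mA mB; have [sg1 [_ sg2]] := sgE B mB.
  have mdir := measurable_preimage_cV (@measurable_direction n.+1) mB.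
  have [l [lE _]] := restricted_measure_exists (leb R n.+1) mdir.
  have [kB kBE] := image_measure_exists l mN.
  have fB0 : 0 <= fine (sg B) by exact: fine_ge0.
  pose kb : {nonneg R} := NngNum fB0.
  have sgfin : sg B = (fine (sg B))%:E by rewrite fineK // ge0_fin_numE.
  have kBA C : measurable C -> kB C = m' (C `*` B).
    move=> mC; rewrite kBE lE; last first.
      by rewrite -[X in measurable X]setTI; exact: mN.
    by rewrite m'E; congr (leb R n.+1 _); apply/seteqP; split => y []; rewrite /Phi.
  have kBt (t : R) : kB `]-oo, t]%classic = mscale kb (mscale k m) `]-oo, t]%classic.
    rewrite kBA //= m'E.
    have := leb_polar_cell t c0 mB; rewrite -sg1.
    rewrite (_ : [set y | _] = Phi @^-1` (`]-oo, t] `*` B)); last first.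
      by apply/seteqP; split => y; rewrite /Phi /preimage /= in_itv.
    move=> E1; apply: etrans E1 _; transitivity ((fine (sg B))%:E * ((c `^ p)%:E * m `]-oo, t]%classic))%E => //.
    rewrite mt {1}sgfin -!EFinM; congr EFin.
    by case: ifPn => t0; rewrite ?mul0r ?mulr0 // powRM ?(ltW c0) ?(ltW t0) // mulrC.
  rewrite -kBA // (measure_line_unique kBt _ mA); last first.
    move=> t; rewrite kBt.
    have -> : mscale kb (mscale k m) `]-oo, t]%classic = ((fine (sg B))%:E * ((c `^ p)%:E * m `]-oo, t]%classic))%E by [].
    by rewrite mt -!EFinM ltry.
  transitivity ((fine (sg B))%:E * (m2 A))%E; first by rewrite m2E.
  by rewrite -sgfin muleC.
have m'prod X : measurable X -> m' X = (m2 \x sg)%E X.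
  by move=> mX; rewrite (product_measure_unique cellE).
pose E : set (measurableTypeR R * cVb R n.+1) := [set qu | D (Num.sqrt (c * qu.1) *: (qu.2 : 'cV[R]_n.+1))].
have mE' : measurable E by exact: measurable_scaled_preimage.
pose G (qu : measurableTypeR R * cVb R n.+1) : \bar R := (h qu.1 * \1_E qu)%:E.
have G0 qu : (0 <= G qu)%E by rewrite lee_fin mulr_ge0.
have mG : measurable_fun setT G.
  apply/measurable_EFinP; apply: measurable_funM; last exact: measurable_indic.
  exact: (measurableT_comp mh).
transitivity (\int[leb R n.+1]_y G (Phi y))%E.
  apply: eq_integral => y _; rewrite /G /Phi /=; congr (_ * _)%:E.
  rewrite !indicE; congr (nat_of_bool _)%:R.
  suff E1 : Num.sqrt (c * (euclidean_norm (y : 'cV[R]_n.+1) ^+ 2 / c)) *: direction y = y :> 'cV[R]_n.+1.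
    by apply/idP/idP; rewrite !inE /E /= E1.
  rewrite mulrC divfK ?gt_eqF // sqrtr_sqr ger0_norm ?euclidean_norm_ge0 //.
  rewrite /direction scalerA; have [y0|y0] := eqVneq (euclidean_norm (y : 'cV[R]_n.+1)) 0.
    by rewrite y0 mul0r scale0r (euclidean_norm_eq0 y0).
  by rewrite divff // scale1r.
rewrite -(ge0_integral_image mPhi (fun A _ => m'E A) mG G0).
rewrite (eq_measure_integral (m2 \x sg)%E); last by move=> A mA _; exact: m'prod.
rewrite fubini_tonelli1 //.
pose F (q : measurableTypeR R) : \bar R := ((h q)%:E * sg [set u | D (Num.sqrt (c * q) *: (u : 'cV[R]_n.+1))%R])%E.
have mDq q : measurable [set u : cVb R n.+1 | D (Num.sqrt (c * q) *: (u : 'cV[R]_n.+1))%R].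
  exact: measurable_preimage_cV (measurable_scale _) mD.
have FE q : fubini_F sg G q = F q.
  have sgI X : measurable X -> sg X = (\int[sg]_u (\1_X u)%:E)%E.
    by move=> mX; rewrite integral_indic // setIT.
  rewrite /fubini_F /F sgI // -ge0_integralZl //; last 2 first.
  - exact/measurable_EFinP/measurable_indic.
  - by rewrite lee_fin.
have F0 q : (0 <= F q)%E by rewrite mule_ge0 ?lee_fin.
have mF : measurable_fun setT F.
  rewrite -(_ : fubini_F sg G = F); last exact/funext.
  exact: measurable_fun_fubini_tonelli_F.
transitivity (\int[m2]_q F q)%E; first by apply: eq_integral => q _; exact: FE.
rewrite (eq_measure_integral (mscale k m)); last by move=> A mA _; exact: m2E.
rewrite ge0_integral_mscale // (ge0_integral_powR_measure p0 mE mF F0).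
rewrite -[LHS]ge0_integralZl //; last 2 first.
- apply: emeasurable_funM; last exact: measurable_funTS.
  by apply: measurable_funTS; apply/measurable_EFinP; exact: measurable_powR_weight.
- by move=> q _; rewrite mule_ge0 // lee_fin mulr_ge0 ?powR_ge0 // ltW.
apply: eq_integral => q _; rewrite /F.
have [_ [-> _]] := sgE _ (mDq q).
rewrite !muleA; congr (mule _ _); rewrite -!EFinM; congr EFin.
by rewrite /= -/p; ring.
Qed.

End polar.

(** * Gaussian mixtures and the multivariate t law *)

Section gaussian_constants.
Variable R : realType.
Notation mu := (@lebesgue_measure R).

Lemma normal_peak1E : normal_peak 1 = (2 * pi) `^ (- 2^-1) :> R.
Proof.
rewrite /normal_peak expr1n mul1r -mulr_natl powRN powR12_sqrt //.
by rewrite mulr_ge0 // pi_ge0.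
Qed.

Lemma normal_peak1X n : normal_peak 1 ^+ n = (2 * pi) `^ (- (n%:R / 2)) :> R.
Proof.
rewrite normal_peak1E -powR_mulrn ?powR_ge0 // -powRrM; by congr (_ `^ _); field.
Qed.

Lemma sphere_probT n : sphere_prob [set: 'cV[R]_n.+1] = 1%E.
Proof.
have [sg sgE] := sphere_measure_exists R n.+1.
have [E1 [E2 _]] := sgE _ measurableT.
have := @leb_polar_cell R n 1 1 setT ltr01 measurableT.
rewrite -E1 E2 ltr01 mulr1 powR1 mul1e -[RHS]/(_ * _)%E => E3.
have : leb R n.+1 (ball_cV R n.+1) = ((ball_volume R n.+1)%:E * sphere_prob [set: 'cV[R]_n.+1])%E.
  rewrite -E3; congr (leb R n.+1 _); apply/seteqP; split => y; rewrite /ball_cV /= divr1.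
    by move=> y1; split => //; rewrite exprn_ile1 // euclidean_norm_ge0.
  by move=> [y1 _]; rewrite -(@ler_pXn2r _ 2) ?nnegrE ?euclidean_norm_ge0 // expr1n.
rewrite -ball_volumeE; have v0 := ball_volume_gt0 R n.+1.
rewrite /sphere_prob; move: (fine _ / _) => r; rewrite -EFinM => -[E].
by congr EFin; apply: (mulfI (lt0r_neq0 v0)); rewrite mulr1.
Qed.

Lemma sum_sqrE n (y : 'cV[R]_n) : \sum_i y i 0 ^+ 2 = euclidean_norm y ^+ 2.
Proof. by rewrite sqr_sqrtr //; apply: sumr_ge0 => i _; exact: sqr_ge0. Qed.

(** With c = 2 in polar coordinates the Gaussian density becomes a constant times exp (- q), so that
    radial expectations are Gamma integrals. The function g = 1 yields the volume of the ball, g(q)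
    = 2 |q| in dimension one the variance. *)
Lemma gauss_radial n (g : measurableTypeR R -> R) : measurable_fun setT g -> (forall q, 0 <= g q) ->
  (\int[gauss R n.+1]_y (g (euclidean_norm (y : 'cV[R]_n.+1) ^+ 2 / 2))%:E =
   (ball_volume R n.+1 * (n.+1%:R / 2) * pi `^ (- (n.+1%:R / 2)))%:E *
   \int[mu]_(q in `]0%R, +oo[) (g q * (q `^ (n.+1%:R / 2 - 1) * expR (- q)))%:E)%E.
Proof.
move=> mg g0.
have mN : measurable_fun setT (fun y : cVb R n.+1 => euclidean_norm (y : 'cV[R]_n.+1) ^+ 2 / 2 : measurableTypeR R).
  by apply: measurable_funM => //; apply: measurable_funX; exact: measurable_euclidean_norm.
pose h (q : measurableTypeR R) : R := normal_peak 1 ^+ n.+1 * expR (- q) * g q.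
have mh : measurable_fun setT h.
  by apply: measurable_funM => //; apply: measurable_funM => //; exact: measurableT_comp.
have h0 q : 0 <= h q.
  by rewrite mulr_ge0 // mulr_ge0 ?expR_ge0 // exprn_ge0 // normal_peak_ge0.
rewrite ge0_integral_gauss; last 2 first.
- by apply/measurable_EFinP; exact: (measurableT_comp mg).
- by move=> y; rewrite lee_fin.
have := @polar_integral R n 2 h setT (ltr0n _ 2) mh h0 measurableT.
set P := (X in _ = X -> _) => EP.
transitivity P.
  rewrite -EP; apply: eq_integral => y _; rewrite indicT /= mulr1 /h /gauss_pdf -EFinM.
  by rewrite sum_sqrE mulNr.
rewrite /P -ge0_integralZl //; last 3 first.
- apply: measurable_funTS; apply/measurable_EFinP; apply: measurable_funM => //.
  exact: measurable_gamma_fun.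
- by move=> q _; rewrite lee_fin mulr_ge0 // mulr_ge0 ?powR_ge0 ?expR_ge0.
- rewrite lee_fin mulr_ge0 ?powR_ge0 // mulr_ge0 ?divr_ge0 // ltW //.
  exact: ball_volume_gt0.
apply: eq_integral => q _.
rewrite (_ : [set u | _] = setT) // sphere_probT mule1 -EFinM; congr EFin.
rewrite /h normal_peak1X powRM ?pi_ge0 // [2 `^ (- _)]powRN.
have : 2 `^ (n.+1%:R / 2) != 0 :> R by rewrite gt_eqF // powR_gt0.
by move=> ?; field.
Qed.

(** The volume is read off from the total mass 1 of the Gaussian law. *)
Lemma ball_volume_Gamma n :
  ball_volume R n.+1 * (n.+1%:R / 2) * Gamma (n.+1%:R / 2) = pi `^ (n.+1%:R / 2) :> R.
Proof.
have p0 : 0 < n.+1%:R / 2 :> R by rewrite divr_gt0.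
have := @gauss_radial n (cst 1) (measurable_cst _) (fun=> ler01).
rewrite (_ : (\int[mu]_(q in _) _)%E = (Gamma (n.+1%:R / 2))%:E); last first.
  by rewrite -GammaE //; apply: eq_integral => q _; rewrite mul1r.
rewrite [X in X = _](_ : _ = 1%E); last first.
  by apply: etrans (integral_cst _ measurableT 1%E) _; rewrite mul1e; exact: gauss_setT.
rewrite -EFinM powRN => -[E].
have pi0 : pi `^ (n.+1%:R / 2) != 0 :> R by rewrite gt_eqF // powR_gt0 // pi_gt0.
apply: (mulIf (invr_neq0 pi0)); rewrite divff // [RHS]E; ring.
Qed.

Lemma ge0_integral_gauss1 (g : measurableTypeR R -> \bar R) : measurable_fun setT g ->
  (forall x, 0 <= g x)%E ->
  (\int[gauss R 1]_y g ((y : 'cV[R]_1) ord0 ord0) = \int[@normal_prob R 0 1]_x g x)%E.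
Proof.
move=> mg g0.
have mG : measurable_fun setT (fun y : cVb R 1 => g ((y : 'cV[R]_1) ord0 ord0)).
  by apply: (measurableT_comp mg); exact: measurable_cV_coord.
rewrite [LHS]ge0_integral_pmeasS //; apply: eq_integral => x _.
rewrite [LHS]ge0_integral_pmeas0 //; last first.
  apply: (measurableT_comp mG).
  by apply: (measurableT_comp (@measurable_cons_cV R 0)); exact: measurable_pair1.
by rewrite cons_cV0.
Qed.

Lemma normal_second_moment : (\int[@normal_prob R 0 1]_x (x ^+ 2)%:E = 1)%E.
Proof.
have m2 : measurable_fun setT (fun x : measurableTypeR R => (x ^+ 2)%:E : \bar R).
  by apply/measurable_EFinP; exact: measurable_funX.
rewrite -ge0_integral_gauss1 //; last by move=> x; rewrite lee_fin sqr_ge0.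
pose g (q : measurableTypeR R) : R := 2 * `|q|.
have mg : measurable_fun setT g by apply: measurable_funM => //; exact: measurableT_comp.
have := @gauss_radial 0 g mg (fun q => mulr_ge0 (ler0n _ _) (normr_ge0 _)).
set c := ball_volume R 1 * _ * _.
rewrite (_ : (\int[mu]_(q in _) _)%E = (2 * Gamma (1 / 2 + 1))%:E); last first.
  rewrite EFinM -GammaE //; apply: etrans; last first.
    apply: ge0_integralZl.
    - exact: measurable_itv.
    - by apply: measurable_funTS; apply/measurable_EFinP; exact: measurable_gamma_fun.
    - by move=> q _; rewrite lee_fin mulr_ge0 ?powR_ge0 ?expR_ge0.
    - by rewrite lee_fin.
  apply: eq_integral => q; rewrite mem_setE in_itv /= andbT => q0.
  rewrite -EFinM addrK /g ger0_norm ?(ltW q0) // -(@mulr_powRB1 _ q (1/2)) ?(ltW q0) //.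
  by congr EFin; ring.
rewrite GammaS // -EFinM => E; apply: etrans (etrans E _).
  apply: eq_integral => y _; rewrite /g ger0_norm; last first.
    by rewrite divr_ge0 // sqr_ge0.
  by rewrite mulrC divfK // -sum_sqrE big_ord1.
have V := ball_volume_Gamma 0.
have pi0 : pi `^ (1 / 2) != 0 :> R by rewrite gt_eqF // powR_gt0 // pi_gt0.
rewrite /c powRN; congr EFin.
transitivity (ball_volume R 1 * (1 / 2) * Gamma (1 / 2) / pi `^ (1 / 2)); first by field.
by rewrite V divff.
Qed.

Lemma integral_powR_normal (a : R) : 0 < a ->
  (\int[mu]_(x in `]0%R, +oo[) (x `^ a * normal_pdf 0 1 x)%:E = (m_const a)%:E)%E.
Proof.
move=> a0; have peak0 : 0 <= normal_peak 1 :> R by exact: normal_peak_ge0.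
transitivity ((normal_peak 1)%:E * \int[mu]_(x in `]0%R, +oo[) (x `^ a * expR (- x ^+ 2 / 2))%:E)%E.
  rewrite -ge0_integralZl //; last 2 first.
  - apply: measurable_funTS; apply/measurable_EFinP; apply: measurable_funM.
      exact: measurable_powR.
    apply: measurableT_comp => //; apply: measurable_funM => //.
    by apply: measurableT_comp => //; exact: measurable_funX.
  - by move=> x _; rewrite lee_fin mulr_ge0 ?powR_ge0 ?expR_ge0.
  by apply: eq_integral => x _; rewrite normal_pdf01E -EFinM mulrCA.
rewrite integral_powR_gauss // -EFinM /m_const mulrA; congr (_ * _)%:E.
rewrite normal_peak1E powRM ?pi_ge0 // [RHS]mulrC mulrAC; congr (_ * _).
rewrite -powRD; last by rewrite pnatr_eq0 implybT.
by congr (_ `^ _); field.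
Qed.

Lemma m_const_gt0 (a : R) : 0 < a -> 0 < m_const a.
Proof.
move=> a0; rewrite /m_const !mulr_gt0 ?powR_gt0 ?pi_gt0 //.
by apply: Gamma_gt0; rewrite divr_gt0 // addr_gt0.
Qed.

Lemma integral_powR_gauss_scaled (b s : R) : 0 < b -> 0 < s ->
  (\int[mu]_(x in `]0%R, +oo[) (x `^ b * expR (- (s * x ^+ 2) / 2))%:E
   = (s `^ (- ((b + 1) / 2)) * (2 `^ ((b - 1) / 2) * Gamma ((b + 1) / 2)))%:E)%E.
Proof.
move=> b0 s0; pose r := Num.sqrt s.
have r0 : 0 < r by rewrite sqrtr_gt0.
have rs : s = r ^+ 2 by rewrite sqr_sqrtr // ltW.
pose g (x : measurableTypeR R) : \bar R := (\1_(`]0, +oo[%classic) x * (x `^ b * expR (- x ^+ 2 / 2)))%:E.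
have mg : measurable_fun setT g.
  apply/measurable_EFinP; apply: measurable_funM; first exact: measurable_indic.
  apply: measurable_funM; first exact: measurable_powR.
  apply: measurableT_comp => //; apply: measurable_funM => //.
  by apply: measurableT_comp => //; exact: measurable_funX.
have g0 x : (0 <= g x)%E by rewrite lee_fin mulr_ge0 // mulr_ge0 ?powR_ge0 ?expR_ge0.
have mr : measurable_fun setT (fun x : measurableTypeR R => r * x : measurableTypeR R).
  by apply: measurable_funM.
have k0 : 0 <= r^-1 by rewrite invr_ge0 ltW.
pose k : {nonneg R} := NngNum k0.
have kE A : measurable A -> mscale k mu A = mu ((fun x => r * x) @^-1` A).
  by move=> mA; rewrite /mscale /= lebesgue_measure_scale.
have := ge0_integral_image mr kE mg g0.
rewrite ge0_integral_mscale //= => E.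
have gE : (\int[mu]_x g x = (2 `^ ((b - 1) / 2) * Gamma ((b + 1) / 2))%:E)%E.
  rewrite -integral_powR_gauss // [RHS]ge0_integral_mul_indic.
  by apply: eq_integral => x _; rewrite /g EFinM muleC.
rewrite gE in E.
rewrite ge0_integral_mul_indic.
transitivity ((r `^ (- b))%:E * \int[mu]_x g (r * x)%R)%E.
  rewrite -ge0_integralZl //; last 2 first.
  - exact: (measurableT_comp mg).
  - by rewrite lee_fin powR_ge0.
  apply: eq_integral => x _.
  rewrite /g -!EFinM; congr EFin; rewrite !indicE.
  have -> : (r * x \in `]0, +oo[%classic) = (x \in `]0, +oo[%classic).
    by rewrite !mem_setE !in_itv /= !andbT pmulr_rgt0.
  case: (boolP (x \in _)); last by rewrite !mul0r !mulr0.
  rewrite mem_setE in_itv /= andbT => x0.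
  rewrite powRM ?(ltW r0) ?(ltW x0) // mulr1 mul1r exprMn -rs !mulrA -powRD; last first.
    by rewrite (gt_eqF r0) implybT.
  by rewrite addNr powRr0 mul1r.
rewrite -E -!EFinM mulrA; congr (_ * _)%:E.
rewrite -[r^-1]powR_inv1 ?(ltW r0) // -powRD; last by rewrite (gt_eqF r0) implybT.
rewrite rs -powR_mulrn ?(ltW r0) // -powRrM; congr (_ `^ _); by field.
Qed.

Lemma measurable_F_pdf (u v : R) : measurable_fun setT (F_pdf u v : measurableTypeR R -> R).
Proof.
apply: measurable_funM; last first.
  apply: (measurableT_comp (@measurable_powR R _)).
  by apply: measurable_funD => //; apply: measurable_funM.
by apply: measurable_funM => //; exact: measurable_powR.
Qed.

Lemma F_pdf_ge0 (u v q : R) : 0 < u -> 0 < v -> 0 <= F_pdf u v q.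
Proof.
move=> u0 v0; rewrite /F_pdf !mulr_ge0 ?powR_ge0 ?invr_ge0 //.
  by rewrite ltW // Gamma_gt0 // divr_gt0 // addr_gt0.
by rewrite mulr_ge0 // ltW // Gamma_gt0 // divr_gt0.
Qed.

Lemma power_measure_ge0 (m : {measure set (measurableTypeR R) -> \bar R}) n (B : set 'cV[R]_n) :
  (0 <= power_measure m B)%E.
Proof.
elim: n B => [|n IH] B /=; first by rewrite lee_fin.
by apply: integral_ge0 => x _; exact: IH.
Qed.

Lemma measurable_sphere_prob_section n (c : R) (D : set (cVb R n)) : measurable D ->
  measurable_fun setT (fun q : measurableTypeR R =>
    sphere_prob [set u : 'cV[R]_n | D (Num.sqrt (c * q) *: u)]).
Proof.
move=> mD; have [sg sgE] := sphere_measure_exists R n.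
have mDq q : measurable [set u : cVb R n | D (Num.sqrt (c * q) *: (u : 'cV[R]_n))].
  exact: measurable_preimage_cV (measurable_scale _) mD.
have v0 : ball_volume R n != 0 by rewrite gt_eqF // ball_volume_gt0.
rewrite (_ : (fun q => _) = (fun q => ((ball_volume R n)^-1)%:E *
    sg [set u | D (Num.sqrt (c * q) *: (u : 'cV[R]_n))%R])%E); last first.
  apply/funext => q; have [_ [-> _]] := sgE _ (mDq q).
  by rewrite /sphere_prob -!EFinM mulKf.
apply: emeasurable_funM => //.
have := measurable_fun_xsection sg (measurable_scaled_preimage c mD).
congr (measurable_fun _); apply/funext => q /=.
by congr (sg _); apply/seteqP; split => u; rewrite /xsection /= ?inE.
Qed.

(* Mixing over the radius of an independent chi-distributed scale turns the
   Gaussian law into a multivariate t law. *)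
Lemma gauss_scale_mixture n (a : R) (D : set (cVb R n.+1)) : 0 < a -> measurable D ->
  (\int[mu]_(x in `]0%R, +oo[) ((x `^ a * normal_pdf 0 1 x)%:E *
      gauss R n.+1 [set y : cVb R n.+1 | D (x^-1 *: (y : 'cV[R]_n.+1))%R]) =
   (m_const a)%:E * \int[mu]_(q in `]0%R, +oo[) ((F_pdf n.+1%:R (a + 1) q)%:E *
      sphere_prob [set u : 'cV[R]_n.+1 | D (Num.sqrt (n.+1%:R / (a + 1) * q) *: u)%R]))%E.
Proof.
move=> a0 mD.
have nu0 : 0 < a + 1 by rewrite addr_gt0.
(* The substitution of x y for y in the Gaussian integral contributes x ^ (n + 1), raising the
   exponent of x from a to b. *)
pose b : R := a + n.+1%:R.
have b0 : 0 < b by rewrite addr_gt0.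
pose w (x : R) : R := \1_(`]0, +oo[%classic) x * (x `^ b * normal_pdf 0 1 x).
pose f (xy : measurableTypeR R * cVb R n.+1) : \bar R :=
  (w xy.1 * (gauss_pdf (xy.1 *: (xy.2 : 'cV[R]_n.+1)) * \1_D xy.2))%:E.
have w0 x : 0 <= w x by rewrite mulr_ge0 // mulr_ge0 ?powR_ge0 ?normal_pdf_ge0.
have f0 xy : (0 <= f xy)%E by rewrite lee_fin mulr_ge0 // mulr_ge0 // gauss_pdf_ge0.
have mw : measurable_fun setT (w : measurableTypeR R -> R).
  apply: measurable_funM; first exact: measurable_indic.
  by apply: measurable_funM; [exact: measurable_powR|exact: measurable_normal_pdf].
have mf : measurable_fun setT f.
  apply/measurable_EFinP; apply: measurable_funM; first exact: (measurableT_comp mw).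
  apply: measurable_funM.
    apply: (measurableT_comp (@measurable_gauss_pdf R n.+1)).
    exact: (@measurable_scalecV R _ (measurableTypeR R * cVb R n.+1)%type n.+1 fst snd).
  by apply: (measurableT_comp _ measurable_snd); exact: measurable_indic.
transitivity (\int[mu]_x \int[leb R n.+1]_y f (x, y))%E.
  rewrite ge0_integral_mul_indic; apply: eq_integral => x _.
  rewrite indicE; case: (boolP (x \in _)) => [|h]; last first.
    rewrite mule0; apply/esym/integral0_eq => y _.
    by rewrite /f /w indicE (negbTE h) !mul0r.
  rewrite mem_setE in_itv /= andbT => x0; rewrite mule1.
  have xi0 : 0 < x^-1 by rewrite invr_gt0.
  have mDx : measurable [set y : cVb R n.+1 | D (x^-1 *: (y : 'cV[R]_n.+1))].
    exact: measurable_preimage_cV (measurable_scale _) mD.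
  pose g (y : cVb R n.+1) : \bar R := (gauss_pdf (x *: (y : 'cV[R]_n.+1)) * \1_D y)%:E.
  have mg : measurable_fun setT g.
    apply/measurable_EFinP; apply: measurable_funM; last exact: measurable_indic.
    apply: (measurableT_comp (@measurable_gauss_pdf R n.+1)); exact: measurable_scale.
  have g0 y : (0 <= g y)%E by rewrite lee_fin mulr_ge0 // gauss_pdf_ge0.
  have k0 : 0 <= x ^+ n.+1 by rewrite exprn_ge0 // ltW.
  pose k : {nonneg R} := NngNum k0.
  have kE A : measurable A -> mscale k (leb R n.+1) A = leb R n.+1 ((fun y : cVb R n.+1 => x^-1 *: (y : 'cV[R]_n.+1)) @^-1` A).
    by move=> mA; rewrite leb_scale // exprVn invrK.
  have := ge0_integral_image (measurable_scale x^-1) kE mg g0.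
  rewrite ge0_integral_mscale //= => E.
  rewrite [X in (_ * X)%E](_ : _ = ((x ^+ n.+1)%:E * \int[leb R n.+1]_y g y)%E); last first.
    rewrite E gauss_density // ge0_integral_mul_indic; apply: eq_integral => y _.
    by rewrite /g scalerA divff ?gt_eqF // scale1r EFinM.
  rewrite muleA -EFinM -ge0_integralZl //; last first.
    by rewrite lee_fin mulr_ge0 // mulr_ge0 ?powR_ge0 ?normal_pdf_ge0.
  apply: eq_integral => y _; rewrite /g /f /w -EFinM /=; congr EFin.
  have -> : \1_(`]0, +oo[%classic) x = 1 :> R by rewrite indicE mem_set //= in_itv /= x0.
  rewrite mul1r -powR_mulrn ?(ltW x0) // /b powRD; last by rewrite (gt_eqF x0) implybT.
  ring.
rewrite fubini_tonelli //.
(* Result of integrating out x: with s = 1 + |y| ^ 2, the integral of x ^ b exp (- s x ^ 2 / 2) is a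
   constant times s ^ (- (b + 1) / 2). One factor [normal_peak 1] belongs to x and n + 1 to y.
   Setting |y| ^ 2 = c q, with c the ratio of the degrees of freedom, produces the last factor of
   [F_pdf]. *)
pose K : R := normal_peak 1 ^+ n.+2 * (2 `^ ((b - 1) / 2) * Gamma ((b + 1) / 2)).
pose c : R := n.+1%:R / (a + 1).
have c0 : 0 < c by rewrite divr_gt0.
pose h (q : measurableTypeR R) : R := K * (1 + c * `|q|) `^ (- ((b + 1) / 2)).
have b10 : 0 < (b + 1) / 2 by rewrite divr_gt0 // addr_gt0.
have K0 : 0 <= K.
  rewrite mulr_ge0 ?exprn_ge0 ?normal_peak_ge0 // mulr_ge0 ?powR_ge0 //.
  by rewrite ltW // Gamma_gt0.
have h0 q : 0 <= h q by rewrite mulr_ge0 ?powR_ge0.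
have mh : measurable_fun setT h.
  apply: measurable_funM => //.
  apply: (measurableT_comp (@measurable_powR R _)).
  apply: measurable_funD => //; apply: measurable_funM => //.
transitivity (\int[leb R n.+1]_y (h (euclidean_norm (y : 'cV[R]_n.+1) ^+ 2 / c) * \1_D y)%:E)%E.
  apply: eq_integral => y _.
  pose s : R := 1 + euclidean_norm (y : 'cV[R]_n.+1) ^+ 2.
  have s0 : 0 < s by rewrite ltr_pwDl // sqr_ge0.
  have k0 : 0 <= normal_peak 1 ^+ n.+2 * \1_D y :> R.
    by rewrite mulr_ge0 // exprn_ge0 // normal_peak_ge0.
  transitivity ((normal_peak 1 ^+ n.+2 * \1_D y)%:E *
     \int[mu]_(x in `]0%R, +oo[) (x `^ b * expR (- (s * x ^+ 2) / 2))%:E)%E.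
    rewrite [X in _ = (_ * X)%E]ge0_integral_mul_indic -ge0_integralZl //; last 2 first.
    - apply: emeasurable_funM; last exact/measurable_EFinP/measurable_indic.
      apply/measurable_EFinP; apply: measurable_funM; first exact: measurable_powR.
      apply: measurableT_comp => //; apply: measurable_funM => //.
      by apply: measurableT_comp => //; apply: measurable_funM.
    - by move=> x _; rewrite mule_ge0 // lee_fin mulr_ge0 ?powR_ge0 ?expR_ge0.
    apply: eq_integral => x _; rewrite -!EFinM; congr EFin.
    rewrite /f /w /= normal_pdf01E /gauss_pdf sum_sqrE.
    have -> : euclidean_norm (x *: (y : 'cV[R]_n.+1)) ^+ 2 = x ^+ 2 * euclidean_norm (y : 'cV[R]_n.+1) ^+ 2.
      rewrite -!sum_sqrE mulr_sumr; apply: eq_bigr => i _; by rewrite mxE exprMn.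
    rewrite (_ : - (s * x ^+ 2) / 2 = - x ^+ 2 / 2 + - (x ^+ 2 * euclidean_norm (y : 'cV[R]_n.+1) ^+ 2) / 2); last first.
      by rewrite /s; field.
    rewrite expRD (exprS _ n.+1); ring.
  rewrite integral_powR_gauss_scaled // -EFinM; congr EFin.
  have -> : h (euclidean_norm (y : 'cV[R]_n.+1) ^+ 2 / c) = K * s `^ (- ((b + 1) / 2)).
    rewrite /h ger0_norm; last by rewrite divr_ge0 ?sqr_ge0 // ltW.
    by rewrite [c * _]mulrC divfK // gt_eqF.
  rewrite /K; ring.
rewrite polar_integral //.
apply: etrans; last first.
  apply: ge0_integralZl.
  - exact: measurable_itv.
  - apply: measurable_funTS; apply: emeasurable_funM.
      by apply/measurable_EFinP; exact: measurable_F_pdf.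
    exact: measurable_sphere_prob_section.
  - move=> q; rewrite /= in_itv /= andbT => q0; apply: mule_ge0.
      by rewrite lee_fin F_pdf_ge0.
    by rewrite lee_fin divr_ge0 // fine_ge0 // power_measure_ge0.
  - by rewrite lee_fin ltW // m_const_gt0.
apply: eq_integral => q; rewrite mem_setE in_itv /= andbT => q0.
rewrite [RHS]muleA -/c; congr (_ * _)%E; rewrite -EFinM; congr EFin.
rewrite /h ger0_norm ?(ltW q0) // /F_pdf -/c /K.
have -> : (n.+1%:R + (a + 1)) / 2 = (b + 1) / 2 by rewrite /b; field.
set G := Gamma ((b + 1) / 2); set X := _ `^ (- _); set p : R := n.+1%:R / 2.
have p0 : 0 < p by rewrite divr_gt0.
have Gp0 : Gamma p != 0 by rewrite gt_eqF // Gamma_gt0.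
have Ga0 : Gamma ((a + 1) / 2) != 0 by rewrite gt_eqF // Gamma_gt0 // divr_gt0.
have V : ball_volume R n.+1 * p = pi `^ p / Gamma p.
  by apply: (mulIf Gp0); rewrite divfK // ball_volume_Gamma.
(* Once the volume of the ball is written as pi ^ p / (p Gamma(p)), the comparison of constants
   comes down to this identity between powers of pi and of 2. *)
have H : pi `^ p * normal_peak 1 ^+ n.+2 * 2 `^ ((b - 1) / 2) = pi `^ (- 2^-1) * 2 `^ ((a - 2) / 2) :> R.
  rewrite normal_peak1X powRM ?pi_ge0 //.
  transitivity ((pi `^ p * pi `^ (- (n.+2%:R / 2))) * (2 `^ (- (n.+2%:R / 2)) * 2 `^ ((b - 1) / 2)) : R).
    by ring.
  rewrite -!powRD; last 2 first.
  - by rewrite pnatr_eq0 implybT.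
  - by rewrite (gt_eqF (pi_gt0 R)) implybT.
  by congr (_ `^ _ * _ `^ _); rewrite /p /b -(natr1 n.+1); field.
rewrite /m_const -H.
transitivity ((ball_volume R n.+1 * p) * c `^ p * q `^ (p - 1) * (normal_peak 1 ^+ n.+2 * (2 `^ ((b - 1) / 2) * G) * X)).
  by ring.
by rewrite V; field; rewrite Gp0 Ga0.
Qed.

End gaussian_constants.

(** * Poisson counts *)

Section product_mixture.
Context d (T : measurableType d) (R : realType) (P : probability T R).

Lemma prod_indicE (I : finType) (A : I -> set T) w :
  \prod_i \1_(A i) w = \1_(\bigcap_i A i) w :> R.
Proof.
have [h|h] := pselect (forall i, A i w).
  rewrite big1 => [|i _]; last by rewrite indicE mem_set.
  by rewrite indicE mem_set // => i _; exact: h.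
have [i hi] : exists i, ~ A i w by apply/existsNP.
rewrite (bigD1 i) //= indicE memNset // mul0r indicE memNset // => H.
exact: (hi (H i Logic.I)).
Qed.

Lemma measurable_bigcap_fin (I : finType) (A : I -> set T) :
  (forall i, measurable (A i)) -> measurable (\bigcap_i A i).
Proof. by move=> mA; apply: fin_bigcap_measurable => //; exact: finite_finset. Qed.

(** The product of sums is expanded over all assignments l of a label to each i. The hypothesis then
    says that, given the labels, the events B have the probability obtained by multiplying the p. It
    serves twice: with A the label events of the points and B the mark events, and with A sure and B
    the events fixing the counts. *)
Lemma integral_prod_mixture (I K : finType) (c p : I -> K -> R) (A B : I -> K -> set T) :
  (forall i k, 0 <= c i k) -> (forall i k, 0 <= p i k) ->
  (forall i k, measurable (A i k)) -> (forall i k, measurable (B i k)) ->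
  (forall l : I -> K, P ((\bigcap_i A i (l i)) `&` \bigcap_i B i (l i)) =
     (P (\bigcap_i A i (l i)) * (\prod_i p i (l i))%:E)%E) ->
  (\int[P]_w (\prod_i \sum_k c i k * (\1_(A i k) w * \1_(B i k) w))%:E =
   \int[P]_w (\prod_i \sum_k c i k * p i k * \1_(A i k) w)%:E)%E.
Proof.
move=> c0 p0 mA mB indep.
under [LHS]eq_integral do rewrite bigA_distr_bigA /= -sumEFin.
under [RHS]eq_integral do rewrite bigA_distr_bigA /= -sumEFin.
have mint (l : {ffun I -> K}) : measurable (\bigcap_i A i (l i) `&` \bigcap_i B i (l i)).
  by apply: measurableI; apply: measurable_bigcap_fin => i; [exact: mA|exact: mB].
have mintA (l : {ffun I -> K}) : measurable (\bigcap_i A i (l i)).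
  by apply: measurable_bigcap_fin.
have E1 (l : {ffun I -> K}) w : \prod_i (c i (l i) * (\1_(A i (l i)) w * \1_(B i (l i)) w)) =
    (\prod_i c i (l i)) * \1_(\bigcap_i A i (l i) `&` \bigcap_i B i (l i)) w :> R.
  by rewrite indicI /= -(prod_indicE (fun i => A i (l i))) -(prod_indicE (fun i => B i (l i))) -!big_split.
have E2 (l : {ffun I -> K}) w : \prod_i (c i (l i) * p i (l i) * \1_(A i (l i)) w) =
    (\prod_i (c i (l i) * p i (l i))) * \1_(\bigcap_i A i (l i)) w :> R.
  by rewrite -(prod_indicE (fun i => A i (l i))) -!big_split.
under [LHS]eq_integral do under eq_bigr do rewrite E1.
under [RHS]eq_integral do under eq_bigr do rewrite E2.
rewrite [LHS]ge0_integral_sum //; last 2 first.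
- by move=> l; apply/measurable_EFinP; apply: measurable_funM => //; exact: measurable_indic.
- by move=> l w _; rewrite lee_fin mulr_ge0 ?prodr_ge0.
rewrite [RHS]ge0_integral_sum //; last 2 first.
- by move=> l; apply/measurable_EFinP; apply: measurable_funM => //; exact: measurable_indic.
- by move=> l w _; rewrite lee_fin mulr_ge0 // prodr_ge0 // => i _; rewrite mulr_ge0.
apply: eq_bigr => l _.
under [LHS]eq_integral do rewrite EFinM.
under [RHS]eq_integral do rewrite EFinM.
rewrite [LHS]ge0_integralZl //; last 2 first.
- by apply/measurable_EFinP; exact: measurable_indic.
- by rewrite lee_fin prodr_ge0.
rewrite [RHS]ge0_integralZl //; last 2 first.
- by apply/measurable_EFinP; exact: measurable_indic.
- by rewrite lee_fin prodr_ge0 // => i _; rewrite mulr_ge0.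
have IP (X : set T) : measurable X -> (\int[P]_x (\1_X x)%:E = P X)%E.
  by move=> mX; rewrite integral_indic // setIT.
rewrite !IP // (indep l) big_split EFinM -muleA; congr (_ * _)%E.
by rewrite muleC.
Qed.

End product_mixture.

Lemma poisson_pgf (R : realType) (r p : R) : 0 <= r ->
  (fun m => \sum_(j < m) p ^+ j * fine (poisson_prob r 0 [set (j : nat)])) @ \oo -->
  expR (- (r * (1 - p))).
Proof.
move=> r0.
have E (j : nat) : p ^+ j * fine (poisson_prob r 0 [set j]) = expR (- r) * exp_coeff (p * r) j.
  (* At rate 0 [poisson_prob] is a Dirac mass, so the exponential series is compared with it
     separately. *)
  rewrite /poisson_prob; case: ifPn => [rp|]; last first.
    rewrite -leNgt => rn; have -> : r = 0 by apply/eqP; rewrite eq_le rn.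
    rewrite diracE oppr0 expR0 mul1r mulr0 /exp_coeff [RHS]/= expr0n.
    have -> : (0%N \in [set j]) = (j == 0%N) by apply/idP/eqP; rewrite inE /= => ->.
    by case: j => [|j] /=; rewrite ?mulr1 ?mulr0 ?mul0r // fact0 divr1.
  rewrite esum_set1 ?lee_fin ?poisson_pmf_ge0 // /poisson_pmf rp /exp_coeff /= exprMn.
  ring.
rewrite (_ : (fun m => _) = (fun m => expR (- r) * series (exp_coeff (p * r)) m)); last first.
  by apply/funext => m; rewrite /series /= big_mkord mulr_sumr; apply: eq_bigr => j _; exact: E.
have -> : - (r * (1 - p)) = - r + p * r by ring.
by rewrite expRD; apply: cvgM; [exact: cvg_cst|exact: is_cvg_series_exp_coeff].
Qed.

Lemma measure_bigcup_seq d (T : measurableType d) (R : realType) (m : {measure set T -> \bar R})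
    (F : (set T)^nat) : (forall j, measurable (F j)) -> trivIset setT F ->
  m (\bigcup_j F j) = (\sum_(j <oo) m (F j))%E.
Proof.
by move=> mF tF; rewrite measure_bigcup //; apply: eq_eseriesl => j; rewrite in_setT.
Qed.

Lemma measurable_preimage_RV d (T : measurableType d) (R : realType) (P : probability T R)
    (X : {RV P >-> R}) (A : set (measurableTypeR R)) :
  measurable A -> measurable [set w | A (X w)].
Proof. by move=> mA; have := measurable_funPT X measurableT _ mA; rewrite setTI. Qed.

Lemma ecvg_unique (R : realType) (u : (\bar R)^nat) (a b : \bar R) : u @ \oo --> a -> u @ \oo --> b -> a = b.
Proof. by move=> ua ub; rewrite -(cvg_lim _ ua) // (cvg_lim _ ub). Qed.

Section point_count.
Context d (T : measurableType d) (R : realType) (P : probability T R).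
Variables (V : nat -> {RV P >-> R}) (Lam : {measure set (measurableTypeR R) -> \bar R}).
Notation N := (point_count (fun i => V i : T -> R)).

Lemma point_countE A w : N A w = (\sum_(i <oo) (\1_A (V i w))%:E)%E.
Proof.
rewrite /point_count counting_dirac; apply: eq_eseriesr => i _.
by rewrite diracE indicE; congr (_%:R%:E)%E; congr nat_of_bool; apply/idP/idP; rewrite !inE.
Qed.

Lemma measurable_point_count A : measurable A -> measurable_fun setT (N A).
Proof.
move=> mA; rewrite (_ : N A = fun w => (\sum_(i <oo) (\1_A (V i w))%:E)%E); last first.
  by apply/funext => w; exact: point_countE.
apply: ge0_emeasurable_sum => [i w _ _|i _]; first by rewrite lee_fin.
apply/measurable_EFinP; exact: (measurableT_comp (@measurable_indic _ _ R setT A mA) (measurable_funPT (V i))).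
Qed.

Lemma measurable_point_count_eq A (j : \bar R) : measurable A -> measurable [set w | N A w = j].
Proof.
move=> mA; rewrite -[X in measurable X]setTI.
exact: (measurable_point_count mA measurableT (emeasurable_set1 j)).
Qed.

(** The partial counts are integers converging to j, hence eventually equal to j. This is the link
    between the enumeration of the points and the counts. *)
Lemma point_count_stationary A w (j : nat) : N A w = j%:R%:E ->
  \forall n \near \oo, (\sum_(i < n) (V i w \in A))%N = j.
Proof.
rewrite point_countE => E.
have C : (fun n => (\sum_(i < n) (V i w \in A))%N%:R : R) @ \oo --> (j%:R : R).
  have h : cvgn (fun n => \sum_(0 <= i < n) (\1_A (V i w) : R)%:E)%E.
    by apply: is_cvg_nneseries => i _ _; rewrite lee_fin.
  have {}h : (fun n => \sum_(0 <= i < n) (\1_A (V i w) : R)%:E)%E @ \oo --> (j%:R : R)%:E by rewrite -E.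
  have hE : (fun n => ((\sum_(i < n) (V i w \in A))%N%:R : R)%:E) @ \oo --> (j%:R : R)%:E.
    apply: cvg_trans h; apply: near_eq_cvg; near=> n.
    rewrite big_mkord sumEFin natr_sum; congr EFin.
  exact: (fine_cvg hE).
move/cvgrPdist_lt in C; have {}C := C 1 ltr01.
near=> n.
have : `|(j%:R : R) - (\sum_(i < n) (V i w \in A))%N%:R| < 1 by near: n.
set s := (\sum_(i < n) _)%N => h.
have : `|(j%:Z - s%:Z)%:~R : R| < 1 by rewrite rmorphB.
by rewrite -intr_norm -[1]/(1%:~R) ltr_int => {}h; lia.
Unshelve. all: by end_near.
Qed.

End point_count.

Lemma mutually_independent_seq d (T : measurableType d) (R : realType) (P : probability T R)
    (I : choiceType) (F : I -> set (set T)) (s : seq I) (E : I -> set T) :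
  mutually_independent P F -> uniq s -> (forall i, i \in s -> F i (E i)) ->
  P (\bigcap_(i in [set` s]) E i) = (\prod_(i <- s) P (E i))%E.
Proof.
move=> indep us FE.
have := indep [fset x in s]%fset E; rewrite (_ : [set` _] = [set` s]); last first.
  by apply/seteqP; split => i /=; rewrite !inE.
move=> ->; last by move=> i; rewrite !inE; exact: FE.
by apply: perm_big; apply: uniq_perm => // i; rewrite inE.
Qed.

Lemma mutually_independent_finType d (T : measurableType d) (R : realType) (P : probability T R)
    (I : finType) (F : I -> set (set T)) (E : I -> set T) :
  mutually_independent P F -> (forall i, F i (E i)) ->
  P (\bigcap_i E i) = (\prod_i P (E i))%E.
Proof.
move=> indep FE.
have := mutually_independent_seq indep (index_enum_uniq I) (fun i _ => FE i).
by rewrite (_ : [set` _] = setT) //; apply/seteqP; split => i //= _; rewrite mem_index_enum.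
Qed.

(** * Generating functions of Poisson counts *)

Section poisson_process_pgf.
Context d (T : measurableType d) (R : realType) (P : probability T R).
Variables (V : nat -> {RV P >-> R}) (Lam : {measure set (measurableTypeR R) -> \bar R}).
Hypothesis hV : poisson_process V Lam.
Notation N := (point_count (fun i => V i : T -> R)).

Lemma point_count_eq_prob (A : set (measurableTypeR R)) j : measurable A -> A `<=` `]0, +oo[ -> (Lam A < +oo)%E ->
  P [set w | N A w = j%:R%:E] = poisson_prob (fine (Lam A)) 0 [set j].
Proof. by move=> mA A0 fA; have [_ h _] := hV; have [+ _] := h A mA A0; apply. Qed.

(** Truncating at counts below m keeps all sums finite, so that independence of the counts is used
    through [integral_prod_mixture]; the limit is a product of Poisson generating functions. *)
Lemma point_count_pgf (K : nat) (A : 'I_K -> set (measurableTypeR R)) (p : 'I_K -> R) :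
  (forall k, measurable (A k)) -> (forall k, A k `<=` `]0, +oo[) ->
  (forall k, Lam (A k) < +oo)%E -> trivIset setT A -> (forall k, 0 <= p k) ->
  (fun m => \int[P]_w (\prod_k \sum_(j < m) p k ^+ j * \1_[set w | N (A k) w = j%:R%:E] w)%:E)%E @ \oo -->
  (expR (- \sum_k fine (Lam (A k)) * (1 - p k)))%:E.
Proof.
move=> mA A0 fA tA p0.
pose q (k : 'I_K) (j : nat) : R := fine (poisson_prob (fine (Lam (A k))) 0 [set j]).
have qE k (j : nat) : P [set w | N (A k) w = j%:R%:E] = (q k j)%:E.
  by rewrite point_count_eq_prob // fineK // fin_num_measure.
have q0 k j : 0 <= q k j by rewrite fine_ge0.
have [_ _ /(_ K A (fun k => conj (mA k) (A0 k)) tA) indep] := hV.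
have E m : (\int[P]_w (\prod_k \sum_(j < m) p k ^+ j * \1_[set w | N (A k) w = j%:R%:E] w)%:E =
    (\prod_k \sum_(j < m) p k ^+ j * q k j)%:E)%E.
  have := @integral_prod_mixture _ T R P 'I_K 'I_m (fun k j => p k ^+ j) (fun k j => q k j)
    (fun _ _ => setT) (fun k j => [set w | N (A k) w = j%:R%:E]).
  move=> /(_ (fun k j => exprn_ge0 _ (p0 k)) (fun k j => q0 k j) (fun _ _ => measurableT)).
  move=> /(_ (fun k j => measurable_point_count_eq V _ (mA k))) h.
  transitivity (\int[P]_w (\prod_i \sum_(k < m) p i ^+ k * q i k * \1_[set: T] w)%:E)%E.
    rewrite -h; last first.
      move=> l; have -> : \bigcap_(_ in [set: 'I_K]) [set: T] = setT by apply/seteqP; split.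
      rewrite setTI probability_setT mul1e; apply: etrans (mutually_independent_finType indep _) _.
        move=> k; exists [set (l k)%:R%:E]; first exact: emeasurable_set1.
        by rewrite setTI.
      by rewrite -prodEFin; apply: eq_bigr => k _; rewrite qE.
    by apply: eq_integral => w _; congr EFin; apply: eq_bigr => k _; apply: eq_bigr => j _;
      rewrite indicT mul1r.
  under eq_integral do under eq_bigr do under eq_bigr do rewrite indicT mulr1.
  apply: etrans (integral_cst _ measurableT _) _.
  by rewrite [X in (_ * X)%E](_ : _ = 1%E) ?mule1 //; exact: probability_setT.
under eq_fun do rewrite E.
apply/cvg_EFin; first by near=> m.
rewrite (_ : fine \o _ = fun m => \prod_k \sum_(j < m) p k ^+ j * q k j) //.
rewrite -sumrN expR_sum; apply: cvg_big; first exact: mul_continuous.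
by move=> k _; apply: poisson_pgf; rewrite fine_ge0.
Unshelve. all: by end_near.
Qed.


(** The Poisson masses of the finite counts already add up to 1. *)
Lemma point_count_fin_ae (A : set (measurableTypeR R)) : measurable A -> A `<=` `]0, +oo[%classic ->
  (Lam A < +oo)%E -> {ae P, forall w, exists j : nat, N A w = j%:R%:E}.
Proof.
move=> mA A0 fA.
have mE : measurable (\bigcup_j [set w | N A w = j%:R%:E]).
  by apply: bigcup_measurable => j _; exact: measurable_point_count_eq.
exists (~` \bigcup_j [set w | N A w = j%:R%:E]); split.
- exact: measurableC.
- rewrite probability_setC // [P _](_ : _ = 1%E) ?subee //.
  have t1 : trivIset setT (fun j : nat => [set w | N A w = j%:R%:E]).
    by move=> i j _ _ [w [/= -> /eqP]]; rewrite eqe eqr_nat => /eqP.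
  have t2 : trivIset setT (fun j : nat => [set j]) by move=> i j _ _ [w [/= <-]].
  apply: etrans (measure_bigcup_seq _ _ _) _ => //.
    by move=> j; exact: measurable_point_count_eq.
  transitivity (\sum_(j <oo) poisson_prob (fine (Lam A)) 0 [set (j : nat)])%E.
    by apply: eq_eseriesr => j _; exact: (point_count_eq_prob _ mA A0 fA).
  transitivity (poisson_prob (fine (Lam A)) 0 (\bigcup_j [set (j : nat)])).
    by apply/esym; exact: measure_bigcup_seq.
  rewrite (_ : \bigcup_j _ = setT); first exact: probability_setT.
  by apply/seteqP; split => // j _; exists j.
- by move=> w /= h [j _ hj]; apply: h; exists j.
Qed.

(** Each index i is labelled by the set [A k] containing V_i, or by [None]. Given the labels of the
    first n points, the probability that all of them pass their test is the product of the p_k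
    raised to the number of points labelled k. As n grows these numbers settle at the Poisson
    counts, and dominated convergence leads to the generating function of the counts. *)
Lemma simple_void_probability (K : nat) (A : 'I_K -> set (measurableTypeR R))
    (p : 'I_K -> R) (B : nat -> 'I_K -> set T) :
  let A' k := if k is Some k then A k else ~` \bigcup_k A k in
  let B' i k := if k is Some k then B i k else setT in
  let p' k := if k is Some k then p k else 1 in
  (forall k, measurable (A k)) -> (forall k, A k `<=` `]0, +oo[) ->
  (forall k, Lam (A k) < +oo)%E -> trivIset setT A -> (forall k, 0 <= p k <= 1) ->
  (forall i k, measurable (B i k)) ->
  (forall n (l : 'I_n -> option 'I_K),
     P ((\bigcap_(i : 'I_n) [set w | A' (l i) (V i w)]) `&` \bigcap_(i : 'I_n) B' i (l i)) =
     (P (\bigcap_(i : 'I_n) [set w | A' (l i) (V i w)]) * (\prod_i p' (l i))%:E)%E) ->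
  P (\bigcap_i [set w | forall k, A k (V i w) -> B i k w]) =
  (expR (- \sum_k fine (Lam (A k)) * (1 - p k)))%:E.
Proof.
move=> A' B' p' mA A0 fA tA p01 mB indep.
have p0 k : 0 <= p k by case/andP: (p01 k).
have mA' k : measurable (A' k).
  case: k => [k|] /=; first exact: mA.
  by apply: measurableC; apply: fin_bigcup_measurable => //; exact: finite_finset.
have mB' i k : measurable (B' i k) by case: k => [k|] /=; [exact: mB|exact: measurableT].
have mVA i k : measurable [set w | A' k (V i w)].
  exact: measurable_preimage_RV (mA' k).
have labex i w : exists k, A' k (V i w).
  have [[k _ hk]|h] := pselect ((\bigcup_k A k) (V i w)); first by exists (Some k).
  by exists None.
have labun i w k1 k2 : A' k1 (V i w) -> A' k2 (V i w) -> k1 = k2.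
  case: k1 => [k1|]; case: k2 => [k2|] //= h1 h2.
  - by congr Some; apply: (tA k1 k2) => //; exists (V i w).
  - by exfalso; apply: h2; exists k1.
  - by exfalso; apply: h1; exists k2.
have sumlab (f : option 'I_K -> R) i w k : A' k (V i w) -> \sum_k f k * \1_[set w | A' k (V i w)] w = f k.
  move=> hk; rewrite (bigD1 k) //= indicE mem_set // mulr1 big1 ?addr0 // => k2 nk.
  rewrite indicE memNset ?mulr0 //= => h2.
  by move: nk; rewrite (labun _ _ _ _ h2 hk) eqxx.
pose C i := [set w | forall k, A k (V i w) -> B i k w].
(* The conditional probability, given the labels, that the first n points pass. *)
pose G n w : R := \prod_(i < n) \sum_k 1 * p' k * \1_[set w | A' k (V i w)] w.
have mC i : measurable (C i).
  rewrite (_ : C i = \bigcap_k ((~` ([set w | A k (V i w)])) `|` B i k)).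
    apply: measurable_bigcap_fin => k; apply: measurableU => //.
    exact: measurableC (mVA i (Some k)).
  apply/seteqP; split => w h k; last by case: (h k Logic.I).
  by move=> _; have [/h|] := pselect (A k (V i w)); [right|left].
have PE n : P (\bigcap_(i < n) C i) = (\int[P]_w (G n w)%:E)%E.
  transitivity (\int[P]_w (\prod_(i < n) \sum_k 1 * (\1_[set w | A' k (V i w)] w * \1_(B' i k) w))%:E)%E.
    rewrite (_ : \bigcap_(i < n) C i = \bigcap_(i in [set: 'I_n]) C i); last first.
      apply/seteqP; split => w h i; first by move=> _; exact: (h _ (ltn_ord i)).
      by move=> /= ni; exact: (h (Ordinal ni)).
    transitivity (\int[P]_w (\1_(\bigcap_(i in [set: 'I_n]) C i) w)%:E)%E.
      by rewrite integral_indic ?setIT //; exact: measurable_bigcap_fin.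
    apply: eq_integral => w _; rewrite -prod_indicE; congr EFin.
    apply: eq_bigr => i _; have [k hk] := labex i w.
    under eq_bigr do rewrite mul1r mulrC.
    rewrite (sumlab (fun k => \1_(B' i k) w) _ _ _ hk) !indicE; congr (nat_of_bool _)%:R.
    apply/idP/idP; rewrite !inE.
      by case: k hk => //= k hk h; exact: h.
    move=> hB k2 h2; have := labun _ _ _ (Some k2) hk h2 => E; by rewrite E in hB.
  apply: integral_prod_mixture => //.
  - by move=> i [k|] /=.
  - exact: indep.
have GE n w : G n w = \prod_k p k ^+ (\sum_(i < n) (V i w \in A k)).
  transitivity (\prod_(i < n) \prod_k p k ^+ (V i w \in A k)); last first.
    by rewrite exchange_big /=; apply: eq_bigr => k _; rewrite prodrXr.
  apply: eq_bigr => i _; have [k hk] := labex i w.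
  rewrite (sumlab (fun k => 1 * p' k) _ _ _ hk) mul1r.
  case: k hk => [k|] hk /=.
    rewrite (bigD1 k) //= mem_set // expr1 big1 ?mulr1 // => k2 nk.
    rewrite memNset // => h2; move: nk.
    by have [->] := labun _ _ (Some k) (Some k2) hk h2; rewrite eqxx.
  by rewrite big1 // => k2 _; rewrite memNset // => h2; apply: hk; exists k2.
(* The product of the p_k ^ N(A_k), truncated to counts below m. It is nondecreasing in m; defining
   [L] as its limit avoids a power with a possibly infinite exponent, and where all counts are
   finite [L] is the expected product. *)
pose F m w : R := \prod_k \sum_(j < m) p k ^+ j * \1_[set w | N (A k) w = j%:R%:E] w.
pose L w : \bar R := limn (fun m => (F m w)%:E).
have F0 m w : 0 <= F m w.
  by rewrite prodr_ge0 // => k _; rewrite sumr_ge0 // => j _; rewrite mulr_ge0 ?exprn_ge0.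
have mF m : measurable_fun setT (fun w => (F m w)%:E).
  apply/measurable_EFinP; apply: measurable_prod => k _; apply: measurable_sum => j.
  apply: measurable_funM => //; apply: measurable_indic.
  exact: (measurable_point_count_eq V _ (mA k)).
have ndF w : {homo (fun m => (F m w)%:E) : n m / (n <= m)%N >-> (n <= m)%E}.
  move=> n m nm; rewrite lee_fin; apply: ler_prod => k _; apply/andP; split.
    by rewrite sumr_ge0 // => j _; rewrite mulr_ge0 ?exprn_ge0.
  rewrite -!(big_mkord xpredT (fun j => p k ^+ j * \1_[set w | N (A k) w = j%:R%:E] w)).
  rewrite (big_cat_nat (leq0n n) nm) //= lerDl sumr_ge0 // => j _.
  by rewrite mulr_ge0 ?exprn_ge0.
have cF w : (fun m => (F m w)%:E) @ \oo --> L w.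
  exact: ereal_nondecreasing_is_cvgn (ndF w).
have mL : measurable_fun setT L.
  by apply: (emeasurable_fun_cvg (fun m w => (F m w)%:E)).
have EF := point_count_pgf mA A0 fA tA p0.
have EL : (\int[P]_w L w = (expR (- \sum_k fine (Lam (A k)) * (1 - p k)))%:E)%E.
  have CF := @cvg_monotone_convergence _ _ _ P _ measurableT _ mF (fun m w _ => F0 m w) (fun w _ => ndF w).
  exact: ecvg_unique CF EF.
have mG n : measurable_fun setT (fun w => (G n w)%:E).
  apply/measurable_EFinP; apply: measurable_prod => i _; apply: measurable_sum => k.
  by apply: measurable_funM => //; exact: measurable_indic.
have aeG : {ae P, forall w, setT w -> (fun n => (G n w)%:E) @ \oo --> L w}.
  have : {ae P, forall w, forall k, exists j : nat, N (A k) w = j%:R%:E}.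
    suff : {ae P, forall w, forall m : nat, forall km : (m < K)%N, exists j : nat, N (A (Ordinal km)) w = j%:R%:E}.
      by apply: filterS => w h k; have := h k (ltn_ord k); rewrite (_ : Ordinal _ = k) //; exact: val_inj.
    apply: ae_foralln => m; have [km|km] := pselect (is_true (m < K)%N); last by apply: aeW => w h.
    have := point_count_fin_ae (mA (Ordinal km)) (@A0 (Ordinal km)) (fA (Ordinal km)).
    by apply: filterS => w h km'; rewrite (bool_irrelevance km' km).
  apply: filterS => w h _.
  have [j jE] : exists j : 'I_K -> nat, forall k, N (A k) w = (j k)%:R%:E.
    by have [j jE] := choice h; exists j.
  have LE : L w = (\prod_k p k ^+ j k)%:E.
    apply/cvg_lim => //; apply: cvg_near_cst.
    exists (\max_k j k).+1 => // m /= mj.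
    congr EFin; apply: eq_bigr => k _.
    have jm : (j k < m)%N by apply: leq_ltn_trans mj; exact: leq_bigmax.
    rewrite (bigD1 (Ordinal jm)) //= indicE mem_set // mulr1 big1 ?addr0 // => i ni.
    rewrite indicE memNset ?mulr0 //= jE => -[/eqP]; rewrite eqr_nat => /eqP E.
    by move: ni; rewrite -(inj_eq val_inj) /= E eqxx.
  rewrite LE; apply: cvg_near_cst.
  have : \forall n \near \oo, forall k, (\sum_(i < n) (V i w \in A k))%N = j k.
    apply: filter_forall => k; exact: point_count_stationary.
  by apply: filterS => n hn; rewrite GE; congr EFin; apply: eq_bigr => k _; rewrite hn.
have G01 n w : 0 <= G n w <= 1.
  rewrite GE prodr_ge0 //=; last by move=> k _; rewrite exprn_ge0.
  by apply: prodr_ile1 => k _; rewrite exprn_ge0 //= exprn_ile1 //; case/andP: (p01 k).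
have int1 : P.-integrable setT (cst 1%E : T -> \bar R) by exact: finite_measure_integrable_cst.
have G1 : {ae P, forall w n, setT w -> (`|(G n w)%:E| <= cst 1%E w)%E}.
  by apply: aeW => w n _; rewrite lee_fin ger0_norm; case/andP: (G01 n w).
have [_ _ CG] := dominated_convergence measurableT mG mL aeG int1 G1.
have CP : (fun n => P (\bigcap_(i < n) C i)) @ \oo --> P (\bigcap_n \bigcap_(i < n) C i).
  apply: nonincreasing_cvg_mu.
  - by apply: (le_lt_trans (probability_le1 _ _)); rewrite ?ltry //; exact: bigcap_measurableType.
  - by move=> n; exact: bigcap_measurableType.
  - by apply: bigcap_measurableType => n _; exact: bigcap_measurableType.
  - move=> n m nm; rewrite subsetEset => w h i /= ni; apply: h; exact: leq_trans nm.
transitivity (P (\bigcap_n \bigcap_(i < n) C i)).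
  congr (P _); apply/seteqP; split => w h i; first by move=> _ j _; exact: h.
  by move=> _; exact: (h i.+1 Logic.I i (ltnSn i)).
rewrite -EL; apply: ecvg_unique CP _.
by under eq_fun do rewrite PE.
Qed.

End poisson_process_pgf.

(** * Void probabilities of marked Poisson processes *)

Import HBNNSimple.

Section void_probability.
Context d (T : measurableType d) (R : realType) (P : probability T R).
Variables (V : nat -> {RV P >-> R}) (Lam : {measure set (measurableTypeR R) -> \bar R}).
Hypothesis hV : poisson_process V Lam.
Hypothesis Lam_tail : forall t : R, 0 < t -> (Lam `]t, +oo[%classic < +oo)%E.
Variable M : nat -> T -> R.
Hypotheses (mM : forall i, measurable_fun setT (M i : T -> measurableTypeR R))
  (M0 : forall i w, 0 <= M i w).
Hypothesis indepVM : forall n (A : 'I_n -> set (measurableTypeR R)) (c : 'I_n -> R),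
  (forall i, measurable (A i)) ->
  P ((\bigcap_(i : 'I_n) [set w | A i (V i w)]) `&` \bigcap_(i : 'I_n) [set w | c i * M i w <= 1]) =
  (P (\bigcap_(i : 'I_n) [set w | A i (V i w)]) * (\prod_i fine (P [set w | c i * M 0 w <= 1]%R))%:E)%E.

Let tail (c : R) : \bar R := P [set w | 1 < c * M 0 w].

Let mle i c : measurable [set w | c * M i w <= 1].
Proof.
rewrite -[X in measurable X]setTI.
have m : measurable_fun setT (fun w => c * M i w : measurableTypeR R) by apply: measurable_funM => //; exact: mM.
have := m measurableT _ (measurable_itv `]-oo, (1 : R)]).
by congr (measurable (_ `&` _)); apply/seteqP; split => w; rewrite /= in_itv.
Qed.

Let mgt i c : measurable [set w | 1 < c * M i w].
Proof.
rewrite (_ : [set w | _] = ~` [set w | c * M i w <= 1]); first exact: measurableC (mle i c).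
by apply/seteqP; split => w /=; rewrite ltNge => /negP.
Qed.

Let tail_le c : fine (P [set w | c * M 0 w <= 1]) = 1 - fine (tail c).
Proof.
rewrite /tail (_ : [set w | 1 < _] = ~` [set w | c * M 0 w <= 1]); last first.
  by apply/seteqP; split => w /=; rewrite ltNge => /negP.
have mc := mle 0 c; have fc : P [set w | c * M 0 w <= 1] \is a fin_num by exact: fin_num_measure.
have -> : P (~` [set w | c * M 0 w <= 1]) = (1 - P [set w | c * M 0 w <= 1]%R)%E by exact: probability_setC.
by rewrite fineB //= opprB addrCA subrr addr0.
Qed.

Let tail01 c : 0 <= fine (tail c) <= 1.
Proof.
have mc := mgt 0 c.
rewrite fine_ge0 //= -lee_fin fineK; first exact: probability_le1.
exact: fin_num_measure.
Qed.

(** The cut-off at t gives every level set of psi a finite intensity, as required to use the law of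
    the counts; the finitely many values of [f] serve as labels. Measurability and finiteness are
    stated along with the formula because the monotone limit below consumes them. *)
Lemma simple_threshold_void_probability (f : {nnsfun (measurableTypeR R) >-> R}) (t : R) : 0 < t ->
  let psi v := f v * \1_(`]t, +oo[%classic) v in
  [/\ P (\bigcap_i [set w | psi (V i w) * M i w <= 1]) =
     (expR (- fine (\int[Lam]_(v in `]0%R, +oo[) tail (psi v))))%:E,
    measurable_fun (`]0%R, +oo[%classic : set (measurableTypeR R)) (fun v => tail (psi v))
  & (\int[Lam]_(v in `]0%R, +oo[) tail (psi v) < +oo)%E].
Proof.
move=> t0 psi.
have finr : finite_set (range f) by exact: fimfunP.
pose s : seq R := fset_set (range f).
pose c (k : 'I_(size s)) : R := s`_k.
pose A (k : 'I_(size s)) : set (measurableTypeR R) := (f @^-1` [set c k]) `&` `]t, +oo[%classic.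
have mA k : measurable (A k) by apply: measurableI => //; exact: measurable_sfunP.
have A0 k : A k `<=` `]0, +oo[%classic.
  by move=> v [_ /=]; rewrite !in_itv /= !andbT; exact: lt_trans.
have fA k : (Lam (A k) < +oo)%E.
  by apply: le_lt_trans (Lam_tail t0); apply: le_measure; rewrite ?inE //; move=> v [].
have us : uniq s by exact: fset_uniq.
have tA : trivIset setT A.
  move=> i j _ _ [v [[/= h1 _] [/= h2 _]]]; apply: val_inj.
  by apply/eqP; rewrite -(nth_uniq 0 (ltn_ord i) (ltn_ord j) us) -/(c i) -h1 h2.
have exk v : exists k, f v = c k.
  have fs : f v \in s by rewrite /s in_fset_set // inE; exists v.
  have ks : (index (f v) s < size s)%N by rewrite index_mem.
  by exists (Ordinal ks); rewrite /c /= nth_index.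
have psiE k v : A k v -> psi v = c k.
  by move=> [/= fv tv]; rewrite /psi indicE mem_set // mulr1.
have psi_out v : ~ (exists k, A k v) -> psi v = 0.
  move=> h; rewrite /psi indicE memNset ?mulr0 // => tv.
  by have [k hk] := exk v; apply: h; exists k.
have tail0 : tail 0 = 0%E.
  by rewrite /tail (_ : [set w | _] = set0) ?measure0 //; apply/seteqP; split => w //=; rewrite mul0r ltr10.
have tailE v : tail (psi v) = (\sum_k fine (tail (c k)) * \1_(A k) v)%:E.
  have [[k hk]|h] := pselect (exists k, A k v).
    rewrite (bigD1 k) //= indicE mem_set // mulr1 big1 ?addr0 => [|j jk].
      by rewrite fineK ?fin_num_measure // (psiE _ _ hk).
    rewrite indicE memNset ?mulr0 // => hj.
    by move: jk; rewrite (tA j k) ?eqxx //; exists v.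
  rewrite psi_out // tail0 big1 // => k _.
  by rewrite indicE memNset ?mulr0 // => hk; apply: h; exists k.
have t_ge0 k : 0 <= fine (tail (c k)) by case/andP: (tail01 (c k)).
have intE : (\int[Lam]_(v in `]0%R, +oo[) tail (psi v) = (\sum_k fine (Lam (A k)) * (1 - (1 - fine (tail (c k)))))%:E)%E.
  under eq_integral do rewrite tailE -sumEFin.
  rewrite ge0_integral_sum //; last 2 first.
  - by move=> k; apply/measurable_EFinP; apply: measurable_funM => //; exact: measurable_indic.
  - by move=> k v _; rewrite lee_fin mulr_ge0.
  rewrite -sumEFin; apply: eq_bigr => k _.
  under eq_integral do rewrite EFinM.
  rewrite ge0_integralZl //; last 2 first.
  - by apply/measurable_EFinP; exact: measurable_indic.
  - by rewrite lee_fin.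
  rewrite integral_indic // opprB addrCA subrr addr0 mulrC EFinM; congr (_ * _)%E.
  rewrite fineK; last by rewrite ge0_fin_numE.
  by congr (Lam _); apply/setIidl.
split; last by rewrite intE ltry.
  rewrite intE /=.
  pose p k := 1 - fine (tail (c k)).
  have := @simple_void_probability _ T R P V Lam hV (size s) A p (fun i k => [set w | c k * M i w <= 1]).
  move=> /(_ mA A0 fA tA) h; rewrite -h //; last 2 first.
  - move=> k; rewrite /p; have := tail01 (c k); lra.
  (* Points outside all level sets get the factor 0, which turns their test into the sure event 0 <=
     1. *)
  - move=> n l; pose c' k := if k is Some k then c k else 0.
    have := @indepVM n (fun i => if l i is Some k then A k else ~` \bigcup_k A k) (fun i => c' (l i)).
    have mA' i : measurable (if l i is Some k then A k else ~` \bigcup_k A k).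
      case: (l i) => [k|] //; apply: measurableC.
      by apply: fin_bigcup_measurable => //; exact: finite_finset.
    move=> /(_ mA').
    rewrite (_ : \bigcap_i [set w | c' (l i) * M i w <= 1] =
       \bigcap_i (if l i is Some k then [set w | c k * M i w <= 1] else setT)); last first.
      apply: eq_bigcapr => i _; rewrite /c'; case: (l i) => [k|] //.
      by apply/seteqP; split => w //= _; rewrite mul0r ler01.
    move=> ->; congr (_ * (_)%:E)%E; apply: eq_bigr => i _; rewrite tail_le /c'.
    by case: (l i) => [k|] //; rewrite tail0 subr0.
  congr (P _); apply: eq_bigcapr => i _; apply/seteqP; split => w /=.
    by move=> hw k hk; rewrite -(psiE _ _ hk).
  move=> hw; have [[k hk]|hn] := pselect (exists k, A k (V i w)).
    by rewrite (psiE _ _ hk); exact: hw.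
  by rewrite (psi_out _ hn) mul0r ler01.
rewrite (_ : (fun v => _) = (fun v => (\sum_k fine (tail (c k)) * \1_(A k) v)%:E)); last exact/funext.
apply/measurable_EFinP; by apply: measurable_sum => k; apply: measurable_funM.
Qed.

(** The simple approximations of psi, cut off at 1 / (n + 1), increase to psi on the half-line: the
    events of survival decrease, the exponents increase, and finiteness of the limiting exponent
    lets the exponential pass to the limit. *)
Lemma void_probability (psi : measurableTypeR R -> R) :
  measurable_fun setT psi -> (forall v, 0 <= psi v) ->
  (\int[Lam]_(v in `]0%R, +oo[) P [set w | 1 < psi v * M 0 w]%R < +oo)%E ->
  P (\bigcap_i [set w | psi (V i w) * M i w <= 1]) =
  (expR (- fine (\int[Lam]_(v in `]0%R, +oo[) P [set w | 1 < psi v * M 0 w]%R)))%:E.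
Proof.
move=> mpsi psi0 fin.
have mE : measurable_fun setT (EFin \o psi) by exact/measurable_EFinP.
pose f n := nnsfun_approx measurableT mE n.
pose r n : R := n.+1%:R^-1.
have r0 n : 0 < r n by rewrite invr_gt0.
pose g n v : R := f n v * \1_(`]r n, +oo[%classic) v.
have H n := simple_threshold_void_probability (f n) (r0 n).
have fnd v : {homo (fun n => f n v) : n m / (n <= m)%N >-> n <= m}.
  by move=> n m nm; have /lefP := nd_nnsfun_approx measurableT mE nm; apply.
have gnd v : {homo (g ^~ v) : n m / (n <= m)%N >-> n <= m}.
  move=> n m nm; rewrite /g ler_pM //; first exact: fnd.
  rewrite !indicE ler_nat; case: (boolP (v \in `]r n, +oo[%classic)) => //.
  rewrite mem_setE in_itv /= andbT => rv; rewrite mem_set //= in_itv /= andbT.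
  by apply: le_lt_trans rv; rewrite lef_pV2 ?posrE // ler_nat.
have gcvg v : 0 < v -> g ^~ v @ \oo --> psi v.
  move=> v0; have := cvg_nnsfun_approx measurableT mE (fun x _ => psi0 x) (x := v) Logic.I.
  move=> /fine_cvg /= C; apply: cvg_trans C; apply: near_eq_cvg.
  have := near_infty_natSinv_lt (PosNum v0); apply: filterS => n /= nv.
  by rewrite /g indicE mem_set ?mulr1 //= in_itv /= andbT.
have gle v n : 0 < v -> g n v <= psi v.
  move=> v0; have C := gcvg v v0; rewrite -(cvg_lim _ C) //.
  by apply: nondecreasing_cvgn_le; [exact: gnd|apply/cvg_ex; eexists; exact: C].
have Vpos i w : 0 < V i w by have [] := hV.
pose E n := \bigcap_i [set w | g n (V i w) * M i w <= 1].
have mVE n : measurable (E n).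
  apply: bigcap_measurableType => i _.
  have m : measurable_fun setT (fun w => g n (V i w) * M i w : measurableTypeR R).
    apply: measurable_funM; last exact: mM.
    have mg : measurable_fun setT (g n : measurableTypeR R -> measurableTypeR R).
      apply: measurable_funM; last exact: measurable_indic.
      exact: measurable_funPT (f n).
    exact: (measurableT_comp mg (measurable_funPT (V i))).
  exact: (measurable_sublevel _ (m)).
have EE : \bigcap_n E n = \bigcap_i [set w | psi (V i w) * M i w <= 1].
  apply/seteqP; split => w h i _ /=.
    have C : (fun n => g n (V i w) * M i w) @ \oo --> psi (V i w) * M i w.
      by apply: cvgM; [exact: gcvg|exact: cvg_cst].
    apply: (cvgr_to_le C); near=> n; exact: (h n Logic.I i Logic.I).
  move=> j _ /=; apply: le_trans (h j Logic.I); rewrite ler_wpM2r //; exact: gle.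
have CL : (fun n => P (E n)) @ \oo --> P (\bigcap_i [set w | psi (V i w) * M i w <= 1]).
  rewrite -EE; apply: nonincreasing_cvg_mu => //.
  - by apply: (le_lt_trans (probability_le1 _ _)); rewrite ?ltry.
  - exact: bigcap_measurableType.
  - move=> n m nm; rewrite subsetEset => w h i _ /=; apply: le_trans (h i Logic.I).
    by rewrite ler_wpM2r //; exact: gnd.
have tmono a b : a <= b -> (tail a <= tail b)%E.
  move=> ab; apply: le_measure; rewrite ?inE //; move=> w /= h; apply: lt_le_trans h _.
  by rewrite ler_wpM2r.
have CI := @cvg_monotone_convergence _ _ _ Lam _ (measurable_itv `]0, +oo[)
  (fun n v => tail (g n v)) (fun n => let: And3 _ m _ := H n in m)
  (fun n v _ => measure_ge0 _ _) (fun v _ n m nm => tmono _ _ (gnd v _ _ nm)).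
have IE : (\int[Lam]_(v in `]0%R, +oo[) limn (fun n => tail (g n v)) = \int[Lam]_(v in `]0%R, +oo[) tail (psi v))%E.
  apply: eq_integral => v; rewrite mem_setE in_itv /= andbT => v0.
  apply/cvg_lim => //.
  (* The strict inequality matters: if the limit of g_n(v) M exceeds 1, then so does some term, and
     the events increase to the limiting one. *)
  have -> : tail (psi v) = P (\bigcup_n [set w | 1 < g n v * M 0 w]).
    congr (P _); apply/seteqP; split => w /=; last first.
      by move=> [n _ h]; apply: lt_le_trans h _; rewrite ler_wpM2r //; exact: gle.
    move=> h; apply: contrapT => hn.
    have : psi v * M 0 w <= 1; last by rewrite leNgt h.
    have C : (fun n => g n v * M 0 w) @ \oo --> psi v * M 0 w by apply: cvgM; [exact: gcvg|exact: cvg_cst].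
    apply: (cvgr_to_le C); near=> n; rewrite leNgt; apply/negP => hh; apply: hn; by exists n.
  apply: nondecreasing_cvg_mu => //; first exact: bigcup_measurable.
  move=> n m nm; rewrite subsetEset => w /= h; apply: lt_le_trans h _.
  by rewrite ler_wpM2r //; exact: gnd.
rewrite IE in CI.
apply: ecvg_unique CL _.
have C2 := fine_cvg _.
rewrite (_ : (fun n => P (E n)) = (fun n => (expR (- fine (\int[Lam]_(v in `]0%R, +oo[) tail (g n v))))%:E)%E); last first.
  by apply/funext => n; have [-> _ _] := H n.
apply/cvg_EFin; first by near=> n.
rewrite (_ : _ \o _ = fun n => expR (- fine (\int[Lam]_(v in `]0%R, +oo[) tail (g n v))%E)) //.
apply: continuous_cvg; first exact: continuous_expR.
apply: cvgN; apply: fine_cvg; rewrite fineK //.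
by rewrite ge0_fin_numE //; apply: integral_ge0.
Unshelve. all: by end_near.
Qed.

End void_probability.

(** * Gaussian vectors *)

Section gaussian_law.
Variable R : realType.
Notation N01 := (@normal_prob R 0 1).

Lemma inj_row_free n k (B : 'M[R]_(n, k)) : (forall v : 'rV[R]_n, v *m B = 0 -> v = 0) -> row_free B.
Proof.
move=> injB; rewrite -kermx_eq0; apply/eqP/row_matrixP => i; rewrite row0; apply: injB.
by rewrite -row_mul mulmx_ker row0.
Qed.

Lemma gram_eq0 k (v : 'rV[R]_k) : v *m v^T = 0 -> v = 0.
Proof.
move/matrixP => /(_ 0 0); rewrite !mxE => E; apply/rowP => i; rewrite mxE.
have {}E : \sum_i v 0 i ^+ 2 = 0.
  by rewrite -[RHS]E; apply: eq_bigr => l _; rewrite mxE expr2.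
apply/eqP; rewrite -sqrf_eq0; apply/eqP.
exact: (psumr_eq0P (fun i _ => sqr_ge0 (v 0 i)) E).
Qed.

(** After division by its length, [b] is a single orthonormal row, to which [gauss_row_orthonormal]
    applies. A zero row makes both integrands constant. *)
Lemma ge0_integral_gauss_row k (b : 'rV[R]_k) (g : measurableTypeR R -> \bar R) :
  measurable_fun setT g -> (forall x, 0 <= g x)%E ->
  (\int[gauss R k]_y g ((b *m (y : 'cV[R]_k)) 0 0)%R =
   \int[N01]_x g (Num.sqrt ((b *m b^T) 0 0) * x)%R)%E.
Proof.
move=> mg g0.
have bbE : (b *m b^T) 0 0 = \sum_i b 0 i ^+ 2.
  by rewrite mxE; apply: eq_bigr => i _; rewrite mxE expr2.
have bb0 : 0 <= (b *m b^T) 0 0 by rewrite bbE sumr_ge0 // => i _; exact: sqr_ge0.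
have [s sE] : exists s, s = Num.sqrt ((b *m b^T) 0 0) by eexists.
rewrite -sE; have s0 : 0 <= s by rewrite sE sqrtr_ge0.
have s2 : s ^+ 2 = (b *m b^T) 0 0 by rewrite sE sqr_sqrtr.
have [sz|sp] := eqVneq s 0.
  have b0 : b = 0.
    by apply: gram_eq0; apply/matrixP => i j; rewrite !ord1 -s2 sz expr0n mxE.
  transitivity (\int[gauss R k]_y (cst (g 0%R) y))%E.
    by apply: eq_integral => y _; rewrite b0 mul0mx mxE.
  rewrite integral_cst // [X in (_ * X)%E](gauss_setT R k) mule1.
  transitivity (\int[N01]_x (cst (g 0%R) x))%E.
    by rewrite integral_cst // [X in (_ * X)%E](_ : _ = 1%E) ?mule1 //; exact: probability_setT.
  by apply: eq_integral => x _; rewrite sz mul0r.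
pose q := s^-1 *: b.
have qq : q *m q^T = 1%:M.
  apply/matrixP => i j; rewrite !ord1 /q linearZ /= -scalemxAl -scalemxAr !mxE eqxx.
  rewrite (_ : \sum_j0 _ = s ^+ 2); last by rewrite s2 mxE.
  by transitivity (1 : R) => //; field.
pose G (z : cVb R 1) := g (s * (z : 'cV[R]_1) 0 0).
have mG : measurable_fun setT G.
  apply: (measurableT_comp mg); apply: measurable_funM => //; exact: measurable_cV_coord.
have G0 z : (0 <= G z)%E by exact: g0.
have nuE A : measurable A -> gauss R 1 A = gauss R k ((fun y : cVb R k => q *m (y : 'cV[R]_k) : cVb R 1) @^-1` A).
  by move=> mA; rewrite gauss_row_orthonormal.
have E := ge0_integral_image (measurable_mulmx q) nuE mG G0.
transitivity (\int[gauss R 1]_z G z)%E.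
  rewrite E; apply: eq_integral => y _; rewrite /G; congr g.
  by rewrite /q -scalemxAl [in RHS]mxE mulrA divff // mul1r.
apply: (@ge0_integral_gauss1 R (fun x => g (s * x))) => //.
by apply: (measurableT_comp mg); apply: measurable_funM.
Qed.

Lemma ge0_integral_normal_opp (g : measurableTypeR R -> \bar R) :
  measurable_fun setT g -> (forall x, 0 <= g x)%E ->
  (\int[N01]_x g (- x)%R = \int[N01]_x g x)%E.
Proof.
move=> mg g0.
have mgo : measurable_fun setT (fun x : measurableTypeR R => g (- x)).
  by apply: (measurableT_comp mg); exact: oppr_measurable.
rewrite -[LHS]ge0_integral_gauss1 //.
have := @ge0_integral_gauss_row 1 (- 1%:M) g mg g0.
rewrite linearN /= trmx1 mulmxN mulNmx opprK mulmx1 mxE eqxx sqrtr1.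
move=> E; apply: etrans; last (apply: etrans E _).
  by apply: eq_integral => y _; rewrite mulNmx mul1mx mxE.
by apply: eq_integral => x _; rewrite mul1r.
Qed.

Lemma normal_integrable_id : N01.-integrable setT (fun x : measurableTypeR R => x%:E).
Proof.
have m2 : measurable_fun setT (fun x : measurableTypeR R => (x ^+ 2)%:E : \bar R).
  by apply/measurable_EFinP; exact: measurable_funX.
apply: (@le_integrable _ _ _ N01 setT measurableT _ (fun x => 1 + (x ^+ 2)%:E)%E) => //.
- exact/measurable_EFinP.
- move=> x _; rewrite -[(1 + _)%E]/((1 + x ^+ 2)%:E) /= lee_fin [X in _ <= X]ger0_norm; last first.
    by rewrite addr_ge0 // sqr_ge0.
  have : 0 <= (`|x| - 1) ^+ 2 :> R by exact: sqr_ge0.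
  have : 0 <= `|x| ^+ 2 :> R by exact: sqr_ge0.
  rewrite -[x ^+ 2]real_normK ?num_real //; nra.
- apply: integrableD => //.
    by have := finite_measure_integrable_cst N01 1 measurableT.
  apply/integrableP; split => //.
  rewrite (_ : (\int[_]_(_ in _) _)%E = 1%E) ?ltry // -normal_second_moment.
  by apply: eq_integral => x _; rewrite gee0_abs // lee_fin sqr_ge0.
Qed.

Lemma normal_mean (m s : R) : (\int[N01]_x (m + s * x)%:E = m%:E)%E.
Proof.
have H : (\int[N01]_x x%:E = 0)%E.
  rewrite integralE.
  have mid : measurable_fun setT (fun x : measurableTypeR R => x%:E : \bar R) by exact/measurable_EFinP.
  have E := @ge0_integral_normal_opp (fun x => (fun x : measurableTypeR R => x%:E)^\+ x)%E (measurable_funepos mid) (fun x => funepos_ge0 _ x).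
  rewrite -E (_ : (\int[N01]_x _)%E = (\int[N01]_x (fun x : measurableTypeR R => x%:E)^\- x)%E); last first.
    by apply: eq_integral => x _; rewrite funeposE funenegE EFinN.
  rewrite subee //; have := integrable_neg_fin_num measurableT normal_integrable_id; exact.
have iz : N01.-integrable setT (fun x : measurableTypeR R => s%:E * x%:E)%E.
  exact: integrableZl normal_integrable_id.
have im : N01.-integrable setT (cst m%:E : measurableTypeR R -> \bar R).
  by have := finite_measure_integrable_cst N01 m measurableT.
transitivity (\int[N01]_x ((cst m%:E : measurableTypeR R -> \bar R) x + s%:E * x%:E))%E.
  by apply: eq_integral => x _; rewrite EFinD EFinM.
rewrite integralD // integralZl ?normal_integrable_id // H mule0 adde0 integral_cst //.
by rewrite [X in (_ * X)%E](_ : _ = 1%E) ?mule1 //; exact: probability_setT.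
Qed.

(** A Cholesky factor by recursion: a reflection moves the first row to a multiple of the first
    basis row, the remaining block keeps independent rows, and it is replaced by its own square
    factor. This provides an actual square root for [matrix_root] to choose. *)
Lemma gram_root n k (B : 'M[R]_(n, k)) : (forall v : 'rV[R]_n, v *m B = 0 -> v = 0) ->
  exists C : 'M[R]_n, C *m C^T = B *m B^T.
Proof.
elim: n k B => [|n IH] k B injB; first by exists 0; apply/matrixP => -[].
have [b bE] : exists b : 'rV[R]_k, b = usubmx (B : 'M[R]_(1 + n, k)) by eexists.
have b0 : b != 0.
  apply/eqP => bz.
  have E : (row_mx 1%:M 0 : 'rV[R]_(1 + n)) *m
      col_mx (usubmx (B : 'M[R]_(1 + n, k))) (dsubmx (B : 'M[R]_(1 + n, k))) = 0.
    by rewrite mul_row_col mul0mx addr0 mul1mx -bE bz.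
  rewrite vsubmxK in E; move/injB/matrixP: E => /(_ 0 (@lshift 1 n 0)).
  by rewrite (@row_mxEl _ 1 1 n) !mxE eqxx => /eqP; rewrite oner_eq0.
case: k B injB b bE b0 => [|k] B injB b bE b0.
  by exfalso; move/eqP: b0; apply; apply/matrixP => i [].
have bb : (b *m b^T) 0 0 = \sum_i b 0 i ^+ 2.
  by rewrite mxE; apply: eq_bigr => i _; rewrite mxE expr2.
have bbp : 0 < (b *m b^T) 0 0.
  rewrite lt_neqAle eq_sym; apply/andP; split; last by rewrite bb; apply: sumr_ge0 => i _; exact: sqr_ge0.
  by apply: contra b0 => /eqP E; apply/eqP/gram_eq0/matrixP => i j; rewrite !ord1 E mxE.
have [r rE] : exists r, r = Num.sqrt ((b *m b^T) 0 0) by eexists.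
have r0 : 0 < r by rewrite rE sqrtr_gt0.
have r2 : r ^+ 2 = (b *m b^T) 0 0 by rewrite rE sqr_sqrtr // ltW.
have rn : r != 0 by rewrite gt_eqF.
have [H [HH qH]] : exists H : 'M[R]_k.+1, H^T *m H = 1%:M /\ (r^-1 *: b) *m H = delta_mx 0 0.
  apply: householder; apply/matrixP => i j; rewrite !ord1 linearZ /= -scalemxAl -scalemxAr.
  rewrite !mxE eqxx (_ : \sum_j0 _ = r ^+ 2); last by rewrite r2 mxE.
  by transitivity (1 : R) => //; field.
have HH' : H *m H^T = 1%:M by exact: mulmx1C.
have bH : b *m H = r *: delta_mx 0 0 by rewrite -qH -scalemxAl scalerA divff // scale1r.
pose B' : 'M[R]_(1 + n, 1 + k) := B *m H.
pose w : 'cV[R]_n := dlsubmx B'; pose D : 'M[R]_(n, k) := drsubmx B'.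
have BE : B' = block_mx r%:M 0 w D.
  rewrite -[LHS]submxK; congr block_mx; apply/matrixP => i j; rewrite !ord1.
    have -> : ulsubmx B' 0 0 = (b *m H) 0 0.
      rewrite bE /ulsubmx /usubmx /lsubmx /B' !mxE; apply: eq_bigr => l _; rewrite !mxE.
      by congr (B _ _ * H _ _); exact: val_inj.
    by rewrite bH !mxE eqxx mulr1.
  have -> : ursubmx B' 0 j = (b *m H) 0 (rshift 1 j).
    rewrite bE /ursubmx /usubmx /rsubmx /B' !mxE; apply: eq_bigr => l _; rewrite !mxE.
    by congr (B _ _ * H _ _); exact: val_inj.
  by rewrite bH !mxE /= mulr0.
have injD (v : 'rV[R]_n) : v *m D = 0 -> v = 0.
  move=> vD; pose u : 'rV[R]_(1 + n) := row_mx (- r^-1 *: (v *m w)) v.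
  have uB' : u *m B' = 0.
    rewrite BE /u mul_row_block mulmx0 add0r vD mul_mx_scalar scalerA mulrN divff // scaleN1r addNr.
    by rewrite row_mx0.
  have : u = 0.
    apply: injB; apply: (can_inj (mulmxK (_ : H \in unitmx))).
      by case/mulmx1_unit: HH.
    by rewrite mul0mx -mulmxA.
  by move/(congr1 (@rsubmx _ 1 1 n)); rewrite /u row_mxKr => ->; rewrite linear0.
have [C CE] := IH _ _ injD.
pose C1 : 'M[R]_(1 + n) := block_mx r%:M 0 w C.
have C1E : C1 *m C1^T = B' *m B'^T.
  by rewrite BE /C1 !tr_block_mx !mulmx_block CE !trmx0 !mulmx0 !mul0mx.
exists C1; apply: etrans C1E _.
by rewrite /B' trmx_mul mulmxA -[B *m H *m _]mulmxA HH' mulmx1.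
Qed.

End gaussian_law.

Section gaussian_random_vector.
Context d (T : measurableType d) (R : realType) (P : probability T R).

(** [gaussian_vector] provides some shift and some matrix; the means force the shift to vanish and
    the covariances force the Gram matrix. Both are read off from linear forms of the vector, whose
    laws are one-dimensional. *)
Lemma gaussian_vector_covariance n (X : 'I_n -> {RV P >-> R}) (S : 'M[R]_n) :
  gaussian_vector P (fun j => X j : T -> R) -> (forall j, 'E_P[X j] = 0)%E ->
  (forall i j, covariance P (X i) (X j) = (S i j)%:E) ->
  exists k (A : 'M[R]_(n, k)), A *m A^T = S /\
    forall g : cVb R n -> \bar R, measurable_fun setT g -> (forall y, 0 <= g y)%E ->
    (\int[P]_w g (random_vector (fun j => X j : T -> R) w) = \int[gauss R k]_y g (A *m (y : 'cV[R]_k))%R)%E.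
Proof.
move=> [m [k [A AE]]] mean cov.
have mX : measurable_fun setT (random_vector (fun j => X j : T -> R) : T -> cVb R n).
  by apply: measurable_random_vector => j; exact: measurable_funPT.
have maff : measurable_fun setT (fun y : cVb R k => m + A *m (y : 'cV[R]_k) : cVb R n).
  by apply: (measurableT_comp (measurable_translate m)); exact: measurable_mulmx.
have [nu nuE] := image_measure_exists P mX.
have nuE2 B : measurable B -> nu B = gauss R k ((fun y : cVb R k => m + A *m (y : 'cV[R]_k) : cVb R n) @^-1` B).
  move=> mB; rewrite nuE; apply: etrans (AE B mB) _; apply: gaussE.
  exact: measurable_preimage_cV maff mB.
have law (g : cVb R n -> \bar R) : measurable_fun setT g -> (forall y, 0 <= g y)%E ->
    (\int[P]_w g (random_vector (fun j => X j : T -> R) w) = \int[gauss R k]_y g (m + A *m (y : 'cV[R]_k))%R)%E.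
  move=> mg g0; rewrite -(ge0_integral_image mX (fun A _ => nuE A) mg g0).
  exact: (ge0_integral_image maff nuE2 mg g0).
have mlin (c : 'rV[R]_n) : measurable_fun setT (fun y : cVb R n => (c *m (y : 'cV[R]_n)) 0 0).
  exact: (measurableT_comp (@measurable_cV_coord R 1 0) (measurable_mulmx c)).
have law1 (c : 'rV[R]_n) (g : measurableTypeR R -> \bar R) : measurable_fun setT g -> (forall y, 0 <= g y)%E ->
    (\int[P]_w g ((c *m random_vector (fun j => X j : T -> R) w) 0 0)%R =
     \int[@normal_prob R 0 1]_x g ((c *m m) 0 0 + Num.sqrt ((c *m A *m (c *m A)^T) 0 0) * x)%R)%E.
  move=> mg g0.
  rewrite (law (fun y : cVb R n => g ((c *m (y : 'cV[R]_n)) 0 0))) //; last exact: (measurableT_comp mg (mlin c)).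
  have mg' : measurable_fun setT (fun x : measurableTypeR R => g ((c *m m) 0 0 + x)).
    by apply: (measurableT_comp mg); exact: measurable_funD.
  rewrite -(ge0_integral_gauss_row (c *m A) mg') //.
  by apply: eq_integral => y _; rewrite mulmxDr mulmxA mxE.
have m0 : m = 0.
  apply/colP => j; rewrite [RHS]mxE.
  have := mean j; rewrite expectation_def integralE.
  have cE w : ((delta_mx 0 j : 'rV[R]_n) *m random_vector (fun j => X j : T -> R) w) 0 0 = X j w.
    by rewrite -rowE !mxE.
  (* The one-dimensional law is available for nonnegative functions, so the mean is compared through
     positive and negative parts. *)
  pose gp : measurableTypeR R -> \bar R := ((fun x : measurableTypeR R => x%:E)^\+)%E.
  pose gn : measurableTypeR R -> \bar R := ((fun x : measurableTypeR R => x%:E)^\-)%E.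
  have mgp : measurable_fun setT gp by apply: measurable_funepos; exact/measurable_EFinP.
  have mgn : measurable_fun setT gn by apply: measurable_funeneg; exact/measurable_EFinP.
  have gp0 x : (0 <= gp x)%E by exact: funepos_ge0.
  have gn0 x : (0 <= gn x)%E by exact: funeneg_ge0.
  have Ep := law1 (delta_mx 0 j) gp mgp gp0.
  have En := law1 (delta_mx 0 j) gn mgn gn0.
  rewrite (_ : (\int[P]_w (_^\+) w)%E = (\int[P]_w gp (((delta_mx 0 j : 'rV[R]_n) *m random_vector (fun j => X j : T -> R) w) 0 0)%R)%E); last first.
    by apply: eq_integral => w _; rewrite cE /gp !funeposE.
  rewrite (_ : (\int[P]_w (_^\-) w)%E = (\int[P]_w gn (((delta_mx 0 j : 'rV[R]_n) *m random_vector (fun j => X j : T -> R) w) 0 0)%R)%E); last first.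
    by apply: eq_integral => w _; rewrite cE /gn !funenegE.
  rewrite Ep En => E.
  have := @normal_mean R (((delta_mx 0 j : 'rV[R]_n) *m m) 0 0) (Num.sqrt (((delta_mx 0 j : 'rV[R]_n) *m A *m ((delta_mx 0 j : 'rV[R]_n) *m A)^T) 0 0)).
  rewrite integralE.
  under eq_integral do rewrite funeposE -[X in maxe X _]/((fun x : measurableTypeR R => x%:E) _) -funeposE.
  under [X in (_ - X)%E]eq_integral do rewrite funenegE -[X in (maxe (- X) _)%E]/((fun x : measurableTypeR R => x%:E) _) -funenegE.
  rewrite [LHS]E -rowE !mxE => -[<-] //.
exists k, A; split; last by move=> g mg g0; rewrite law // m0; apply: eq_integral => y _; rewrite add0r.
have second (c : 'rV[R]_n) : (\int[P]_w (((c *m random_vector (fun j => X j : T -> R) w) 0 0) ^+ 2)%:E =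
    ((c *m A *m (c *m A)^T) 0 0)%:E)%E.
  have mg : measurable_fun setT (fun x : measurableTypeR R => (x ^+ 2)%:E : \bar R).
    by apply/measurable_EFinP; exact: measurable_funX.
  rewrite (law1 c (fun x => (x ^+ 2)%:E)) //; last by move=> x; rewrite lee_fin sqr_ge0.
  set v := (c *m A *m _) 0 0.
  have v0 : 0 <= v.
    by rewrite /v mxE sumr_ge0 // => i _; rewrite [X in _ * X]mxE -expr2 sqr_ge0.
  transitivity (v%:E * \int[@normal_prob R 0 1]_x (x ^+ 2)%:E)%E.
    rewrite -ge0_integralZl //; last by move=> x _; rewrite lee_fin sqr_ge0.
    by apply: eq_integral => x _; rewrite m0 mulmx0 mxE add0r exprMn sqr_sqrtr.
  by rewrite normal_second_moment mule1.
apply/matrixP => i j.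
have sqint (c : 'rV[R]_n) : P.-integrable setT (fun w => (((c *m random_vector (fun j => X j : T -> R) w) 0 0) ^+ 2)%:E).
  apply/integrableP; split.
    apply/measurable_EFinP; apply: measurable_funX; exact: (measurableT_comp (mlin c) mX).
  rewrite (_ : (\int[P]_(w in _) _)%E = ((c *m A *m (c *m A)^T) 0 0)%:E) ?ltry // -second.
  by apply: eq_integral => w _; rewrite gee0_abs // lee_fin sqr_ge0.
(* Polarisation: X_i X_j is the square of (X_i + X_j) / 2 minus the square of (X_i - X_j) / 2, so
   second moments of linear forms determine the covariances. *)
pose cp : 'rV[R]_n := 2^-1 *: ((delta_mx 0 i : 'rV[R]_n) + (delta_mx 0 j : 'rV[R]_n)).
pose cm : 'rV[R]_n := 2^-1 *: ((delta_mx 0 i : 'rV[R]_n) - (delta_mx 0 j : 'rV[R]_n)).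
have cpE w : (cp *m random_vector (fun j => X j : T -> R) w) 0 0 = 2^-1 * (X i w + X j w).
  by rewrite /cp -scalemxAl mulmxDl -!rowE !mxE.
have cmE w : (cm *m random_vector (fun j => X j : T -> R) w) 0 0 = 2^-1 * (X i w - X j w).
  by rewrite /cm -scalemxAl mulmxBl -!rowE !mxE.
have E : (S i j)%:E = (((cp *m A *m (cp *m A)^T) 0 0)%:E - ((cm *m A *m (cm *m A)^T) 0 0)%:E)%E.
  rewrite -cov -!second -integralB // unlock !mean /= unlock; apply: eq_integral => w _.
  rewrite cpE cmE -EFinB; congr EFin; rewrite !fctE /= !subr0; by field.
have G (c : 'rV[R]_n) : (c *m A *m (c *m A)^T) = c *m (A *m A^T) *m c^T.
  by rewrite trmx_mul !mulmxA.
move: E; rewrite !G -EFinB => -[->].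
have [M ME] : exists M, M = A *m A^T by eexists.
have Msym : M^T = M by rewrite ME trmx_mul trmxK.
have cpT : cp^T = 2^-1 *: (delta_mx i 0 + delta_mx j 0).
  by rewrite /cp linearZ linearD /= !trmx_delta.
have cmT : cm^T = 2^-1 *: (delta_mx i 0 - delta_mx j 0).
  by rewrite /cm linearZ linearB /= !trmx_delta.
rewrite -ME cpT cmT /cp /cm -!scalemxAl -!scalemxAr.
rewrite !mulmxDl !mulmxDr !mulNmx !mulmxN -!rowE -!colE !mxE.
have -> : M j i = M i j by rewrite -[in LHS]Msym mxE.
by field.
Qed.

End gaussian_random_vector.

(** * Gaussian moments on the cone where a given coordinate ratio is largest *)

Section gaussian_conditioning.
Variable R : realType.
Notation mu := (@lebesgue_measure R).

Lemma mul_row'mx n m p (j : 'I_n.+1) (A : 'M[R]_(n.+1, m)) (B : 'M[R]_(m, p)) :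
  row' j (A *m B) = row' j A *m B.
Proof. by apply/matrixP => i c; rewrite !mxE; apply: eq_bigr => l _; rewrite !mxE. Qed.

(* An orthogonal change of variables makes the coordinate j of A y the first
   standard normal variable, independent of the k remaining ones. *)
Lemma orthogonal_row_split n k (A : 'M[R]_(n.+1, k)) (S : 'M[R]_n.+1) (j : 'I_n.+1) :
  A *m A^T = S -> S \in unitmx -> S j j = 1 ->
  exists k' (A2 : 'M[R]_(n, k')),
    [/\ A2 *m A2^T = row' j (col' j S) - row' j (col j S) *m (row' j (col j S))^T,
        forall v : 'rV[R]_n, v *m A2 = 0 -> v = 0
      & forall h : cVb R n.+1 -> \bar R, measurable_fun setT h -> (forall v, 0 <= h v)%E ->
        exists A' : 'M[R]_(n.+1, k'.+1),
        [/\ (\int[gauss R k]_y h (A *m (y : 'cV[R]_k))%R = \int[gauss R k'.+1]_y h (A' *m (y : 'cV[R]_k'.+1))%R)%E,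
          forall x (y : 'cV[R]_k'), (A' *m (cons_cV (x, y) : 'cV[R]_k'.+1)) j 0 = x
        & forall x (y : 'cV[R]_k'), row' j (A' *m (cons_cV (x, y) : 'cV[R]_k'.+1)) = x *: row' j (col j S) + A2 *m y]].
Proof.
move=> AS uS Sjj.
case: k A AS => [|k] A AS.
  exfalso; move: Sjj; rewrite -AS mxE big_ord0 => /esym/eqP; by rewrite oner_eq0.
have bb : row j A *m (row j A)^T = 1%:M.
  apply/matrixP => a b; rewrite !ord1 [RHS]mxE eqxx -Sjj -AS !mxE.
  by apply: eq_bigr => l _; rewrite !mxE.
have [H [HH bH]] := householder bb.
have HH' : H *m H^T = 1%:M by exact: mulmx1C.
have [A' A'E] : exists A' : 'M[R]_(n.+1, 1 + k), A' = A *m H by eexists.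
have A'S : A' *m A'^T = S by rewrite A'E trmx_mul mulmxA -[A *m H *m _]mulmxA HH' mulmx1.
have A'j : row j A' = delta_mx 0 0 by rewrite A'E row_mul.
have A'j0 : A' j 0 = 1 by have /matrixP /(_ 0 0) := A'j; rewrite !mxE eqxx.
have A'jS l : A' j (rshift 1 l) = 0 by have /matrixP /(_ 0 (rshift 1 l)) := A'j; rewrite !mxE.
have [A2 A2E] : exists A2 : 'M[R]_(n, k), A2 = rsubmx (row' j A') by eexists.
have c0E : lsubmx (row' j A') = row' j (col j S).
  apply/matrixP => i z; rewrite !ord1 !mxE -A'S !mxE (bigD1 (lshift k 0)) //=.
  rewrite big1 => [|l l0].
    rewrite !mxE (_ : lshift k 0 = 0); last exact: val_inj.
    by rewrite A'j0 mulr1 addr0.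
  have [m ->] : exists m, l = rshift 1 m.
    case: (splitP l) l0 => [m E|m E] /eqP l0; last by exists m; exact: val_inj.
    by case: l0; apply: val_inj; rewrite /= E ord1.
  by rewrite mxE A'jS mulr0.
have rowE' : row' j A' = row_mx (row' j (col j S)) A2 by rewrite -c0E A2E hsubmxK.
have A2S : A2 *m A2^T = row' j (col' j S) - row' j (col j S) *m (row' j (col j S))^T.
  have : row' j A' *m (row' j A')^T = row' j (col' j S).
    apply/matrixP => a b; rewrite !mxE -A'S !mxE; by apply: eq_bigr => l _; rewrite !mxE.
  by rewrite rowE' tr_row_mx mul_row_col => <-; rewrite addrC addKr.
exists k, A2; split => //.
  move=> v vA2.
  (* A row annihilating [A2] is extended to a row annihilating [A']: the entry at j is chosen to
     cancel the first column, where row j of [A'] has its only nonzero entry. As S is non-singular,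
     the extension vanishes. *)
  pose u : 'rV[R]_n.+1 := v *m row' j 1%:M - (v *m row' j (col j S)) 0 0 *: delta_mx 0 j.
  have uA' : u *m A' = 0.
    rewrite /u mulmxBl -mulmxA -mul_row'mx mul1mx -scalemxAl -rowE A'j rowE' mul_mx_row vA2.
    apply/matrixP => a b; rewrite !ord1 !mxE.
    case: splitP => [m E|m E]; rewrite !mxE.
      have -> : b = 0 by apply: val_inj; rewrite /= E ord1.
      by rewrite ord1 eqxx mulr1 subrr.
    have -> : (b == 0) = false by apply/negP => /eqP b0; rewrite b0 in E.
    by rewrite mulr0 subr0.
  have u0 : u = 0.
    apply: (can_inj (mulmxK uS)); by rewrite mul0mx -A'S mulmxA uA' mul0mx.
  apply/rowP => i; have /rowP /(_ (lift j i)) := u0.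
  rewrite /u !mxE (bigD1 i) //= !mxE eqxx mulr1 big1 => [|l li].
    by rewrite addr0 eq_sym (negbTE (neq_lift j i)) mulr0 subr0.
  by rewrite !mxE (inj_eq lift_inj) (negbTE li) mulr0.
move=> h mh h0; exists A'; split.
- have mG : measurable_fun setT (fun y : cVb R k.+1 => h (A *m (y : 'cV[R]_k.+1))).
    exact: (measurableT_comp mh (measurable_mulmx A)).
  have nuE B : measurable B -> gauss R k.+1 B = gauss R k.+1 ((fun y : cVb R k.+1 => H *m (y : 'cV[R]_k.+1) : cVb R k.+1) @^-1` B).
    by move=> mB; rewrite gauss_orthogonal.
  rewrite (ge0_integral_image (measurable_mulmx H) nuE mG) //.
  by apply: eq_integral => y _; rewrite A'E mulmxA.
- move=> x y; transitivity (row j (A' *m (cons_cV (x, y) : 'cV[R]_(1 + k))) 0 0); first by rewrite [RHS]mxE.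
  by rewrite row_mul A'j -rowE mxE cons_cV0.
- move=> x y; rewrite mul_row'mx rowE' (@mul_row_col _ n 1 k 1).
  by rewrite mul_mx_scalar.
Qed.

Lemma mule_fine (c : R) (x : \bar R) : x \is a fin_num -> (c%:E * x = (c * fine x)%:E)%E.
Proof. by case: x. Qed.

Lemma mule_fin_lty (c b : R) (x : \bar R) : 0 < c -> (c%:E * x = b%:E)%E -> (x < +oo)%E.
Proof.
move=> c0; case: x => [r||] //; first by rewrite ltry.
by rewrite gt0_muley ?lte_fin.
Qed.

Lemma sphere_prob_ge0 n (B : set 'cV[R]_n) : (0 <= sphere_prob B)%E.
Proof. by rewrite lee_fin divr_ge0 // fine_ge0 // power_measure_ge0. Qed.

Lemma sphere_prob_le1 n (B : set (cVb R n.+1)) : measurable B -> (sphere_prob (B : set 'cV[R]_n.+1) <= 1)%E.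
Proof.
move=> mB; rewrite -(@sphere_probT R n); have [sg sgE] := sphere_measure_exists R n.+1.
have v0 := ball_volume_gt0 R n.+1.
have [_ [E1 _]] := sgE _ measurableT; have [_ [E2 _]] := sgE _ mB.
have : (sg B <= sg setT)%E by apply: le_measure; rewrite ?inE.
by rewrite E1 E2 lee_pmul2l.
Qed.

Lemma sphere_mixture_le n (a c : R) (D : set (cVb R n.+1)) : 0 < a -> measurable D ->
  (\int[mu]_(q in `]0%R, +oo[) ((F_pdf n.+1%:R a q)%:E *
      sphere_prob [set u : 'cV[R]_n.+1 | D (Num.sqrt (c * q) *: u)%R]) <=
  \int[mu]_(q in `]0%R, +oo[) ((F_pdf n.+1%:R a q)%:E * sphere_prob [set: 'cV[R]_n.+1]))%E.
Proof.
move=> a0 mD; apply: ge0_le_integral.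
- exact: measurable_itv.
- move=> q; rewrite /= in_itv /= andbT => q0; apply: mule_ge0; last exact: sphere_prob_ge0.
  by rewrite lee_fin F_pdf_ge0.
- apply: measurable_funTS; apply: emeasurable_funM.
    by apply/measurable_EFinP; exact: measurable_F_pdf.
  exact: measurable_sphere_prob_section.
- apply: measurable_funTS; apply: emeasurable_funM; last exact: measurable_cst.
  by apply/measurable_EFinP; exact: measurable_F_pdf.
- move=> q; rewrite /= in_itv /= andbT => q0; apply: lee_wpmul2l.
    by rewrite lee_fin F_pdf_ge0.
  rewrite sphere_probT; apply: sphere_prob_le1.
  exact: measurable_preimage_cV (measurable_scale _) mD.
Qed.

(** The factor sqrt (a + 1) before the root turns the radius sqrt (n q / (a + 1)) of the mixture
    into the radius sqrt (n q) of [t_prob]. Since [t_cdf] takes [fine] of [t_prob], finiteness is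
    needed too; it comes from the total mass of the mixture. For n = 0 the convention [t_cdf] = 1
    matches [integral_powR_normal]. *)
Lemma t_cdf_mixture n (a : R) (t m : 'cV[R]_n) (M : 'M[R]_n) : 0 < a ->
  (\int[mu]_(x in `]0%R, +oo[) ((x `^ a * normal_pdf 0 1 x)%:E *
     gauss R n [set z : cVb R n | forall i,
       ((Num.sqrt (a + 1) *: matrix_root M) *m (x^-1 *: (z : 'cV[R]_n))) i 0 <= (t - m) i 0]%R) =
   (m_const a * t_cdf (a + 1) t m M)%:E)%E.
Proof.
move=> a0; have nu0 : 0 < a + 1 by rewrite addr_gt0.
case: n t m M => [|n] t m M.
  rewrite /t_cdf eqxx mulr1 -integral_powR_normal //; apply: eq_integral => x _.
  rewrite (_ : [set z | _] = setT); last by apply/seteqP; split => z // _ [[]].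
  by rewrite [X in (_ * X)%E](gauss_setT R 0) mule1.
pose K := Num.sqrt (a + 1) *: matrix_root M.
pose D := [set z : cVb R n.+1 | forall i, (K *m (z : 'cV[R]_n.+1)) i 0 <= (t - m) i 0].
have mD : measurable D.
  exact: measurable_preimage_cV (measurable_mulmx K) (measurable_orthant (t - m)).
rewrite -/K; change (\int[mu]_(x in `]0%R, +oo[) ((x `^ a * normal_pdf 0 1 x)%:E *
     gauss R n.+1 [set z : cVb R n.+1 | D (x^-1 *: (z : 'cV[R]_n.+1))%R]) =
   (m_const a * t_cdf (a + 1) t m M)%:E)%E.
rewrite gauss_scale_mixture // /t_cdf /=.
have tE : (\int[mu]_(q in `]0%R, +oo[) ((F_pdf n.+1%:R (a + 1) q)%:E *
      sphere_prob [set u : 'cV[R]_n.+1 | D (Num.sqrt (n.+1%:R / (a + 1) * q) *: u)%R]) =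
   t_prob (a + 1) m (matrix_root M) [set y : 'cV[R]_n.+1 | forall i, (y i 0 <= t i 0)%R])%E.
  apply: eq_integral => q; rewrite mem_setE in_itv /= andbT => q0.
  congr (_ * sphere_prob _)%E.
  have sE : Num.sqrt (a + 1) * Num.sqrt (n.+1%:R / (a + 1) * q) = Num.sqrt (n.+1%:R * q).
    rewrite -sqrtrM ?(ltW nu0) //; congr Num.sqrt; by field; rewrite gt_eqF.
  have KuE u : K *m (Num.sqrt (n.+1%:R / (a + 1) * q) *: u) = Num.sqrt (n.+1%:R * q) *: (matrix_root M *m u).
    by rewrite /K -scalemxAr -scalemxAl scalerA mulrC sE.
  apply/seteqP; split => u /= hu i; have := hu i; rewrite KuE !mxE.
    by rewrite lerBrDl.
  by rewrite lerBrDl.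
have tp_fin : (t_prob (a + 1) m (matrix_root M) [set y : 'cV[R]_n.+1 | forall i, (y i 0 <= t i 0)%R] < +oo)%E.
  have FT := @gauss_scale_mixture R n a setT a0 measurableT.
  have [J JE] : exists J, J = (\int[mu]_(q in `]0%R, +oo[) ((F_pdf n.+1%:R (a + 1) q)%:E *
      sphere_prob [set: 'cV[R]_n.+1]))%E by eexists.
  have mJ : ((m_const a)%:E * J = (m_const a)%:E)%E.
    rewrite JE; apply: etrans (esym FT) _; apply: etrans _ (integral_powR_normal a0).
    apply: eq_integral => x _.
    by rewrite [X in (_ * X)%E](gauss_setT R n.+1) mule1.
  rewrite -tE; apply: (@le_lt_trans _ _ J); last first.
    exact: (mule_fin_lty (m_const_gt0 a0) mJ).
  rewrite JE.
  exact: sphere_mixture_le.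
have tp_fn : t_prob (a + 1) m (matrix_root M) [set y : 'cV[R]_n.+1 | forall i, y i 0 <= t i 0] \is a fin_num.
  rewrite ge0_fin_numE; first exact: tp_fin.
  apply: integral_ge0 => q; rewrite /= in_itv /= andbT => q0; apply: mule_ge0.
    rewrite lee_fin; exact: F_pdf_ge0.
  exact: sphere_prob_ge0.
apply: etrans (congr1 _ tE) _; exact: mule_fine tp_fn.
Qed.

(** With t the ratios z_i / z_j, these are the vectors with positive coordinate j for which v_j /
    z_j is the largest of the v_i / z_i. *)
Definition argmax_cone n (j : 'I_n.+1) (t : 'cV[R]_n) : set (cVb R n.+1) :=
  [set v | 0 < (v : 'cV[R]_n.+1) j 0 /\
     forall i, row' j (v : 'cV[R]_n.+1) i 0 <= (v : 'cV[R]_n.+1) j 0 * t i 0].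

Lemma measurable_argmax_cone n (j : 'I_n.+1) (t : 'cV[R]_n) : measurable (argmax_cone j t).
Proof.
have mcoord i : measurable_fun setT (fun v : cVb R n.+1 => (v : 'cV[R]_n.+1) i 0 : measurableTypeR R).
  exact: measurable_cV_coord.
rewrite (_ : argmax_cone j t = [set v | 0 < (v : 'cV[R]_n.+1) j 0] `&`
     \bigcap_i [set v | (v : 'cV[R]_n.+1) (lift j i) 0 - (v : 'cV[R]_n.+1) j 0 * t i 0 <= 0]).
    apply: measurableI.
      have := mcoord j measurableT _ (measurable_itv `](0 : R), +oo[).
      by rewrite setTI; congr measurable; apply/seteqP; split => v; rewrite /= in_itv /= andbT.
    apply: measurable_bigcap_fin => i.
    have m : measurable_fun setT (fun v : cVb R n.+1 => (v : 'cV[R]_n.+1) (lift j i) 0 - (v : 'cV[R]_n.+1) j 0 * t i 0 : measurableTypeR R).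
      by apply: measurable_funB; [exact: mcoord|apply: measurable_funM => //; exact: mcoord].
    exact: (measurable_sublevel _ (m)).
  apply/seteqP; split => v [v0 h]; split => // i.
    by move=> _ /=; rewrite subr_le0; have := h i; rewrite mxE.
  by rewrite mxE -subr_le0; exact: h.
Qed.

Lemma gaussian_argmax_moment n k (A : 'M[R]_(n.+1, k)) (S : 'M[R]_n.+1) (j : 'I_n.+1)
    (a : R) (t : 'cV[R]_n) :
  0 < a -> A *m A^T = S -> S \in unitmx -> S j j = 1 ->
  (\int[gauss R k]_y (((A *m (y : 'cV[R]_k)) j 0 `^ a) *
      \1_(argmax_cone j t) (A *m (y : 'cV[R]_k)))%:E =
   (m_const a * t_cdf (a + 1) t (row' j (col j S))
      ((a + 1)^-1 *: (row' j (col' j S) - row' j (col j S) *m (row' j (col j S))^T)))%:E)%E.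
Proof.
move=> a0 AS uS Sjj.
have nu0 : 0 < a + 1 by rewrite addr_gt0.
have [k' [A2 [A2S injA2 split2]]] := orthogonal_row_split AS uS Sjj.
have [Sj SjE] : exists Sj, Sj = row' j (col j S) by eexists.
rewrite -SjE in A2S split2 *.
set E := argmax_cone j t.
have mcoord i : measurable_fun setT (fun v : cVb R n.+1 => (v : 'cV[R]_n.+1) i 0 : measurableTypeR R).
  exact: measurable_cV_coord.
have mE : measurable E by exact: measurable_argmax_cone.
pose h (v : cVb R n.+1) : \bar R := ((v : 'cV[R]_n.+1) j 0 `^ a * \1_E v)%:E.
have mh : measurable_fun setT h.
  apply/measurable_EFinP; apply: measurable_funM; last exact: measurable_indic.
  exact: (measurableT_comp (@measurable_powR R a) (mcoord j)).
have h0 v : (0 <= h v)%E by rewrite lee_fin mulr_ge0 // powR_ge0.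
have [A' [E1 A'j A'r]] := split2 h mh h0.
rewrite [LHS]E1 [LHS]ge0_integral_pmeasS //; last first.
  exact: (measurableT_comp mh (measurable_mulmx A')).
have nus0 : 0 < Num.sqrt (a + 1) by rewrite sqrtr_gt0.
have [M ME] : exists M, M = (a + 1)^-1 *: (row' j (col' j S) - Sj *m Sj^T) by eexists.
rewrite -ME.
(* [matrix_root] is a choice with a default value, so an invertible root has to be exhibited.
   [gram_root] supplies a square factor, and independence of the rows of [A2] makes it
   invertible. *)
have [Cu CC] : matrix_root M \in unitmx /\ matrix_root M *m (matrix_root M)^T = M.
  have [C CE] := gram_root injA2.
  have MA : M = (a + 1)^-1 *: (A2 *m A2^T) by rewrite ME A2S.
  pose C' := (Num.sqrt (a + 1))^-1 *: C.
  have C'M : C' *m C'^T = M.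
    rewrite /C' linearZ /= -scalemxAl -scalemxAr scalerA CE MA; congr (_ *: _).
    by rewrite -invfM -expr2 sqr_sqrtr // ltW.
  have C'u : C' \in unitmx.
    rewrite -row_free_unit; apply: inj_row_free => v vC; apply: injA2; apply: gram_eq0.
    have : v *m (C' *m C'^T) *m v^T = 0 by rewrite mulmxA vC !mul0mx.
    rewrite C'M MA -scalemxAr -scalemxAl => /eqP.
    rewrite scaler_eq0 invr_eq0 (gt_eqF nu0) /= => /eqP <-.
    by rewrite trmx_mul !mulmxA.
  have : [set A | A \in unitmx /\ A *m A^T = M] (matrix_root M) by apply: xgetPex; exists C'.
  by [].
have [K KE] : exists K, K = Num.sqrt (a + 1) *: matrix_root M by eexists.
have Ku : K \in unitmx by rewrite KE unitmxZ // unitfE gt_eqF.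
have KK : K *m K^T = A2 *m A2^T.
  rewrite KE linearZ /= -scalemxAl -scalemxAr scalerA CC -expr2 sqr_sqrtr ?(ltW nu0) //.
  by rewrite ME scalerA divff ?gt_eqF // scale1r A2S.
(* [K] and [A2] have the same Gram matrix, so K^-1 A2 has orthonormal rows: the k' normal variables
   behind [A2] can be replaced by n of them acted on by [K]. *)
have QQ : (invmx K *m A2) *m (invmx K *m A2)^T = 1%:M.
  rewrite trmx_mul mulmxA -[_ *m A2 *m _]mulmxA -KK mulmxA mulVmx // mul1mx trmx_inv.
  by rewrite mulmxV // unitmx_tr.
have KQ y : A2 *m y = K *m (invmx K *m A2 *m y) by rewrite !mulmxA mulmxV // mul1mx.
pose D := [set z : cVb R n | forall i, (K *m (z : 'cV[R]_n)) i 0 <= (t - Sj) i 0].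
have mD : measurable D.
  exact: measurable_preimage_cV (measurable_mulmx K) (measurable_orthant (t - Sj)).
have inner (x : measurableTypeR R) : (\int[gauss R k']_y h (A' *m (cons_cV (x, y) : 'cV[R]_k'.+1))%R =
    (\1_(`]0, +oo[%classic) x * x `^ a)%:E *
     gauss R n [set z : cVb R n | D (x^-1 *: (z : 'cV[R]_n))%R])%E.
  rewrite indicE; case: (boolP (x \in _)); last first.
    rewrite mem_setE in_itv /= andbT => x0; rewrite mul0r mul0e.
    apply: integral0_eq => y _; rewrite /h indicE memNset ?mulr0 // => -[].
    by rewrite A'j => x1; rewrite x1 in x0.
  rewrite mem_setE in_itv /= andbT => x0; rewrite mul1r.
  have mDx : measurable [set z : cVb R n | D (x^-1 *: (z : 'cV[R]_n))].
    exact: measurable_preimage_cV (measurable_scale _) mD.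
  rewrite -(gauss_row_orthonormal QQ mDx).
  transitivity ((x `^ a)%:E * \int[gauss R k']_y (\1_((fun y : cVb R k' => invmx K *m A2 *m (y : 'cV[R]_k')) @^-1`
      [set z : cVb R n | D (x^-1 *: (z : 'cV[R]_n))%R]) y)%:E)%E; last first.
    congr (_ * _)%E; rewrite integral_indic ?setIT //.
    exact: measurable_preimage_cV (measurable_mulmx _) mDx.
  rewrite -ge0_integralZl //; last 2 first.
  - apply/measurable_EFinP/measurable_indic.
    exact: measurable_preimage_cV (measurable_mulmx _) mDx.
  - by rewrite lee_fin powR_ge0.
  apply: eq_integral => y _; rewrite /h A'j EFinM; congr (_ * _%:E)%E.
  rewrite !indicE; congr (nat_of_bool _)%:R; apply/idP/idP; rewrite !inE /E /D /=.
    move=> [_ hy] i; have := hy i; rewrite A'r A'j -scalemxAr -KQ !mxE => hyi.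
    rewrite ler_pdivrMl // mulrBr lerBrDl; exact: hyi.
  move=> hy; split; first by rewrite A'j.
  move=> i; have := hy i; rewrite A'r A'j -scalemxAr -KQ !mxE => hyi.
  by move: hyi; rewrite ler_pdivrMl // mulrBr lerBrDl.
have mh2 : measurable_fun setT (fun xy : measurableTypeR R * cVb R k' => h (A' *m (cons_cV xy : 'cV[R]_k'.+1))).
  apply: (measurableT_comp mh); apply: (measurableT_comp (measurable_mulmx A')).
  exact: measurable_cons_cV.
rewrite [LHS]ge0_integral_normal_prob; last 2 first.
- by apply: (@measurable_fun_fubini_tonelli_F _ _ _ _ _ (gauss R k') (fun xy : measurableTypeR R * cVb R k' => h (A' *m (cons_cV xy : 'cV[R]_k'.+1)))).
- by move=> x; exact: integral_ge0.
have {}inner : (\int[mu]_x ((normal_pdf 0 1 x)%:E * \int[gauss R k']_y h (A' *m (cons_cV (x, y) : 'cV[R]_k'.+1))%R) =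
   \int[mu]_(x in `]0%R, +oo[) ((x `^ a * normal_pdf 0 1 x)%:E * gauss R n [set z : cVb R n | D (x^-1 *: (z : 'cV[R]_n))%R]))%E.
  rewrite [RHS]ge0_integral_mul_indic; apply: eq_integral => x _.
  by rewrite inner [RHS]muleAC !muleA -!EFinM; congr (_%:E * _)%E; ring.
rewrite [LHS]inner {inner}.
rewrite /D KE; exact: t_cdf_mixture.
Qed.

End gaussian_conditioning.

(** * The maximal ratio of a Gaussian vector *)

Section gaussian_gram.
Variable R : realType.
Notation N01 := (@normal_prob R 0 1).

(** Conditioning on the first coordinate. The slope and the Gram matrix of the remainder, a Schur
    complement, are expressed by [S] alone, so that two factorisations of the same [S] can be
    compared coordinate by coordinate. *)
Lemma gauss_split_row0 n k (A : 'M[R]_(1 + n, k)) (S : 'M[R]_(1 + n)) (r : R) :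
  0 < r -> A *m A^T = S -> S 0 0 = r ^+ 2 ->
  exists k1 (D : 'M[R]_(n, k1)),
    D *m D^T = drsubmx S - (r^-1 *: dlsubmx S) *m (r^-1 *: dlsubmx S)^T /\
    forall B : set (cVb R n.+1), measurable B ->
      gauss R k [set y : cVb R k | B (A *m (y : 'cV[R]_k))] =
      (\int[N01]_x gauss R k1 [set y : cVb R k1 |
         B (cons_cV ((r * x)%R, (x *: (r^-1 *: dlsubmx S) + D *m (y : 'cV[R]_k1))%R))])%E.
Proof.
move=> r0 AS S00.
have rn : r != 0 by rewrite gt_eqF.
have [b bE] : exists b : 'rV[R]_k, b = usubmx A by eexists.
have bb : (b *m b^T) 0 0 = r ^+ 2.
  rewrite -S00 -AS bE !mxE; apply: eq_bigr => l _; rewrite !mxE.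
  by congr (A _ _ * A _ _); exact: val_inj.
case: k A AS b bE bb => [|k] A AS b bE bb.
  by move: bb; rewrite mxE big_ord0 => /esym/eqP; rewrite sqrf_eq0 (negbTE rn).
have [H [HH qH]] : exists H : 'M[R]_k.+1, H^T *m H = 1%:M /\ (r^-1 *: b) *m H = delta_mx 0 0.
  apply: householder; apply/matrixP => i j; rewrite !ord1 linearZ /= -scalemxAl -scalemxAr.
  rewrite !mxE eqxx (_ : \sum_j0 _ = r ^+ 2); last by rewrite -bb mxE.
  by transitivity (1 : R) => //; field.
have HH' : H *m H^T = 1%:M by exact: mulmx1C.
have bH : b *m H = r *: delta_mx 0 0 by rewrite -qH -scalemxAl scalerA divff // scale1r.
have [B' B'E] : exists B' : 'M[R]_(1 + n, 1 + k), B' = A *m H by eexists.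
have B'S : B' *m B'^T = S by rewrite B'E trmx_mul mulmxA -[A *m H *m _]mulmxA HH' mulmx1.
pose w : 'cV[R]_n := dlsubmx B'; pose D : 'M[R]_(n, k) := drsubmx B'.
have BE : B' = block_mx r%:M 0 w D.
  rewrite -[LHS]submxK; congr block_mx; apply/matrixP => i j; rewrite !ord1.
    have -> : ulsubmx B' 0 0 = (b *m H) 0 0.
      rewrite bE /ulsubmx /usubmx /lsubmx B'E !mxE; apply: eq_bigr => l _; rewrite !mxE.
      by congr (A _ _ * H _ _); exact: val_inj.
    by rewrite bH !mxE eqxx mulr1.
  have -> : ursubmx B' 0 j = (b *m H) 0 (rshift 1 j).
    rewrite bE /ursubmx /usubmx /rsubmx B'E !mxE; apply: eq_bigr => l _; rewrite !mxE.
    by congr (A _ _ * H _ _); exact: val_inj.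
  by rewrite bH !mxE /= mulr0.
have SE : S = block_mx (r ^+ 2)%:M (r *: w^T) (r *: w) (w *m w^T + D *m D^T).
  rewrite -B'S BE !tr_block_mx !mulmx_block !trmx0 !mulmx0 !mul0mx !addr0 tr_scalar_mx.
  by rewrite -scalar_mxM -expr2 mul_scalar_mx mul_mx_scalar.
have wE : r^-1 *: dlsubmx S = w by rewrite SE block_mxKdl scalerA mulVf // scale1r.
exists k, D; split; first by rewrite wE SE block_mxKdr addrC addKr.
move=> B mB; rewrite wE.
have mA C : measurable C -> measurable [set y : cVb R k.+1 | C (A *m (y : 'cV[R]_k.+1) : cVb R n.+1)].
  by move=> mC; exact: measurable_preimage_cV (measurable_mulmx _) mC.
rewrite -(gauss_orthogonal HH (mA _ mB)) [LHS]pmeasSE; last first.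
  exact: measurable_preimage_cV (measurable_mulmx _) (mA _ mB).
apply: eq_integral => x _; congr (gauss R k _).
have E (y : 'cV[R]_k) : A *m (H *m (cons_cV (x, y) : 'cV[R]_(1 + k))) = cons_cV (r * x, x *: w + D *m y).
  rewrite mulmxA -B'E BE /cons_cV /= (@mul_block_col _ 1 n 1 k 1) mul0mx addr0 -scalar_mxM.
  by rewrite mul_mx_scalar.
by apply/seteqP; split => y /=; rewrite E.
Qed.

(** The centered Gaussian law depends on its covariance matrix only. The induction allows singular
    matrices, which occur when sites are repeated. *)
Lemma gauss_gram n k k' (A : 'M[R]_(n, k)) (A' : 'M[R]_(n, k')) (B : set (cVb R n)) :
  A *m A^T = A' *m A'^T -> measurable B ->
  gauss R k [set y : cVb R k | B (A *m (y : 'cV[R]_k))] =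
  gauss R k' [set y : cVb R k' | B (A' *m (y : 'cV[R]_k'))].
Proof.
elim: n k k' A A' B => [|n IH] k k' A A' B AA mB.
  have E l (C : 'M[R]_(0, l)) : gauss R l [set y : cVb R l | B (C *m (y : 'cV[R]_l))] =
      (\1_B (0 : 'cV[R]_0))%:E.
    have C0 (y : 'cV[R]_l) : C *m y = 0 by apply/matrixP => -[].
    rewrite indicE; have [h|h] := boolP ((0 : 'cV[R]_0) \in B).
      rewrite (_ : [set _ | _] = setT) ?(gauss_setT R l) //.
      by apply/seteqP; split => y // _ /=; rewrite C0; rewrite inE in h.
    rewrite (_ : [set _ | _] = set0) ?measure0 //.
    by apply/seteqP; split => y //=; rewrite C0 => h2; rewrite mem_set in h.
  by rewrite !E.
have [S SE] : exists S : 'M[R]_(1 + n), S = A *m A^T by eexists.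
have SE' : A' *m A'^T = S by rewrite -AA SE.
have gram00 l (C : 'M[R]_(1 + n, l)) : (C *m C^T) 0 0 = \sum_i C 0 i ^+ 2.
  by rewrite mxE; apply: eq_bigr => i _; rewrite mxE expr2.
have S0 : 0 <= S 0 0 by rewrite SE gram00 sumr_ge0 // => i _; exact: sqr_ge0.
have [Sz|Sn] := eqVneq (S 0 0) 0.
  have E l (C : 'M[R]_(1 + n, l)) : C *m C^T = S ->
      gauss R l [set y : cVb R l | B (C *m (y : 'cV[R]_l))] =
      gauss R l [set y : cVb R l | [set v : cVb R n | B (cons_cV (0%R, v))] (dsubmx C *m (y : 'cV[R]_l))].
    move=> CS; congr (gauss R l _).
    have uC : usubmx C = 0.
      apply/matrixP => i j; rewrite !ord1 !mxE; apply/eqP; rewrite -sqrf_eq0; apply/eqP.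
      rewrite (_ : lshift n 0 = 0); last exact: val_inj.
      have : \sum_i C 0 i ^+ 2 = 0 by rewrite -gram00 CS.
      by move/(psumr_eq0P (fun i _ => sqr_ge0 (C 0 i))); exact.
    have CE (y : 'cV[R]_l) : C *m y = cons_cV (0, dsubmx C *m y).
      rewrite -[in LHS](@vsubmxK _ 1 n l C) (@mul_col_mx _ 1 n l 1) uC mul0mx /cons_cV /=.
      by congr col_mx; apply/matrixP => i j; rewrite !mxE mul0rn.
    by apply/seteqP; split => y /=; rewrite CE.
  rewrite (E _ A (esym SE)) (E _ A' SE'); apply: IH; last exact: measurable_cons_section.
  have dd l (C : 'M[R]_(1 + n, l)) : dsubmx C *m (dsubmx C)^T = drsubmx (C *m C^T).
    apply/matrixP => i j; rewrite !mxE; apply: eq_bigr => m _; by rewrite !mxE.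
  by rewrite !dd AA.
have r0 : 0 < Num.sqrt (S 0 0) by rewrite sqrtr_gt0 lt_neqAle eq_sym Sn.
have r2 : S 0 0 = Num.sqrt (S 0 0) ^+ 2 by rewrite sqr_sqrtr.
have [k1 [D1 [DS1 H1]]] := gauss_split_row0 r0 (esym SE) r2.
have [k2 [D2 [DS2 H2]]] := gauss_split_row0 r0 SE' r2.
rewrite H1 // H2 //; apply: eq_integral => x _.
apply: (IH k1 k2 D1 D2 [set v : cVb R n | B (cons_cV (Num.sqrt (S 0 0) * x,
  x *: ((Num.sqrt (S 0 0))^-1 *: dlsubmx S) + (v : 'cV[R]_n)))]); first by rewrite DS1 DS2.
exact: measurable_preimage_cV (measurable_translate _) (measurable_cons_section _ mB).
Qed.

Lemma gauss_hyperplane_null k (b : 'rV[R]_k) : b != 0 ->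
  gauss R k [set y : cVb R k | (b *m (y : 'cV[R]_k)) 0 0 = 0] = 0%E.
Proof.
move=> b0; have m1 : measurable [set (0 : measurableTypeR R)] by exact: measurable_set1.
pose g (x : measurableTypeR R) : \bar R := (\1_[set (0 : measurableTypeR R)] x)%:E.
have mg : measurable_fun setT g by apply/measurable_EFinP; exact: measurable_indic.
have g0 x : (0 <= g x)%E by rewrite lee_fin.
have := ge0_integral_gauss_row b mg g0.
have s0 : Num.sqrt ((b *m b^T) 0 0) != 0.
  apply: contra b0 => /eqP E; apply/eqP/gram_eq0/matrixP => i j; rewrite !ord1 [RHS]mxE.
  apply/eqP; rewrite eq_le -sqrtr_eq0 E eqxx /= mxE sumr_ge0 // => l _.
  by rewrite mxE -expr2 sqr_ge0.
rewrite (_ : (\int[N01]_x _)%E = 0%E); last first.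
  transitivity (\int[N01]_x g x)%E.
    apply: eq_integral => x _; rewrite /g !indicE; congr (nat_of_bool _)%:R%:E.
    apply/idP/idP; rewrite !inE /=; last by move=> ->; rewrite mulr0.
    by move/eqP; rewrite mulf_eq0 (negbTE s0) => /eqP.
  rewrite ge0_integral_normal_prob // -ge0_integral_mul_indic; exact: integral_set1.
move=> E; pose X := [set y : cVb R k | (b *m (y : 'cV[R]_k)) 0 0 = 0].
have mX : measurable X.
  have := measurableT_comp (@measurable_cV_coord R 1 0) (measurable_mulmx b) measurableT m1.
  by rewrite setTI.
transitivity (\int[gauss R k]_y (\1_X y)%:E)%E; first by rewrite integral_indic // setIT.
by rewrite -[RHS]E; apply: eq_integral => y _; rewrite /g !indicE; congr (nat_of_bool _)%:R%:E; apply/idP/idP; rewrite !inE.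
Qed.

End gaussian_gram.

Lemma sigma_generated_vector (I : Type) d (T : measurableType d) (R : realType) (X : I -> T -> R) n (f : 'I_n -> I)
    (B : set 'cV[R]_n) : borel B ->
  sigma_generated X (random_vector (fun j => X (f j)) @^-1` B).
Proof.
move=> mB.
pose G := \bigcup_i preimage_set_system [set: T] (X i) measurable.
have mX j : measurable_fun [set: g_sigma_algebraType G] (X (f j) : g_sigma_algebraType G -> R).
  move=> _ Y mY; apply: sub_gen_smallest; exists (f j) => //; by exists Y.
have := measurable_random_vector mX measurableT mB.
by rewrite setTI.
Qed.

Lemma sigma_generated_bigcap (I : Type) d (T : measurableType d) (R : realType) (X : I -> T -> R) n (E : 'I_n -> set T) :
  (forall i, sigma_generated X (E i)) -> sigma_generated X (\bigcap_(i : 'I_n) E i).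
Proof.
pose G := \bigcup_i preimage_set_system [set: T] (X i) measurable.
exact: (@measurable_bigcap_fin _ (g_sigma_algebraType G)).
Qed.

(** * Moments of the maximal ratio *)

Section ratio_max.
Variables (R : realType) (a : R).
Hypothesis a0 : 0 < a.

Definition ratio_max n (z v : 'cV[R]_n) : R := \big[Num.max/0]_j (v j 0 / z j 0).

Lemma ratio_max_ge0 n (z v : 'cV[R]_n) : 0 <= ratio_max z v.
Proof. exact: bigmax_ge_id. Qed.

Lemma ratio_max_attained n (z v : 'cV[R]_n) :
  ratio_max z v = 0 \/ exists j, ratio_max z v = v j 0 / z j 0.
Proof.
rewrite /ratio_max; elim: (index_enum _) => [|j s IH]; first by left; rewrite big_nil.
by rewrite big_cons maxEle; case: ifP => _ //; right; exists j.
Qed.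

Lemma measurable_ratio_max n (z : 'cV[R]_n) :
  measurable_fun setT (fun v : cVb R n => ratio_max z (v : 'cV[R]_n) : measurableTypeR R).
Proof.
rewrite /ratio_max; elim: (index_enum _) => [|j s IH].
  by under eq_fun do rewrite big_nil; exact: measurable_cst.
under eq_fun do rewrite big_cons; apply: measurable_maxr => //.
by apply: measurable_funM => //; exact: measurable_cV_coord.
Qed.

Lemma ratio_max_le n (z v : 'cV[R]_n) c : (forall j, 0 < z j 0) -> 0 <= c ->
  (ratio_max z v <= c) <-> (forall j, v j 0 <= c * z j 0).
Proof.
move=> z0 c0; split.
  by move/bigmax_leP => [_ h] j; rewrite -ler_pdivrMr //; exact: h.
by move=> h; apply/bigmax_leP; split => // j _; rewrite ler_pdivrMr.
Qed.

Lemma ratio_maxZ n (l : R) (z v : 'cV[R]_n) : 0 < l ->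
  ratio_max (l *: z) v = l^-1 * ratio_max z v.
Proof.
move=> l0; rewrite /ratio_max; have li0 : 0 <= l^-1 by rewrite invr_ge0 ltW.
elim: (index_enum _) => [|j s IH]; first by rewrite !big_nil mulr0.
by rewrite !big_cons IH maxr_pMr // mxE invfM mulrCA.
Qed.

Notation ratios z j := (map_mx (fun x => x / z j 0) (row' j z)).

(** Without ties the cones are disjoint, and a vector with some positive coordinate lies in the cone
    of its maximal ratio. A vector without positive coordinates lies in no cone, and both sides are
    then 0 because a > 0. *)
Lemma ratio_max_argmax n (z v : 'cV[R]_n.+1) : (forall j, 0 < z j 0) ->
  (forall i j, i != j -> v i 0 * z j 0 != v j 0 * z i 0) ->
  ratio_max z v `^ a =
  \sum_j z j 0 `^ (- a) * (v j 0 `^ a * \1_(argmax_cone j (ratios z j)) (v : cVb R n.+1)).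
Proof.
move=> z0 noties.
pose j := [arg max_(j > ord0) (v j 0 / z j 0)]%O.
have jmax i : v i 0 / z i 0 <= v j 0 / z j 0.
  by rewrite /j; case: arg_maxP => // k _ h; exact: h.
have cone i : argmax_cone i (ratios z i) (v : cVb R n.+1) -> i = j /\ 0 < v i 0.
  move=> [vi h]; split => //; apply/eqP/negPn/negP => ij.
  have [k kE] := unlift_some ij.
  have := h k; rewrite !mxE -kE => hj.
  have := jmax i; rewrite ler_pdivrMr // mulrAC ler_pdivlMr // => h1.
  move: hj; rewrite mulrA ler_pdivlMr // => h2.
  by move: (noties i j ij); rewrite eq_le h1 h2.
have [vj|vj] := ltP 0 (v j 0).
  have -> : ratio_max z v = v j 0 / z j 0.
    apply/eqP; rewrite eq_le; apply/andP; split; last exact: le_bigmax.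
    by apply/bigmax_leP; split => //; rewrite divr_ge0 // ltW.
  rewrite (bigD1 j) //= big1 ?addr0 => [|i ij].
    rewrite indicE mem_set ?mulr1; last first.
      split => // i; rewrite !mxE mulrA ler_pdivlMr //.
      by have := jmax (lift j i); rewrite ler_pdivrMr // mulrAC ler_pdivlMr.
    by rewrite powRM ?invr_ge0 ?(ltW vj) ?(ltW (z0 j)) // powR_inv ?(ltW (z0 j)) // mulrC.
  rewrite indicE memNset ?mulr0 // => /cone [E _]; by rewrite E eqxx in ij.
have -> : ratio_max z v = 0.
  apply/eqP; rewrite eq_le ratio_max_ge0 andbT; apply/bigmax_leP; split => // i _.
  apply: le_trans (jmax i) _; by rewrite pmulr_lle0 // invr_gt0.
rewrite powR0 ?gt_eqF // big1 // => i _.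
rewrite indicE memNset ?mulr0 // => /cone [E]; by rewrite E ltNge vj.
Qed.

Lemma ratio_max_moment n k (A : 'M[R]_(n.+1, k)) (S : 'M[R]_n.+1) (z : 'cV[R]_n.+1) :
  (forall j, 0 < z j 0) -> A *m A^T = S -> S \in unitmx -> (forall j, S j j = 1) ->
  (\int[gauss R k]_y (ratio_max z (A *m (y : 'cV[R]_k)) `^ a)%:E =
   (m_const a * \sum_j z j 0 `^ (- a) *
      t_cdf (a + 1) (map_mx (fun x => x / z j 0)%R (row' j z)) (row' j (col j S))
        ((a + 1)^-1 *: (row' j (col' j S) - row' j (col j S) *m (row' j (col j S))^T)))%:E)%E.
Proof.
move=> z0 AS uS S1.
have mcone j : measurable (argmax_cone j (ratios z j)).
  exact: measurable_argmax_cone.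
have mterm0 j : measurable_fun setT (fun y : cVb R k => ((A *m (y : 'cV[R]_k)) j 0 `^ a *
    \1_(argmax_cone j (ratios z j)) (A *m (y : 'cV[R]_k)))%:E).
  apply/measurable_EFinP.
  apply: (@measurableT_comp _ _ _ _ _ _ (fun v : cVb R n.+1 => (v : 'cV[R]_n.+1) j 0 `^ a * \1_(argmax_cone j (ratios z j)) v : measurableTypeR R)); last exact: measurable_mulmx.
  apply: measurable_funM; last exact: measurable_indic.
  exact: (measurableT_comp (@measurable_powR R a) (@measurable_cV_coord R n.+1 j)).
have mterm j : measurable_fun setT (fun y : cVb R k => (z j 0 `^ (- a) * ((A *m (y : 'cV[R]_k)) j 0 `^ a *
    \1_(argmax_cone j (ratios z j)) (A *m (y : 'cV[R]_k))))%:E).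
  apply/measurable_EFinP; apply: measurable_funM; first exact: measurable_cst.
  by apply/measurable_EFinP; exact: mterm0.
transitivity (\int[gauss R k]_y (\sum_j (z j 0 `^ (- a) * ((A *m (y : 'cV[R]_k)) j 0 `^ a *
    \1_(argmax_cone j (ratios z j)) (A *m (y : 'cV[R]_k))))%:E))%E.
  apply: ae_eq_integral => //.
  - apply/measurable_EFinP; apply: (measurableT_comp (@measurable_powR R a)).
    exact: (measurableT_comp (measurable_ratio_max z) (measurable_mulmx A)).
  - exact: emeasurable_sum.
  (* The linear form that vanishes exactly where sites i and j tie. It is not zero because the Gram
     matrix of [A] is invertible, so ties lie in null hyperplanes. *)
  pose b (i j : 'I_n.+1) : 'rV[R]_k := (z j 0 *: delta_mx 0 i - z i 0 *: delta_mx 0 j) *m A.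
  have b0 i j : i != j -> b i j != 0.
    move=> ij; apply/eqP => bz.
    have : z j 0 *: delta_mx 0 i - z i 0 *: delta_mx 0 j = 0 :> 'rV[R]_n.+1.
      by apply: (can_inj (mulmxK uS)); rewrite mul0mx -AS mulmxA [_ *m A]bz mul0mx.
    move/rowP => /(_ i); rewrite !mxE !eqxx (negbTE ij) /= mulr1 mulr0 subr0.
    by apply/eqP; rewrite gt_eqF.
  have bE i j y : (b i j *m y) 0 0 = (A *m y) i 0 * z j 0 - (A *m y) j 0 * z i 0.
    by rewrite /b -mulmxA mulmxBl -!scalemxAl -!rowE !mxE mulrC [z i 0 * _]mulrC.
  pose tie (ij : 'I_n.+1 * 'I_n.+1) : set (cVb R k) :=
    if ij.1 != ij.2 then [set y | (b ij.1 ij.2 *m (y : 'cV[R]_k)) 0 0 = 0] else set0.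
  have neg : (gauss R k).-negligible (\big[setU/set0]_ij tie ij).
    apply: big_ind; [exact: negligible_set0|exact: negligibleU|move=> [i j] _].
    rewrite /tie /=; case: ifPn => ij; last exact: negligible_set0.
    apply/negligibleP; last exact: gauss_hyperplane_null (b0 _ _ ij).
    have := measurableT_comp (@measurable_cV_coord R 1 0) (measurable_mulmx (b i j)) measurableT (measurable_set1 0).
    by rewrite setTI.
  apply: negligibleS neg => y /= h; apply: contrapT => nt; apply: h => _.
  rewrite sumEFin; congr EFin; apply: ratio_max_argmax => // i j ij.
  apply/eqP => E; apply: nt; rewrite (bigD1 (i, j)) //=; left.
  by rewrite /tie /= ij /= bE E subrr.
rewrite ge0_integral_sum //; last first.
  by move=> j y _; rewrite lee_fin mulr_ge0 ?powR_ge0 // mulr_ge0 ?powR_ge0.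
rewrite mulr_sumr -sumEFin; apply: eq_bigr => j _.
have := gaussian_argmax_moment (ratios z j) a0 AS uS (S1 j).
set I := (\int[_]_y _)%E => E.
transitivity ((z j 0 `^ (- a))%:E * I)%E; last by rewrite E -EFinM mulrCA.
rewrite -ge0_integralZl //; first by move=> y _; rewrite lee_fin mulr_ge0 ?powR_ge0.
by rewrite lee_fin powR_ge0.
Qed.

End ratio_max.

(** * The max process *)

(** The real [sup] of an unbounded set is 0 by convention, and so is [fine] of +oo. The real
    supremum is therefore [fine] of the extended one at every point, not just almost surely. *)
Lemma measurable_real_sup d (T : measurableType d) (R : realType) (f : nat -> T -> measurableTypeR R) :
  (forall i, measurable_fun setT (f i)) ->
  measurable_fun setT (fun w => sup (range (fun i => f i w)) : measurableTypeR R).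
Proof.
move=> mf; pose g w := esups (fun i => (f i w)%:E) 0.
have mg : measurable_fun setT g.
  by apply: measurable_fun_esups => i; apply/measurable_EFinP; exact: mf.
have -> : (fun w => sup (range (fun i => f i w)) : measurableTypeR R) = fine \o g.
  apply/funext => w /=.
  have -> : g w = ereal_sup [set x%:E | x in range (fun i => f i w)].
    congr ereal_sup; apply/seteqP; split => x /=.
      by case=> i _ <-; exists (f i w) => //; exists i.
    by case=> _ [i _ <-] <-; exists i.
  have ne : range (fun i => f i w) !=set0 by exists (f 0%N w), 0%N.
  have [ub|nub] := pselect (has_ubound (range (fun i => f i w))).
    by rewrite ereal_sup_EFin.
  rewrite sup_out; last by case.
  case E : (ereal_sup _) => [r| |] //=; exfalso; apply: nub; exists r => _ [i _ <-].
  by rewrite -lee_fin -E; apply: ereal_sup_ubound; exists (f i w) => //; exists i.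
by apply: (measurableT_comp _ mg); exact: fine_measurable.
Qed.

Lemma forall_bigcap (I T : Type) (A : I -> T -> Prop) :
  [set w | forall i, A i w] = \bigcap_i [set w | A i w].
Proof. by apply/seteqP; split => w h i; [move=> _; exact: h|exact: (h i Logic.I)]. Qed.

Lemma probability_ae_iff d (T : measurableType d) (R : realType) (P : probability T R) (A B : set T) :
  measurable A -> measurable B -> {ae P, forall w, A w <-> B w} -> P A = P B.
Proof.
move=> mA mB AB.
rewrite -[A in LHS]setIT -[B in RHS]setIT -!integral_indic //.
apply: ae_eq_integral => //; [by apply/measurable_EFinP; exact: measurable_indic..|].
apply: filterS AB => w AB _; rewrite !indicE; congr (nat_of_bool _)%:R%:E.
by apply/idP/idP; rewrite !inE => /AB.
Qed.

Section powR_intensity.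
Variables (R : realType) (a : R).
Hypothesis a0 : 0 < a.
Notation mu := (@lebesgue_measure R).

Lemma measurable_scaled_gt1 d (T : measurableType d) (M : T -> R) :
  measurable_fun setT (M : T -> measurableTypeR R) ->
  measurable [set vw : measurableTypeR R * T | 1 < vw.1 * M vw.2].
Proof.
move=> mM.
have m : measurable_fun setT (fun vw : measurableTypeR R * T => vw.1 * M vw.2 : measurableTypeR R).
  by apply: measurable_funM => //; exact: (measurableT_comp mM measurable_snd).
have := m measurableT _ (measurable_itv `](1 : R), +oo[).
by rewrite setTI; congr measurable; apply/seteqP; split => v; rewrite /= in_itv /= andbT.
Qed.

Lemma measurable_scaled_tail d (T : measurableType d) (P : probability T R) (M : T -> R) :
  measurable_fun setT (M : T -> measurableTypeR R) ->
  measurable_fun setT (fun v : measurableTypeR R => P [set w | 1 < v * M w]).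
Proof.
move=> mM; have := measurable_fun_xsection P (measurable_scaled_gt1 mM).
congr (measurable_fun _); apply/funext => v /=.
by congr (P _); apply/seteqP; split => w; rewrite /xsection /= inE.
Qed.

(** By Fubini the integral is the expected mass of ]1 / M, +oo[, which is M ^ a. A vanishing M has
    to be treated apart, both sides being 0. *)
Lemma powR_intensity_exists : exists Lam : {measure set (measurableTypeR R) -> \bar R},
  (forall A, Lam A = intensity_measure (fun v => a * v `^ (- (a + 1))) A) /\
  (forall t : R, 0 < t -> Lam `]t, +oo[%classic = (t `^ (- a))%:E) /\
  forall d (T : measurableType d) (P : probability T R) (M : T -> R),
    measurable_fun setT (M : T -> measurableTypeR R) -> (forall w, 0 <= M w) ->
    (\int[Lam]_(v in `]0%R, +oo[) P [set w | 1 < v * M w]%R = \int[P]_w (M w `^ a)%:E)%E.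
Proof.
pose f (v : measurableTypeR R) : R := a * v `^ (- (a + 1)).
have mf : measurable_fun setT f by apply: measurable_funM => //; exact: measurable_powR.
have f0 v : 0 <= f v by rewrite mulr_ge0 ?powR_ge0 // ltW.
have [Lam LE] := density_measure_exists mu mf f0.
have tail (t : R) : 0 < t -> (\int[mu]_(v in `]t, +oo[) (f v)%:E = (t `^ (- a))%:E)%E.
  move=> t0; rewrite -integral_powR_tail //; apply: integral_itv_obnd_cbnd.
  by apply: measurable_funTS; apply/measurable_EFinP.
exists Lam; split; first exact: LE.
split; first by move=> t t0; rewrite LE tail.
move=> d T P M mM M0.
pose C : set (measurableTypeR R * T) := [set vw | 1 < vw.1 * M vw.2].
have mC : measurable C := measurable_scaled_gt1 mM.
have mCv v : measurable [set w | 1 < v * M w].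
  have := measurable_xsection v mC; congr measurable.
  by apply/seteqP; split => w; rewrite /xsection /= inE.
pose g (v : measurableTypeR R) := P [set w | 1 < v * M w].
have mg : measurable_fun setT g := measurable_scaled_tail P mM.
pose F (vw : measurableTypeR R * T) : \bar R := ((f vw.1 * \1_(`]0, +oo[%classic) vw.1) * \1_C vw)%:E.
have mF : measurable_fun setT F.
  apply/measurable_EFinP; apply: measurable_funM; last exact: measurable_indic.
  apply: (@measurableT_comp _ _ _ _ _ _ (fun v : measurableTypeR R => f v * \1_(`]0, +oo[%classic) v : measurableTypeR R)) => //.
  by apply: measurable_funM => //; exact: measurable_indic.
have F0 vw : (0 <= F vw)%E by rewrite lee_fin mulr_ge0 // mulr_ge0.
rewrite [LHS]ge0_integral_mul_indic.
rewrite (@ge0_integral_density _ _ _ mu Lam f) //; last 2 first.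
- by apply: emeasurable_funM => //; apply/measurable_EFinP; exact: measurable_indic.
- by move=> v; rewrite mule_ge0 // lee_fin.
transitivity (\int[mu]_v \int[P]_w F (v, w))%E.
  apply: eq_integral => v _.
  rewrite [X in ((f v)%:E * X)%E]muleC muleA -EFinM.
  transitivity ((f v * \1_(`]0, +oo[%classic) v)%:E * \int[P]_w (\1_[set w | (1 < v * M w)%R] w)%:E)%E.
    by rewrite integral_indic // setIT.
  rewrite -ge0_integralZl //; last 2 first.
  - by apply/measurable_EFinP; apply: measurable_indic; exact: mCv.
  - by rewrite lee_fin mulr_ge0.
rewrite fubini_tonelli //; apply: eq_integral => w _.
have [M1|M1] := ltP 0 (M w); last first.
  have -> : M w = 0 by apply/eqP; rewrite eq_le M0 M1.
  rewrite powR0 ?gt_eqF //; apply: integral0_eq => v _; rewrite /F (_ : \1_C (v, w) = 0) ?mulr0 //.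
  rewrite indicE memNset // /C /=.
  have -> : M w = 0 by apply/eqP; rewrite eq_le M0 M1.
  by rewrite mulr0 ltr10.
rewrite -[M w in RHS]invrK powR_inv ?invr_ge0 ?(ltW M1) // -tail ?invr_gt0 // [RHS]ge0_integral_mul_indic.
apply: eq_integral => v _; rewrite /F /= -EFinM -mulrA; congr (_ * _)%:E.
rewrite !indicE -natrM mulnb; congr (nat_of_bool _)%:R; apply/andP/idP.
  by rewrite !inE /C /= !in_itv /= !andbT => -[_ h]; rewrite -div1r ltr_pdivrMr.
rewrite !inE /C /= !in_itv /= !andbT => h; split; first by apply: lt_trans h; rewrite invr_gt0.
by rewrite -ltr_pdivrMr // div1r.
Qed.

End powR_intensity.

Section max_process.
Context (R : realType) d (T : measurableType d) (P : probability T R) (S : Type).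
Variables (a : R) (Cov : S -> S -> R) (W : nat -> S -> {RV P >-> R}) (V : nat -> {RV P >-> R}).
Hypotheses (a0 : 0 < a) (hCov : correlation_function Cov)
  (hW : forall i, centered_gaussian_field Cov (W i))
  (hW_indep : mutually_independent P (fun i => sigma_generated (fun s => W i s : T -> R)))
  (hV : poisson_process V (intensity_measure (fun v => a * v `^ (- (a + 1)))))
  (hVW : independent2 P (sigma_generated (fun i => V i : T -> R))
     (sigma_generated (fun q : nat * S => W q.1 q.2 : T -> R))).

Lemma points_gt0 i w : 0 < V i w.
Proof. by have [] := hV. Qed.

Definition sites n (s : 'I_n -> S) (i : nat) : T -> cVb R n :=
  random_vector (fun j => W i (s j) : T -> R).

Lemma measurable_sites n (s : 'I_n -> S) i : measurable_fun setT (sites s i).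
Proof. by apply: measurable_random_vector => j; exact: measurable_funPT. Qed.

(** A single matrix serves all i: each field comes with its own factorisation, and [gauss_gram]
    identifies the resulting laws. *)
Lemma sites_law n (s : 'I_n -> S) : exists k (A : 'M[R]_(n, k)),
  A *m A^T = cov_matrix Cov s /\
  forall i (g : cVb R n -> \bar R), measurable_fun setT g -> (forall v, 0 <= g v)%E ->
    (\int[P]_w g (sites s i w) = \int[gauss R k]_y g (A *m (y : 'cV[R]_k))%R)%E.
Proof.
have L i : exists k (A : 'M[R]_(n, k)), A *m A^T = cov_matrix Cov s /\
    forall g : cVb R n -> \bar R, measurable_fun setT g -> (forall v, 0 <= g v)%E ->
    (\int[P]_w g (sites s i w) = \int[gauss R k]_y g (A *m (y : 'cV[R]_k))%R)%E.
  have [G mean cov] := hW i.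
  apply: (@gaussian_vector_covariance _ _ _ P n (fun j => W i (s j))); first exact: G.
    by move=> j; exact: mean.
  by move=> j l; rewrite cov mxE.
have [k [A [AS AL]]] := L 0%N; exists k, A; split=> // i g mg g0.
have [k' [A' [AS' ->]]] := L i; last first => //.
have [nu nuE] := image_measure_exists (gauss R k) (measurable_mulmx A).
rewrite -(ge0_integral_image (measurable_mulmx A) (fun B _ => nuE B) mg g0).
apply/esym/(ge0_integral_image (measurable_mulmx A')) => // B mB.
by rewrite nuE; apply: gauss_gram; rewrite ?AS ?AS'.
Qed.

Lemma sites_law_eq n (s : 'I_n -> S) i (B : set (cVb R n)) : measurable B ->
  P (sites s i @^-1` B) = P (sites s 0%N @^-1` B).
Proof.
move=> mB; have [k [A [_ L]]] := sites_law s.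
have mI : measurable_fun setT (fun v : cVb R n => (\1_B v)%:E : \bar R).
  by apply/measurable_EFinP; exact: measurable_indic.
have E l : P (sites s l @^-1` B) = (\int[P]_w (\1_B (sites s l w))%:E)%E.
  transitivity (\int[P]_w (\1_(sites s l @^-1` B) w)%:E)%E.
    rewrite integral_indic ?setIT //.
    exact: measurable_preimage_cV (measurable_sites s l) mB.
  by apply: eq_integral => w _; rewrite !indicE; congr (nat_of_bool _)%:R%:E; apply/idP/idP; rewrite !inE.
by rewrite !E !(L _ (fun v => (\1_B v)%:E)).
Qed.

(** The exponent function of the max-stable vector of values at the sites, before norming. *)
Definition exponent n (s : 'I_n -> S) (z : 'cV[R]_n) : \bar R :=
  (\int[P]_w (ratio_max z (sites s 0%N w : 'cV[R]_n) `^ a)%:E)%E.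

Lemma measurable_ratio_sites n (s : 'I_n -> S) (z : 'cV[R]_n) i :
  measurable_fun setT (fun w => ratio_max z (sites s i w : 'cV[R]_n) : measurableTypeR R).
Proof. exact: (measurableT_comp (measurable_ratio_max z) (measurable_sites s i)). Qed.

Lemma exponent_unit n (s : 'I_n.+1 -> S) (z : 'cV[R]_n.+1) : (forall j, 0 < z j 0) ->
  cov_matrix Cov s \in unitmx ->
  exponent s z = (m_const a * \sum_j z j 0 `^ (- a) *
    let Sjj := row' j (col' j (cov_matrix Cov s)) in
    let Sj := row' j (col j (cov_matrix Cov s)) in
      t_cdf (a + 1) (map_mx (fun x => x / z j 0)%R (row' j z)) Sj
        ((a + 1)^-1 *: (Sjj - Sj *m Sj^T)))%:E.
Proof.
move=> z0 uS; have [k [A [AS L]]] := sites_law s.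
rewrite /exponent (L 0%N (fun v => (ratio_max z (v : 'cV[R]_n.+1) `^ a)%:E)).
- by apply: ratio_max_moment => // j; rewrite mxE; have [] := hCov.
- apply/measurable_EFinP; exact: (measurableT_comp (@measurable_powR R a) (measurable_ratio_max z)).
- by move=> v; rewrite lee_fin powR_ge0.
Qed.

Lemma exponent1 (s : S) (z : R) : 0 < z ->
  exponent (fun _ : 'I_1 => s) (const_mx z) = (m_const a * z `^ (- a))%:E.
Proof.
move=> z0; rewrite exponent_unit; last 2 first.
- by move=> j; rewrite mxE.
- rewrite (_ : cov_matrix _ _ = 1%:M) ?unitmx1 //.
  by apply/matrixP => i j; rewrite !ord1 !mxE eqxx; have [] := hCov.
by rewrite big_ord1 /t_cdf eqxx mulr1 mxE.
Qed.

Lemma exponent_lty n (s : 'I_n -> S) (z : 'cV[R]_n) : (forall j, 0 < z j 0) -> (exponent s z < +oo)%E.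
Proof.
move=> z0; pose h (j : 'I_n) w := (ratio_max (const_mx (z j 0) : 'cV[R]_1) (sites (fun _ : 'I_1 => s j) 0%N w : 'cV[R]_1) `^ a)%:E.
have mh j : measurable_fun setT (h j).
  apply/measurable_EFinP; apply: (measurableT_comp (@measurable_powR R a)); exact: measurable_ratio_sites.
apply: (@le_lt_trans _ _ (\int[P]_w (\sum_j h j w))%E).
  apply: ge0_le_integral => //.
  - by move=> w _; rewrite lee_fin powR_ge0.
  - by apply/measurable_EFinP; apply: (measurableT_comp (@measurable_powR R a)); exact: measurable_ratio_sites.
  - exact: emeasurable_sum.
  move=> w _; rewrite sumEFin lee_fin.
  have hE j : ratio_max (const_mx (z j 0) : 'cV[R]_1) (sites (fun _ : 'I_1 => s j) 0%N w : 'cV[R]_1) = Num.max (W 0%N (s j) w / z j 0) 0.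
    by rewrite /ratio_max /index_enum; unlock; rewrite big_ord_recl big_ord0 !mxE.
  have s0 : 0 <= \sum_j ratio_max (const_mx (z j 0) : 'cV[R]_1) (sites (fun _ : 'I_1 => s j) 0%N w : 'cV[R]_1) `^ a.
    by apply: sumr_ge0 => j _; exact: powR_ge0.
  have [->|[j jE]] := ratio_max_attained z (sites s 0%N w : 'cV[R]_n); first by rewrite powR0 ?gt_eqF.
  rewrite (bigD1 j) //=; apply: ler_wpDr; first by apply: sumr_ge0 => i _; exact: powR_ge0.
  rewrite hE (_ : Num.max _ _ = ratio_max z (sites s 0%N w : 'cV[R]_n)) //.
  have wj : (sites s 0%N w : 'cV[R]_n) j 0 = W 0%N (s j) w by rewrite /sites mxE.
  by rewrite jE wj; apply/max_idPl; rewrite -wj -jE; exact: ratio_max_ge0.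
rewrite ge0_integral_sum //; last by move=> j w _; rewrite lee_fin powR_ge0.
apply: lte_sum_pinfty => j _.
by have := exponent1 (s j) (z0 j); rewrite /exponent => ->; exact: ltry.
Qed.

Lemma indep_points_sites n (s : 'I_n -> S) (z : 'cV[R]_n) m (A : 'I_m -> set (measurableTypeR R)) (c : 'I_m -> R) :
  (forall i, measurable (A i)) ->
  P ((\bigcap_(i : 'I_m) [set w | A i (V i w)]) `&`
     \bigcap_(i : 'I_m) [set w | c i * ratio_max z (sites s i w : 'cV[R]_n) <= 1]) =
  (P (\bigcap_(i : 'I_m) [set w | A i (V i w)]) *
   (\prod_i fine (P [set w | c i * ratio_max z (sites s 0%N w : 'cV[R]_n) <= 1]%R))%:E)%E.
Proof.
move=> mA.
pose B (x : R) : set (cVb R n) := [set v | x * ratio_max z (v : 'cV[R]_n) <= 1].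
have mB x : measurable (B x).
  have mx : measurable_fun setT (fun v : cVb R n => x * ratio_max z (v : 'cV[R]_n) : measurableTypeR R).
    by apply: measurable_funM => //; exact: measurable_ratio_max.
  exact: (measurable_sublevel _ (mx)).
rewrite hVW; last 2 first.
- apply: sigma_generated_bigcap => i; apply: sub_gen_smallest; exists (nat_of_ord i) => //.
  by exists (A i); [exact: mA|rewrite setTI].
- apply: sigma_generated_bigcap => i.
  exact: (@sigma_generated_vector _ _ T R (fun q : nat * S => W q.1 q.2 : T -> R) n (fun j => (nat_of_ord i, s j)) _ (mB (c i))).
congr (_ * _)%E.
(* Independence of the fields is stated for finite sets of natural numbers; the events are extended
   to all indices by sure events. *)
pose E (i : nat) : set T := if insub i is Some o then sites s i @^-1` B (c o) else setT.
have EE (i : 'I_m) : E i = sites s i @^-1` B (c i) by rewrite /E valK.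
rewrite (_ : \bigcap_i _ = \bigcap_(i in [set` iota 0 m]) E i); last first.
  apply/seteqP; split => w h i.
    rewrite /= mem_iota add0n => /andP[_ im].
    have Ei : E i = sites s i @^-1` B (c (Ordinal im)) := EE (Ordinal im).
    by rewrite Ei; exact: (h (Ordinal im) Logic.I).
  move=> _; have : E i w by apply: h; rewrite /= mem_iota add0n /=.
  by rewrite EE.
rewrite (mutually_independent_seq hW_indep (iota_uniq 0 m)); last first.
  move=> i; rewrite mem_iota add0n => /andP[_ im].
  rewrite (_ : E i = sites s (Ordinal im) @^-1` B (c (Ordinal im))); last exact: (EE (Ordinal im)).
  exact: (@sigma_generated_vector _ _ T R (fun t => W i t : T -> R) n s _ (mB (c (Ordinal im)))).
rewrite (_ : iota 0 m = index_iota 0 m) ?[RHS]/index_iota ?subn0 // -prodEFin big_mkord; apply: eq_bigr => i _.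
rewrite EE sites_law_eq // fineK // fin_num_measure //.
exact: measurable_preimage_cV (measurable_sites s 0%N) (mB _).
Qed.

Lemma sites_le n (s : 'I_n -> S) (z : 'cV[R]_n) i w (x : R) : (forall j, 0 < z j 0) -> 0 < x ->
  (x * ratio_max z (sites s i w : 'cV[R]_n) <= 1) <-> (forall j, x * W i (s j) w <= z j 0).
Proof.
move=> z0 x0; rewrite mulrC -ler_pdivlMr // ratio_max_le // ?divr_ge0 ?(ltW x0) //.
have E j : (sites s i w : 'cV[R]_n) j 0 = W i (s j) w by rewrite /sites mxE.
by split=> h j; have := h j; rewrite E div1r ler_pdivlMl.
Qed.

Lemma points_le_prob n (s : 'I_n -> S) (z : 'cV[R]_n) : (forall j, 0 < z j 0) ->
  P (\bigcap_i [set w | forall j, V i w * W i (s j) w <= z j 0]) = (expR (- fine (exponent s z)))%:E.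
Proof.
move=> z0; have [Lam [LE [Ltail Lint]]] := powR_intensity_exists a0.
have hV' : poisson_process V Lam.
  by rewrite (_ : (Lam : set R -> \bar R) = intensity_measure (fun v => a * v `^ (- (a + 1)))) //; apply/funext.
have mM i := measurable_ratio_sites s z i.
have M0 i w : 0 <= ratio_max z (sites s i w : 'cV[R]_n) by exact: ratio_max_ge0.
have LT t : 0 < t -> (Lam `]t, +oo[%classic < +oo)%E by move=> t0; rewrite Ltail // ltry.
have IE := Lint _ T P _ (mM 0%N) (M0 0%N).
have := @void_probability _ T R P V Lam hV' LT (fun i w => ratio_max z (sites s i w : 'cV[R]_n)) mM M0
  (fun m A c mA => indep_points_sites s z c mA) (fun v => Num.max v 0).
(* The positive part replaces the identity because [void_probability] wants a function that is
   nonnegative on the whole line; the points being positive, nothing changes for them. *)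
have mmax : measurable_fun setT (fun v : measurableTypeR R => Num.max v 0 : R).
  exact: measurable_maxr.
have IE' : (\int[Lam]_(v in `]0%R, +oo[) P [set w | 1 < Num.max v 0 * ratio_max z (sites s 0%N w : 'cV[R]_n)]%R = exponent s z)%E.
  rewrite /exponent -IE; apply: eq_integral => v; rewrite mem_setE in_itv /= andbT => v0.
  by rewrite max_l // ltW.
move=> /(_ mmax); rewrite IE' => H.
rewrite -H; last 2 first.
- by move=> v; rewrite le_max lexx orbT.
- exact: exponent_lty.
congr (P _); apply: eq_bigcapr => i _; apply/seteqP; split => w /=.
  by move=> /(sites_le s i w z0 (points_gt0 i w)); rewrite max_l ?(ltW (points_gt0 i w)).
by rewrite max_l ?(ltW (points_gt0 i w)) // => /(sites_le s i w z0 (points_gt0 i w)).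
Qed.

(** The exponent [J n] of the points up to 1 / (n + 1) is the total exponent minus the part [I n]
    above that level. The total is finite and [I n] increases to it, so [J n] tends to 0. *)
Lemma small_points_le_prob (s : S) (c : R) : 0 < c ->
  (fun n => P (\bigcap_i [set w | V i w <= n.+1%:R^-1 -> V i w * W i s w <= c])) @ \oo --> 1%E.
Proof.
move=> c0; have [Lam [LE [Ltail Lint]]] := powR_intensity_exists a0.
have hV' : poisson_process V Lam.
  by rewrite (_ : (Lam : set R -> \bar R) = intensity_measure (fun v => a * v `^ (- (a + 1)))) //; apply/funext.
pose z : 'cV[R]_1 := const_mx c; pose s1 (_ : 'I_1) := s.
have z0 j : 0 < z j 0 by rewrite mxE.
have mM i := measurable_ratio_sites s1 z i.
have M0 i w : 0 <= ratio_max z (sites s1 i w : 'cV[R]_1) by exact: ratio_max_ge0.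
have LT t : 0 < t -> (Lam `]t, +oo[%classic < +oo)%E by move=> t0; rewrite Ltail // ltry.
pose g (v : measurableTypeR R) := P [set w | 1 < v * ratio_max z (sites s1 0%N w : 'cV[R]_1)].
have mg : measurable_fun setT g := measurable_scaled_tail P (mM 0%N).
have g0 v : (0 <= g v)%E by [].
have tot_fin : (\int[Lam]_(v in `]0%R, +oo[) g v < +oo)%E.
  by rewrite (Lint _ T P _ (mM 0%N) (M0 0%N)); exact: exponent_lty.
pose r n : R := n.+1%:R^-1.
have r0 n : 0 < r n by rewrite invr_gt0.
pose psi n (v : measurableTypeR R) : R := Num.max v 0 * \1_(`]-oo, r n]%classic) v.
have mpsi n : measurable_fun setT (psi n).
  apply: measurable_funM; last exact: measurable_indic.
  exact: measurable_maxr.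
have psi0 n v : 0 <= psi n v by rewrite mulr_ge0 // le_max lexx orbT.
pose J n : \bar R := (\int[Lam]_(v in `]0%R, r n]) g v)%E.
pose I n : \bar R := (\int[Lam]_(v in `]r n, +oo[) g v)%E.
have J0 n : (0 <= J n)%E by exact: integral_ge0.
have I0 n : (0 <= I n)%E by exact: integral_ge0.
have JI n : (J n + I n = \int[Lam]_(v in `]0%R, +oo[) g v)%E.
  rewrite -ge0_integral_setU //; last 2 first.
  - exact: measurable_funTS.
  - apply/disj_setPS => v [/=]; rewrite !in_itv /= andbT => /andP[_ h1] h2.
    by have := lt_le_trans h2 h1; rewrite ltxx.
  congr (integral Lam _ g); apply/seteqP; split => v /=; rewrite !in_itv /= !andbT.
    by case=> [/andP[] //|]; apply: lt_trans.
  by move=> v0; have [h|h] := leP v (r n); [left; rewrite v0|right].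
have Jfin n : (J n < +oo)%E by apply: le_lt_trans tot_fin; rewrite -(JI n) leeDl.
have Ifin n : (I n < +oo)%E by apply: le_lt_trans tot_fin; rewrite -(JI n) leeDr.
have JE n : (\int[Lam]_(v in `]0%R, +oo[) P [set w | 1 < psi n v * ratio_max z (sites s1 0%N w : 'cV[R]_1)]%R = J n)%E.
  rewrite /J ge0_integral_mul_indic [RHS]ge0_integral_mul_indic; apply: eq_integral => v _.
  rewrite /psi !indicE; have [vr|vr] := leP v (r n).
    rewrite mem_set /= ?in_itv //= mulr1; have [v0|v0] := ltP 0 v.
      by rewrite !mem_set //= in_itv /= ?v0.
    by rewrite !memNset ?mule0 //= in_itv /= ?andbT; move: v0; rewrite leNgt => /negP // + /andP[].
  rewrite memNset /= ?in_itv /=; last by apply/negP; rewrite -ltNge.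
  rewrite mulr0 (_ : [set w | _] = set0) ?measure0 ?mul0e; last first.
    by apply/seteqP; split => w //=; rewrite mul0r ltr10.
  by rewrite memNset ?mule0 //= in_itv /= => /andP[_]; rewrite leNgt vr.
have PE n : P (\bigcap_i [set w | V i w <= r n -> V i w * W i s w <= c]) = (expR (- fine (J n)))%:E.
  have := @void_probability _ T R P V Lam hV' LT (fun i w => ratio_max z (sites s1 i w : 'cV[R]_1)) mM M0
    (fun m A c mA => indep_points_sites s1 z c mA) (psi n) (mpsi n) (psi0 n).
  rewrite JE => <- //; congr (P _); apply: eq_bigcapr => i _; apply/seteqP; split => w /= h.
    rewrite /psi max_l ?(ltW (points_gt0 i w)) // indicE; have [vr|vr] := leP (V i w) (r n).
      rewrite mem_set /= ?in_itv //= mulr1; apply/(sites_le s1 i w z0 (points_gt0 i w)) => j.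
      by rewrite mxE; exact: h.
    by rewrite memNset /= ?in_itv /= ?mulr0 ?mul0r ?ler01 //; apply/negP; rewrite -ltNge.
  move=> vr; move: h; rewrite /psi max_l ?(ltW (points_gt0 i w)) // indicE mem_set /= ?in_itv //= mulr1.
  by move/(sites_le s1 i w z0 (points_gt0 i w)) => /(_ ord0); rewrite mxE.
have CI : I @ \oo --> (\int[Lam]_(v in `]0%R, +oo[) g v)%E.
  have := @ge0_nondecreasing_set_cvg_integral _ _ R (fun n => `]r n, +oo[%classic : set (measurableTypeR R)) g Lam.
  rewrite (_ : \bigcup_i _ = `]0%R, +oo[%classic); last first.
    apply/seteqP; split => v /=; rewrite in_itv /= andbT.
      by case=> n _ /=; rewrite in_itv /= andbT; exact: lt_trans.
    move=> v0; have [n _ hn] := near_infty_natSinv_lt (PosNum v0).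
    by exists n => //=; rewrite in_itv /= andbT; exact: (hn n (leqnn n)).
  apply=> //; last by move=> n; exact: measurable_funTS.
  move=> n m nm; rewrite subsetEset => v /=; rewrite !in_itv /= !andbT; apply: le_lt_trans.
  by rewrite lef_pV2 ?posrE // ler_nat.
have fJ n : fine (J n) = fine (\int[Lam]_(v in `]0%R, +oo[) g v)%E - fine (I n).
  have : fine (J n + I n)%E = fine (J n) + fine (I n) by rewrite fineD ?ge0_fin_numE.
  by rewrite JI => ->; rewrite addrK.
under eq_fun do rewrite PE.
apply/cvg_EFin; first by near=> n.
rewrite (_ : fine \o _ = fun n => expR (- (fine (\int[Lam]_(v in `]0%R, +oo[) g v)%E - fine (I n)))); last first.
  by apply/funext => n; rewrite /= fJ.
set tot := fine _.
rewrite (_ : 1 = expR (- (tot - tot))); last by rewrite subrr oppr0 expR0.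
apply: continuous_cvg; first exact: continuous_expR.
apply: cvgN; apply: cvgB; first exact: cvg_cst.
apply: fine_cvg; rewrite fineK // ge0_fin_numE //; exact: integral_ge0.
Unshelve. all: by end_near.
Qed.

(** For c > 0 all products are at most c with probability exp (- m_a c ^ (- a)). Every exp (- x)
    with x > 0 is of this form, so the probability sought is below all of them. *)
Lemma points_nonpos_null (s : S) : P (\bigcap_i [set w | V i w * W i s w <= 0]) = 0%E.
Proof.
have mVW i : measurable_fun setT (fun w => V i w * W i s w : measurableTypeR R).
  by apply: measurable_funM; exact: measurable_funPT.
have mle c i : measurable [set w | V i w * W i s w <= c].
  exact: (measurable_sublevel _ (mVW i)).
have le x : 0 < x -> (P (\bigcap_i [set w | V i w * W i s w <= 0]%R) <= (expR (- x))%:E)%E.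
  move=> x0; have m0 := m_const_gt0 a0.
  pose c := (x / m_const a) `^ (- a^-1).
  have c0 : 0 < c by rewrite powR_gt0 // divr_gt0.
  have := @points_le_prob 1 (fun=> s) (const_mx c) (fun j => _ : 0 < const_mx c j 0).
  rewrite exponent1 // /= => H.
  have cE : m_const a * c `^ (- a) = x.
    rewrite /c -powRrM mulrNN mulVf ?gt_eqF // powRr1; last by rewrite divr_ge0 ?ltW.
    by rewrite mulrC divfK // gt_eqF.
  rewrite -cE -H; last by move=> j; rewrite mxE.
  apply: le_measure; rewrite ?inE; [exact: bigcap_measurableType| |].
    apply: bigcap_measurableType => i _; rewrite (_ : [set w | _] = [set w | V i w * W i s w <= c]) //.
    by apply/seteqP; split => w /=; [move/(_ ord0); rewrite mxE|move=> h j; rewrite mxE].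
  by move=> w h i _ j; rewrite mxE; apply: le_trans (h i Logic.I) (ltW c0).
set p := P _ in le *.
have p0 : (0 <= p)%E by exact: measure_ge0.
have p1 : (p <= 1)%E by apply: probability_le1; exact: bigcap_measurableType.
have pfin : p \is a fin_num by rewrite ge0_fin_numE // (le_lt_trans p1) // ltry.
apply/eqP; rewrite eq_le p0 andbT leNgt; apply/negP => pp.
have fp : 0 < fine p by rewrite fine_gt0 // pp (le_lt_trans p1) // ltry.
have l0 : ln (fine p) <= 0 by rewrite -ln1 ler_ln ?posrE // -lee_fin fineK.
have h : fine p <= expR (-1) * fine p.
  (* If p were positive, the bound at x = 1 - ln p would read p <= p / e. *)
  have x0 : 0 < 1 - ln (fine p) by rewrite subr_gt0 (le_lt_trans l0).
  by have := le _ x0; rewrite -[p in (p <= _)%E]fineK // lee_fin opprB addrC expRD lnK ?posrE.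
have e1 : expR (-1) < 1 :> R by rewrite -[1 in ltRHS]expR0 ltr_expR oppr_lt0.
by move: h; rewrite leNgt gtr_pMl ?e1.
Qed.

(** Some product is positive, hence above some 1 / (k + 1). Points below a suitable level only yield
    products at most 1 / (k + 1), and the points above that level are finitely many. The maximum is
    thus attained on an initial segment of the enumeration, which is not assumed to be ordered. *)
Lemma max_attained_ae (s : S) : {ae P, forall w, exists i, 0 < V i w * W i s w /\
  forall k, V k w * W k s w <= V i w * W i s w}.
Proof.
have mVW i : measurable_fun setT (fun w => V i w * W i s w : measurableTypeR R).
  by apply: measurable_funM; exact: measurable_funPT.
have mle c i : measurable [set w | V i w * W i s w <= c].
  exact: (measurable_sublevel _ (mVW i)).
have A1 : {ae P, forall w, exists i, 0 < V i w * W i s w}.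
  exists (\bigcap_i [set w | V i w * W i s w <= 0]); split.
  - exact: bigcap_measurableType.
  - exact: points_nonpos_null.
  - by move=> w /= h i _ /=; rewrite leNgt; apply/negP => h2; apply: h; exists i.
have A2 : {ae P, forall w, forall k, exists n, forall i, V i w <= n.+1%:R^-1 -> V i w * W i s w <= k.+1%:R^-1}.
  apply: ae_foralln => k.
  have k0 : 0 < k.+1%:R^-1 :> R by rewrite invr_gt0.
  pose E n := \bigcap_i [set w | V i w <= n.+1%:R^-1 -> V i w * W i s w <= k.+1%:R^-1].
  have mE n : measurable (E n).
    apply: bigcap_measurableType => i _.
    rewrite (_ : [set w | _] = ~` [set w | `]-oo, n.+1%:R^-1]%classic (V i w)] `|` [set w | V i w * W i s w <= k.+1%:R^-1]).
      by apply: measurableU => //; apply: measurableC; exact: measurable_preimage_RV.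
    apply/seteqP; split => w /=; rewrite in_itv /=; last by case=> // h /h.
    by move=> h; have [/h|] := pselect (is_true (V i w <= n.+1%:R^-1)); [right|left].
  exists (~` \bigcup_n E n); split.
  - by apply: measurableC; exact: bigcup_measurable.
  - apply: etrans (probability_setC P _) _; first exact: bigcup_measurable.
    rewrite [P _](_ : _ = 1%E) ?subee //.
    apply/eqP; rewrite eq_le probability_le1 /=; last exact: bigcup_measurable.
    apply: (cvge_to_le (small_points_le_prob s k0)); near=> n.
    apply: le_measure; rewrite ?inE; [exact: mE|exact: bigcup_measurable|].
    by move=> w h; exists n.
  - by move=> w /= h [n _ h2]; apply: h; exists n => i; exact: (h2 i Logic.I).
have A3 : {ae P, forall w, forall n, exists j : nat, point_count (fun i => V i : T -> R) `]n.+1%:R^-1, +oo[%classic w = j%:R%:E}.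
  apply: ae_foralln => n; have [Lam [LE [Ltail _]]] := powR_intensity_exists a0.
  have hV' : poisson_process V Lam.
    by rewrite (_ : (Lam : set R -> \bar R) = intensity_measure (fun v => a * v `^ (- (a + 1)))) //; apply/funext.
  have n0 : 0 < n.+1%:R^-1 :> R by rewrite invr_gt0.
  apply: (point_count_fin_ae hV') => //.
    by move=> v /=; rewrite !in_itv /= !andbT; exact: lt_trans.
  by rewrite Ltail // ltry.
apply: filterS3 A1 A2 A3 => w [i0 hi0] h2 h3.
have [k _ hk] := near_infty_natSinv_lt (PosNum hi0).
have {}hk : k.+1%:R^-1 < V i0 w * W i0 s w by exact: (hk k (leqnn k)).
have [n hn] := h2 k; have [j hj] := h3 n.
have [n0 _ hn0] := point_count_stationary hj.
(* From n0 on the partial counts no longer change, so no later point exceeds the level. *)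
have out i : (n0 <= i)%N -> V i w <= n.+1%:R^-1.
  move=> ni; rewrite leNgt; apply/negP => hv.
  have := hn0 i.+1 (leq_trans ni (leqnSn i)); rewrite /= big_ord_recr /= (hn0 i ni) mem_set /=; last first.
    by rewrite in_itv /= hv.
  by move/eqP; rewrite -[X in _ == X]addn0 eqn_add2l.
have i0n : (i0 < n0)%N.
  by rewrite ltnNge; apply/negP => /out /hn; rewrite leNgt hk.
pose im := [arg max_(i > Ordinal i0n) (V i w * W i s w)]%O.
have imax (i : 'I_n0) : V i w * W i s w <= V im w * W im s w.
  by rewrite /im; case: arg_maxP => // l _ h; exact: h.
exists im; split; first by apply: lt_le_trans (imax (Ordinal i0n)).
move=> l; have [ln|ln] := ltnP l n0; first exact: (imax (Ordinal ln)).
apply: le_trans (imax (Ordinal i0n)); apply: le_trans (ltW hk); apply: hn; exact: out.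
Unshelve. all: by end_near.
Qed.

Local Notation Z := (max_process a (fun i => V i : T -> R) (fun i s => W i s : T -> R)).
Local Notation c := (m_const a `^ (- a^-1)).

Lemma norming_gt0 : 0 < c. Proof. by rewrite powR_gt0 // m_const_gt0. Qed.

Lemma measurable_max_process s : measurable_fun setT (Z s : T -> measurableTypeR R).
Proof.
apply: measurable_funM => //; apply: measurable_real_sup => i.
by apply: measurable_funM; exact: measurable_funPT.
Qed.

(** Positivity is recorded as well: it settles nonpositive thresholds and allows passing between Z ^
    a <= z and Z <= z ^ (1 / a). *)
Lemma max_process_le_ae n (s : 'I_n -> S) : {ae P, forall w, forall j, 0 < Z (s j) w /\
  forall y, Z (s j) w <= y <-> forall i, V i w * W i (s j) w <= c^-1 * y}.
Proof.
apply: filter_forall => j; apply: filterS (max_attained_ae (s j)) => w [i [i0 imax]].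
have E : sup (range (fun k => V k w * W k (s j) w)) = V i w * W i (s j) w.
  apply/eqP; rewrite eq_le; apply/andP; split.
    by apply: ge_sup; [exists (V i w * W i (s j) w), i|move=> _ [k _ <-]; exact: imax].
  apply: ub_le_sup; last by exists i.
  by exists (V i w * W i (s j) w) => _ [k _ <-]; exact: imax.
have c0 := norming_gt0.
rewrite /max_process E; split; first exact: mulr_gt0.
move=> y; rewrite -ler_pdivlMl //; split=> [h k|]; last by move/(_ i).
by apply: le_trans h; exact: imax.
Qed.

Lemma measurable_max_process_le n (s : 'I_n -> S) (y : 'I_n -> R) :
  measurable [set w | forall j, Z (s j) w <= y j].
Proof.
have -> : [set w | forall j, Z (s j) w <= y j] = \bigcap_j [set w | Z (s j) w <= y j].
  by rewrite forall_bigcap.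
apply: measurable_bigcap_fin => j.
exact: (measurable_sublevel _ (measurable_max_process (s j))).
Qed.

Lemma max_process_cdf n (s : 'I_n -> S) (y : 'I_n -> R) : (forall j, 0 < y j) ->
  P [set w | forall j, Z (s j) w <= y j] = (expR (- fine (exponent s (c^-1 *: \col_j y j))))%:E.
Proof.
move=> y0; rewrite -points_le_prob; last first.
  by move=> j; rewrite !mxE mulr_gt0 // invr_gt0 norming_gt0.
apply: probability_ae_iff; first exact: measurable_max_process_le.
  apply: bigcap_measurableType => i _.
  have -> : [set w | forall j, V i w * W i (s j) w <= (c^-1 *: \col_j y j) j 0] =
      \bigcap_j [set w | V i w * W i (s j) w <= (c^-1 *: \col_j y j) j 0].
    by rewrite forall_bigcap.
  apply: measurable_bigcap_fin => j.
  have m : measurable_fun setT (fun w => V i w * W i (s j) w : measurableTypeR R).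
    by apply: measurable_funM; exact: measurable_funPT.
  exact: (measurable_sublevel _ (m)).
apply: filterS (max_process_le_ae s) => w H; split => /= h.
  by move=> i _ j; rewrite !mxE; move: i; apply/(proj2 (H j)); exact: h.
move=> j; apply/(proj2 (H j)) => i.
by have := h i Logic.I j; rewrite !mxE.
Qed.

Lemma max_process_cdf0 n (s : 'I_n -> S) (y : 'I_n -> R) j : y j <= 0 ->
  P [set w | forall j, Z (s j) w <= y j] = 0%E.
Proof.
move=> yj; rewrite -(measure0 P); apply: probability_ae_iff => //; first exact: measurable_max_process_le.
apply: filterS (max_process_le_ae s) => w H; split => //= h.
by have [+ _] := H j; rewrite ltNge (le_trans (h j) yj).
Qed.

Lemma exponentZ n (s : 'I_n -> S) (l : R) (z : 'cV[R]_n) : 0 < l ->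
  exponent s (l *: z) = ((l `^ (- a))%:E * exponent s z)%E.
Proof.
move=> l0; rewrite /exponent -ge0_integralZl //; last 3 first.
- by apply/measurable_EFinP; apply: (measurableT_comp (@measurable_powR R a)); exact: measurable_ratio_sites.
- by move=> w _; rewrite lee_fin powR_ge0.
- by rewrite lee_fin powR_ge0.
apply: eq_integral => w _; rewrite -EFinM; congr EFin.
by rewrite ratio_maxZ // powRM ?invr_ge0 ?(ltW l0) ?ratio_max_ge0 // -powR_inv1 ?(ltW l0) // -powRrM mulN1r.
Qed.

(** The inverse of [m_const a] appearing here cancels the factor [m_const a] of the exponent. *)
Lemma norming_powR (x : R) : 0 < x -> (c^-1 * x) `^ (- a) = (m_const a)^-1 * x `^ (- a).
Proof.
move=> x0; have c0 := norming_gt0.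
rewrite powRM ?invr_ge0 ?(ltW c0) ?(ltW x0) //; congr (_ * _).
rewrite -powR_inv1 ?(ltW c0) // -!powRrM mulN1r opprK mulNr mulVf ?gt_eqF // powR_inv1 //.
exact: ltW (m_const_gt0 a0).
Qed.

Lemma max_process_frechet : frechet_margins P a Z.
Proof.
move=> s z z0.
have := @max_process_cdf 1 (fun=> s) (fun=> z) (fun=> z0).
have -> : [set w | forall j : 'I_1, Z s w <= z] = [set w | Z s w <= z].
  by apply/seteqP; split => w //= /(_ ord0).
have -> : c^-1 *: (\col__ z : 'cV[R]_1) = const_mx (c^-1 * z) by apply/matrixP => i j; rewrite !mxE.
rewrite exponent1 ?mulr_gt0 ?invr_gt0 ?norming_gt0 // norming_powR // mulVKf ?gt_eqF ?m_const_gt0 //.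
Qed.

(** A constant y > 0 would make the event Z <= y / 2 null, although its Frechet probability is
    positive; a constant y <= 0 is excluded by positivity. *)
Lemma max_process_nondegenerate s : Defs.nondegenerate P (Z s).
Proof.
move=> [y hy].
have mle x : measurable [set w | Z s w <= x].
  exact: (measurable_sublevel _ (measurable_max_process s)).
have meq : measurable [set w | Z s w = y].
  have := measurable_max_process s measurableT (measurable_set1 y).
  by rewrite setTI.
have [y0|y0] := leP y 0.
  have := @max_process_cdf0 1 (fun=> s) (fun=> y) ord0 y0.
  have -> : [set w | forall j : 'I_1, Z s w <= y] = [set w | Z s w <= y].
    by apply/seteqP; split => w //= /(_ ord0).
  move=> h; have : (P [set w | Z s w = y] <= P [set w | Z s w <= y]%R)%E.
    by apply: le_measure; rewrite ?inE // => w /= ->.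
  by rewrite h hy lee_fin ler10.
have y20 : 0 < y / 2 by rewrite divr_gt0.
have : (P [set w | Z s w <= y / 2]%R <= P (~` [set w | Z s w = y]))%E.
  apply: le_measure; rewrite ?inE //; first exact: measurableC.
  move=> w /= h E; move: h; rewrite E leNgt ltr_pdivrMr // => /negP; apply.
  by rewrite ltr_pMr // ltr1n.
have -> : P (~` [set w | Z s w = y]) = 0%E.
  by apply: etrans (probability_setC P meq) _; rewrite [X in (_ - X)%E]hy subee.
rewrite (_ : P _ = (expR (- (y / 2) `^ (- a)))%:E); last exact: max_process_frechet.
by rewrite lee_fin leNgt expR_gt0.
Qed.

(** Scaling the thresholds by m ^ (1 / a) divides the exponent by m, which the m-th power undoes. If
    some threshold is not positive, both sides are 0, again because m > 0. *)
Lemma max_process_homogeneous n (s : 'I_n -> S) (y : 'I_n -> R) m : (0 < m)%N ->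
  (P [set w | forall j, Z (s j) w <= m%:R `^ a^-1 * y j]%R ^+ m)%E = P [set w | forall j, Z (s j) w <= y j]%R.
Proof.
move=> m0; have m0R : 0 < m%:R :> R by rewrite ltr0n.
have k0 : 0 < m%:R `^ a^-1 :> R by rewrite powR_gt0.
have [y0|] := pselect (forall j, 0 < y j); last first.
  move=> /existsNP[j /negP]; rewrite -leNgt => yj.
  have kyj : m%:R `^ a^-1 * y j <= 0 by rewrite mulr_ge0_le0 // ltW.
  rewrite [RHS](@max_process_cdf0 n s y j yj) [X in (X ^+ _)%E](@max_process_cdf0 n s (fun j => m%:R `^ a^-1 * y j) j kyj).
  by rewrite -[0%E]/(0%:E) -EFin_expe expr0n eqn0Ngt m0.
have ky0 j : 0 < m%:R `^ a^-1 * y j by rewrite mulr_gt0.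
rewrite [RHS](max_process_cdf _ y0) [X in (X ^+ _)%E](max_process_cdf _ ky0) -EFin_expe -expRM_natl; congr (expR _)%:E.
rewrite (_ : \col_j _ = m%:R `^ a^-1 *: \col_j y j); last by apply/matrixP => i j; rewrite !mxE.
rewrite scalerA [_^-1 * _]mulrC -scalerA exponentZ // fineM //; last first.
  rewrite ge0_fin_numE; last by apply: integral_ge0 => w _; rewrite lee_fin powR_ge0.
  by apply: exponent_lty => j; rewrite !mxE mulr_gt0 // invr_gt0 norming_gt0.
rewrite [fine (_ `^ _)%:E]/= -powRrM [a^-1 * - a]mulrN mulVf ?gt_eqF // powR_inv1 ?(ltW m0R) //.
by rewrite mulrN mulVKf ?gt_eqF.
Qed.

Lemma max_process_max_stable : max_stable_process P Z.
Proof.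
move=> n s; split; [by move=> j; exact: measurable_max_process|by move=> j; exact: max_process_nondegenerate|].
(* The norming must be positive at m = 0 as well, where m ^ (1 / a) would vanish; m.-1.+1 equals m
   for every positive m. *)
exists (fun m _ => m.-1.+1%:R `^ a^-1), (fun _ _ => 0); split; first by move=> m j; rewrite powR_gt0.
move=> d' T' P' Y [Ylaw Yindep] m m0; rewrite prednK //.
set k := m%:R `^ a^-1; have k0 : 0 < k by rewrite powR_gt0 // ltr0n.
move=> U; have mU i j : measurable_fun setT (U i j : T' -> measurableTypeR R).
  by apply: measurable_funM => //; apply: measurable_funB => //; exact: measurable_funPT.
apply: same_law_cdf.
- move=> j; rewrite /index_enum; elim: (locked_with _ _) => [|i l IH].
    by under eq_fun do rewrite big_nil; exact: mU.
  by under eq_fun do rewrite big_cons; exact: measurable_maxr (mU _ _) IH.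
- by move=> j; exact: measurable_max_process.
move=> y; pose B : set (cVb R n.+1) := [set v | forall j, (v : 'cV[R]_n.+1) j 0 <= (\col_j (k * y j)) j 0].
have mB : measurable B := measurable_orthant _.
pose E i := random_vector (fun j => Y i j : T' -> R) @^-1` B.
have EP i : P' (E i) = P [set w | forall j, Z (s j) w <= k * y j].
  apply: etrans (Ylaw i B mB) _; congr (P _); apply/seteqP.
  by split => w /= h j; have := h j; rewrite !mxE.
rewrite (_ : [set w | _] = \bigcap_(i in [set` iota 0 m]) E i); last first.
  have UE i j w : U i j w <= y j <-> Y i j w <= k * y j.
    by rewrite /U subr0 mulrC ler_pdivrMr // mulrC.
  apply/seteqP; split => w /= h.
    move=> i; rewrite /= mem_iota add0n => /andP[_ im] j; rewrite !mxE; apply/UE.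
    have [_ H] := bigmax_leP _ _ _ _ (h j); exact: (H (Ordinal im)).
  move=> j; apply/bigmax_leP; split.
    by apply/UE; have := h 0%N; rewrite /= mem_iota add0n m0 => /(_ isT j); rewrite !mxE.
  by move=> i _; apply/UE; have := h i; rewrite /= mem_iota add0n ltn_ord => /(_ isT j); rewrite !mxE.
rewrite (mutually_independent_seq Yindep (iota_uniq 0 m)); last first.
  by move=> i _; exact: (@sigma_generated_vector _ _ T' R (fun j => Y i j : T' -> R) _ id _ mB).
rewrite (eq_bigr (fun=> P [set w | forall j, Z (s j) w <= k * y j])) // big_const_seq count_predT size_iota.
rewrite -[RHS](max_process_homogeneous s y m0) -/k.
by elim: (m) => [//|l IH]; rewrite iterS IH expeS.
Qed.

Lemma max_process_dependence n (s : 'I_n.+1 -> S) (z : 'cV[R]_n.+1) : cov_matrix Cov s \in unitmx ->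
  (forall j, 0 < z j 0) ->
  dependence_function P a (fun j => Z (s j)) z = extremal_t_dependence a (cov_matrix Cov s) z.
Proof.
(* For positive Z, Z ^ a <= z means Z <= z ^ (1 / a). *)
move=> uS z0; pose y j := z j 0 `^ a^-1.
have y0 j : 0 < y j by rewrite powR_gt0.
have c0 := norming_gt0.
have cy0 j : 0 < c^-1 * y j by rewrite mulr_gt0 // invr_gt0.
rewrite /dependence_function (_ : P _ = P [set w | forall j, Z (s j) w <= y j]); last first.
  apply: probability_ae_iff; [|exact: measurable_max_process_le|].
    have -> : [set w | forall j, Z (s j) w `^ a <= z j 0] = \bigcap_j [set w | Z (s j) w `^ a <= z j 0].
      by rewrite forall_bigcap.
    apply: measurable_bigcap_fin => j.
    have m := measurableT_comp (@measurable_powR R a) (measurable_max_process (s j)).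
    exact: (measurable_sublevel _ (m)).
  apply: filterS (max_process_le_ae s) => w H; split => /= h j; have [Z0 _] := H j.
    have := @ge0_ler_powR _ a^-1 _ _ _ _ _ (h j).
    rewrite -powRrM divff ?gt_eqF // powRr1 ?(ltW Z0) //; apply; rewrite ?invr_ge0 ?nnegrE ?powR_ge0 ?ltW //.
  have := @ge0_ler_powR _ a _ _ _ _ _ (h j).
  by rewrite /y -powRrM mulVf ?gt_eqF // powRr1 ?(ltW (z0 j)) //; apply; rewrite ?nnegrE ?powR_ge0 ?ltW.
rewrite (max_process_cdf _ y0) /= expRK opprK exponent_unit //; last by move=> j; rewrite !mxE.
rewrite [LHS]/= mulr_sumr; apply: eq_bigr => j _ /=.
rewrite !mxE norming_powR // !mulrA mulfV ?gt_eqF ?m_const_gt0 // mul1r.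
have -> : y j `^ (- a) = (z j 0)^-1.
  by rewrite /y -powRrM mulrN mulVf ?gt_eqF // powR_inv1 // ltW.
rewrite (_ : map_mx _ (row' j (_ *: _)) = map_mx (fun x => (x / z j 0) `^ a^-1) (row' j z)) //.
(* The norming constant cancels in the ratios of thresholds, leaving (z_l / z_j) ^ (1 / a). *)
apply/matrixP => i l; rewrite !mxE /y -mulf_div divff ?invr_eq0 ?gt_eqF // mul1r.
have zV : (z j 0)^-1 `^ a^-1 = (z j 0 `^ a^-1)^-1.
  by rewrite -(powR_inv1 (ltW (z0 j))) -powRrM mulN1r powRN.
by rewrite ord1 -zV -powRM ?invr_ge0 //; exact: ltW.
Qed.

End max_process.

Theorem corollary3p1 (R : realType) (d : measure_display)
    (T : measurableType d) (P : probability T R)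
    (p : nat) (hp : (0 < p)%N) (S : set 'rV[R]_p)
    (hS0 : S !=set0) (hS : borel S)
    (alpha : R) (halpha : 0 < alpha)
    (Cov : S -> S -> R) (hCov : correlation_function Cov)
    (hCov_unit : forall (n : nat) (s : 'I_n -> S), injective s ->
       cov_matrix Cov s \in unitmx)
    (W : nat -> S -> {RV P >-> R})
    (hW : forall i, centered_gaussian_field Cov (W i))
    (hW_indep : mutually_independent P
       (fun i => sigma_generated (fun s => W i s : T -> R)))
    (V : nat -> {RV P >-> R})
    (hV : poisson_process V
       (intensity_measure (fun v => alpha * v `^ (- (alpha + 1)))))
    (hVW : independent2 P
       (sigma_generated (fun i => V i : T -> R))
       (sigma_generated (fun q : nat * S => W q.1 q.2 : T -> R))) :
  let Z := max_process alpha (fun i => V i : T -> R)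
             (fun i s => W i s : T -> R) in
  (forall s : S, {ae P, forall w, exists i, forall k,
     V k w * W k s w <= V i w * W i s w}) /\
  extremal_t_process P alpha alpha Cov Z.
Proof.
move=> Z; split.
  move=> s; have := max_attained_ae halpha hCov hW hW_indep hV hVW s.
  by apply: filterS => w [i [_ imax]]; exists i.
split.
- exact: max_process_max_stable halpha hCov hW hW_indep hV hVW.
- exact: max_process_frechet halpha hCov hW hW_indep hV hVW.
- move=> n s sinj z z0.
  exact: (max_process_dependence halpha hCov hW hW_indep hV hVW (hCov_unit _ _ sinj) z0).
Qed.
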